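(* Let $X_1,X_2,\ldots$ be i.i.d. strictly positive random variables with finite expectation, let $W_1,W_2,\ldots$ be i.i.d. strictly positive random variables with finite expectation, independent of $(X_i)$, and let $c>0$. Set $\bar X_k:=X_k-cW_k$ with distribution function $F_{\bar X}$, and assume $a:=\mathbb{E}[\bar X_k]<0$. Let $\bar S_0=0$, $\bar S_n=\bar X_1+\cdots+\bar X_n$, let $M=\sup_{n\ge0}\bar S_n$ with distribution function $F_M$, let $\tau_+=\inf\{n\ge1:\bar S_n>0\}$ (with $\inf\emptyset=\infty$), let $p=\mathbb{P}(\tau_+<\infty)$ (so $p<1$) and assume $p>0$. Let $G$ be the distribution function with $\overline{G}(x)=\mathbb{P}(\bar S_{\tau_+}>x\mid\tau_+<\infty)$, $x\ge0$, and let $$F_I(x)=1-\min\Big\{1,\int_x^\infty\overline{F_{\bar X}}(y)\,dy\Big\},\qquad x\ge0.$$ Assume additionally that $F_I\in\mathcal{OL}$ and that one of the following conditions holds: (i) $p(c_G+\varepsilon-1)<1$ for some $\varepsilon>0$, where $c_G=\limsup_{x\to\infty}\overline{G^{2*}}(x)/\overline{G}(x)$; (ii) $F_M\in\mathcal{OS}$; (iii) $F_I\in\mathcal{J}\cap\mathcal{K}^*$. Then the following assertions are equivalent: (1) $F_I\in\mathcal{J}$; (2) $G\in\mathcal{J}$; (3) $F_M\in\mathcal{J}$. Moreover, each one of (1), (2) or (3), combined with each one of (i), (ii) or (iii), implies (4) $\overline{F_M}\asymp\overline{G}\asymp\overline{F_I}$.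
   Context: Let $\mathcal{F}$ be the set of all distribution functions of nonnegative random variables with unbounded support. Write $\overline{H}=1-H$, and $H^{2*}$ for the convolution of $H$ with itself. For positive functions $f,g$ on $[0,\infty)$, $f\asymp g$ means $0<\liminf_{x\to\infty}f(x)/g(x)\le\limsup_{x\to\infty}f(x)/g(x)<\infty$. Classes of $H\in\mathcal{F}$: - $\mathcal{OL}$: $\limsup_{x\to\infty}\overline{H}(x+y)/\overline{H}(x)<\infty$ for every $y\in\mathbb{R}$. - $\mathcal{OS}$: $\limsup_{x\to\infty}\overline{H^{2*}}(x)/\overline{H}(x)<\infty$. - $\mathcal{K}^*$: $\lim_{x\to\infty}e^{\lambda x}\overline{H}(x)=\infty$ for all $\lambda>0$. - $\mathcal{J}$: for $Y_1,Y_2,\ldots$ i.i.d. with distribution function $H$ and for all $n\ge2$, $$\lim_{K\to\infty}\liminf_{x\to\infty}\frac{\mathbb{P}(\max(Y_1,\ldots,Y_n)>x-K,\;Y_1+\cdots+Y_n>x)}{\mathbb{P}(Y_1+\cdots+Y_n>x)}=1.$$ *)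

(* Defs.v *)
From HB Require Import structures.
From mathcomp Require Import all_boot all_order all_algebra finmap.
From mathcomp Require Import all_classical all_reals all_analysis measurable_realfun.

Set Implicit Arguments.
Unset Strict Implicit.
Unset Printing Implicit Defensive.

Import Order.TTheory GRing.Theory Num.Theory.
Import numFieldNormedType.Exports.

Local Open Scope classical_set_scope.
Local Open Scope ring_scope.

Section independence.
Context {R : realType} {d : measure_display} {T : measurableType d}.
Variable P : probability T R.

Definition mutually_independent (I : choiceType) (Y : I -> {RV P >-> R}) :=
  forall (J : {fset I}) (B : I -> set R), (forall i, measurable (B i)) ->
    P (\bigcap_(i in [set` J]) (Y i @^-1` B i)) =
    (\prod_(i <- J) P (Y i @^-1` B i))%E.

Definition identically_distributed (I : Type) (Y : I -> {RV P >-> R}) :=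
  forall (i j : I) (B : set R), measurable B ->
    distribution P (Y i) B = distribution P (Y j) B.

Definition iid (I : choiceType) (Y : I -> {RV P >-> R}) :=
  mutually_independent Y /\ identically_distributed Y.

Definition generated_sigma (I : Type) (Y : I -> {RV P >-> R}) : set (set T) :=
  <<s [set A | exists i (B : set R), measurable B /\ A = Y i @^-1` B] >>.

Definition independent_families (I J : Type)
    (Y : I -> {RV P >-> R}) (Z : J -> {RV P >-> R}) :=
  forall A B, generated_sigma Y A -> generated_sigma Z B ->
    P (A `&` B) = (P A * P B)%E.

Definition iid_with_df (I : choiceType) (Y : I -> {RV P >-> R}) (H : R -> R) :=
  mutually_independent Y /\ forall i x, cdf (Y i) x = (H x)%:E.

End independence.

Section distribution_functions.
Context {R : realType}.
Implicit Types H : R -> R.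

Definition is_df H :=
  [/\ {homo H : x y / x <= y}, right_continuous H,
      H x @[x --> -oo] --> (0 : R) & H x @[x --> +oo] --> (1 : R)].

Section stieltjes_measure.
Variables (H : R -> R) (dfH : is_df H).

(* [H] itself; the phantom dependency on [dfH] lets the structure
   [cumulativeBounded] of the library be attached to it. *)
Definition df_cumulative of is_df H : R -> R := H.

Let df_nd : {homo df_cumulative dfH : x y / x <= y}.
Proof. by case: dfH. Qed.

Let df_rc : right_continuous (df_cumulative dfH).
Proof. by case: dfH. Qed.

Let df_Ny : df_cumulative dfH @ -oo --> (0 : R).
Proof. by case: dfH. Qed.

Let df_y : df_cumulative dfH @ +oo --> (1 : R).
Proof. by case: dfH. Qed.

HB.instance Definition _ :=
  isCumulative.Build R _ R (df_cumulative dfH) df_nd df_rc.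

HB.instance Definition _ :=
  isCumulativeBounded.Build R 0 1 (df_cumulative dfH) df_Ny df_y.

End stieltjes_measure.

(* The law on the real line with distribution function [H]; the value when
   [H] is not a distribution function is irrelevant. *)
Definition law_of_df H : {measure set (measurableTypeR R) -> \bar R} :=
  match pselect (is_df H) with
  | left dfH => lebesgue_stieltjes_measure (df_cumulative dfH)
  | right _ => mzero
  end.

Definition tail H (x : R) : R := 1 - H x.

Definition convolution H1 H2 (x : R) : R :=
  fine (\int[law_of_df H2]_y (H1 (x - y))%:E)%E.

Definition limsup_ratio (f g : R -> R) : \bar R :=
  limf_esup (fun x => (f x / g x)%:E) +oo.

Definition liminf_ratio (f g : R -> R) : \bar R :=
  limf_einf (fun x => (f x / g x)%:E) +oo.

Definition asymp_equiv (f g : R -> R) :=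
  [/\ (0 < liminf_ratio f g)%E, (liminf_ratio f g <= limsup_ratio f g)%E
    & (limsup_ratio f g < +oo)%E].

(* Distribution functions of nonnegative variables with unbounded support. *)
Definition classF H :=
  [/\ is_df H, forall x, x < 0 -> H x = 0 & forall x, H x < 1].

Definition classOL H :=
  classF H /\
  forall y : R, (limsup_ratio (fun x => tail H (x + y)) (tail H) < +oo)%E.

Definition classOS H :=
  classF H /\ (limsup_ratio (tail (convolution H H)) (tail H) < +oo)%E.

Definition classKstar H :=
  classF H /\
  forall lambda : R, 0 < lambda ->
    expR (lambda * x) * tail H x @[x --> +oo] --> +oo.

(* The ratio depends only on the law of (Y_1, ..., Y_n), hence on [H] and [n],
   not on the space carrying the i.i.d. family. *)
Definition classJ H :=
  classF H /\
  forall n : nat, (2 <= n)%N ->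
  forall (d : measure_display) (T : measurableType d) (P : probability T R)
         (Y : 'I_n -> {RV P >-> R}),
  iid_with_df Y H ->
    liminf_ratio
      (fun x => fine (P [set w |
         ((x - K)%:E < \big[maxe/-oo]_(i < n) (Y i w)%:E)%E /\
         x < \sum_(i < n) Y i w]))
      (fun x => fine (P [set w | x < \sum_(i < n) Y i w]))
    @[K --> +oo] --> 1%E.

End distribution_functions.

Section random_walk.
Context {R : realType} {d : measure_display} {T : measurableType d}.
Variable P : probability T R.
Variables (X W : nat -> {RV P >-> R}) (c : R).

(* Indices are shifted: [X 0], [W 0], [Xbar 0] are the first variables. *)
Definition Xbar (k : nat) : {RV P >-> R} := X k \- c \o* W k.

Definition F_Xbar (x : R) : R := fine (cdf (Xbar 0) x).

Definition Sbar (n : nat) (w : T) : R := \sum_(k < n) Xbar k w.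

Definition supS (w : T) : \bar R := ereal_sup [set (Sbar n w)%:E | n in setT].

Definition F_M (x : R) : R := fine (P [set w | (supS w <= x%:E)%E]).

Definition tau_plus (w : T) : \bar R :=
  ereal_inf [set n%:R%:E | n in [set n : nat | (1 <= n)%N /\ 0 < Sbar n w]].

Definition p_ladder : R := fine (P [set w | (tau_plus w < +oo)%E]).

(* For [x < 0] the quotient equals 1, so that [G_ladder x = 0]. *)
Definition G_ladder (x : R) : R :=
  1 - fine (P [set w | exists n : nat, tau_plus w = n%:R%:E /\ x < Sbar n w])
      / p_ladder.

Definition F_I (x : R) : R :=
  if x < 0 then 0
  else 1 - fine (mine 1%E
    (\int[lebesgue_measure]_(y in `[x, +oo[) (tail F_Xbar y)%:E)%E).

End random_walk.

(* Main.v *)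
Require Import Defs.
From HB Require Import structures.
From mathcomp Require Import all_boot all_order all_algebra finmap.
From mathcomp Require Import all_classical all_reals all_analysis measurable_realfun.
From mathcomp Require Import ring lra.

(** The three distribution functions are compared through the tails of three laws
    on the line: [muI] with tail that of [F_I], [muG] the law of the first ladder
    height, and [muM] the law of the supremum.

    Membership in the class J is a property of the tail up to bounded factors. By
    [classJP] it holds for a law if and only if two independent copies are both
    large with a probability negligible against the tail, and shifting the tail by
    a constant costs a bounded factor. Both conditions pass to any law whose tail
    is bounded above and below by constant multiples of the given one
    ([one_big_jump_dominated]). So it is enough to show that the three tails are of the
    same order.

    The ladder height against the integrated tail. Summing over the first ladder
    epoch, [p] times the tail of [muG] at [x] is the integral, over the size [t] of a
    step, of the expected time spent above [x - t] before the walk becomes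
    positive ([ladder_sum_occ]). This occupation time is of linear order in
    [t - x]. It is at most linear because, at each epoch, the walk has a
    probability bounded below to fall by [eta] and not to come back
    ([occ_upper]); it is at least linear because the walk needs many steps of
    finite mean to get down to a given depth ([occ_lower]). Negative drift enters
    through [drop_positive]: the walk stays nonpositive for ever with positive
    probability, which also gives [p < 1]. The integral of [max 0 (t - x)] against
    the law of a step is the integrated tail, so the tails of [muG] and [muI] agree
    up to constants and a unit shift, and the class OL absorbs the shift
    ([comparable_laws]).

    The supremum against the ladder height. Decomposing at the first ladder epoch,
    [muM] is the mixture of the point mass at 0 and of the convolution of [muG] with
    [muM], with weights [1 - p] and [p]; in particular its tail is at least [p]
    times that of [muG]. For the upper bound, a positive function [V] with
    [p * G] applied to [V] at most [V] bounds the tail of [muM]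
    ([supersolution_bound]).
    - Under [cond_i], a large multiple of the tail of [muG], set to 1 on the negative
      half-line, is such a function ([kesten_bound]).
    - Under [cond_iii], [muG] has the one-big-jump property and a tail heavier than any
      exponential. A geometric series of shifted copies of the truncated tail of
      [muG] is then such a function, and its sum is of the order of the tail
      ([heavy_bound]).
    - Under [cond_ii], [muM] convolved with itself has a tail at most [C] times that of
      [muM]. Unrolling the mixture [n] times bounds the tail of [muM] by twice the
      tail of an [n]-fold convolution power of [muG] ([sum_bounded_powers]). If
      [muG] has the one-big-jump property, this power is dominated by [muG].
    If instead [muM] has the one-big-jump property, its convolution square satisfies
    the same bound,
    and the convolution power can be lowered one unit at a time
    ([powers_descent]) down to [muG]. *)

Set Implicit Arguments.
Unset Strict Implicit.
Unset Printing Implicit Defensive.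

Import Order.TTheory GRing.Theory Num.Theory.
Import numFieldNormedType.Exports.

Local Open Scope classical_set_scope.
Local Open Scope ring_scope.

(** * Tails of sums and of joint exceedances *)

Section product_of_laws.
Context {R : realType}.
Local Open Scope ereal_scope.

Definition sum_set (x : R) : set (R * R) := [set u | (x < u.1 + u.2)%R].

Definition both_set (K x : R) : set (R * R) :=
  [set u | [/\ (K < u.1)%R, (K < u.2)%R & (x < u.1 + u.2)%R]].

Lemma measurable_sum_set x : measurable (sum_set x).
Proof.
have mf : measurable_fun [set: R * R] (fun u : R * R => u.1 + u.2)%R.
  by apply: measurable_funD; [exact: measurable_fst|exact: measurable_snd].
have := mf measurableT _ (measurable_itv `]x, +oo[).
rewrite setTI; congr measurable; apply/seteqP; split=> u /=;
  by rewrite /sum_set /= in_itv/= andbT.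
Qed.

Lemma both_setE K x :
  both_set K x = (`]K, +oo[ `*` `]K, +oo[) `&` sum_set x.
Proof.
apply/seteqP; split=> u; rewrite /both_set /sum_set /=.
  by move=> [a b c]; rewrite !in_itv/= !andbT.
by rewrite !in_itv/= !andbT => -[[]].
Qed.

Lemma measurable_both_set K x : measurable (both_set K x).
Proof.
rewrite both_setE; apply: measurableI; last exact: measurable_sum_set.
by apply: measurableX; exact: measurable_itv.
Qed.

Lemma xsection_sum_set x y : xsection (sum_set x) y = `](x - y)%R, +oo[%classic.
Proof.
apply/seteqP; split=> z; rewrite /xsection /= inE /sum_set /= in_itv/= andbT;
  by rewrite ltrBlDl.
Qed.

Lemma ysection_sum_set x y : ysection (sum_set x) y = `](x - y)%R, +oo[%classic.
Proof.
apply/seteqP; split=> z; rewrite /ysection /= inE /sum_set /= in_itv/= andbT;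
  by rewrite ltrBlDr.
Qed.

Lemma xsection_both_set K x y : xsection (both_set K x) y =
  if (K < y)%R then `](Num.max K (x - y))%R, +oo[%classic else set0.
Proof.
apply/seteqP; split=> z; rewrite /xsection /= inE /both_set /=.
  by move=> [-> Kz h]; rewrite /= in_itv/= andbT gt_max Kz/= ltrBlDl.
case: ifPn => //= Ky; rewrite in_itv/= andbT gt_max => /andP[Kz h].
by split=> //; rewrite -ltrBlDl.
Qed.

Lemma ysection_both_set K x y : ysection (both_set K x) y =
  if (K < y)%R then `](Num.max K (x - y))%R, +oo[%classic else set0.
Proof.
apply/seteqP; split=> z; rewrite /ysection /= inE /both_set /=.
  by move=> [Kz -> h]; rewrite /= in_itv/= andbT gt_max Kz/= ltrBlDr.
case: ifPn => //= Ky; rewrite in_itv/= andbT gt_max => /andP[Kz h].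
by split=> //; rewrite -ltrBlDr.
Qed.

Lemma product_measure12 d1 d2 (T1 : measurableType d1) (T2 : measurableType d2)
  (m1 : {sigma_finite_measure set T1 -> \bar R})
  (m2 : {sigma_finite_measure set T2 -> \bar R}) A : measurable A ->
  (m1 \x m2) A = (m1 \x^ m2) A.
Proof.
move=> mA; apply: product_measure_unique => // B C mB mC.
exact: product_measure2E.
Qed.

End product_of_laws.

Section tails.
Context {R : realType}.
Implicit Types mu nu : probability R R.

Definition ptail mu (x : R) : R := fine (mu `]x, +oo[%classic).

Lemma ptailE mu x : mu `]x, +oo[%classic = (ptail mu x)%:E.
Proof. by rewrite /ptail fineK// fin_num_measure. Qed.

Lemma ptail_ge0 mu x : 0 <= ptail mu x.
Proof. by rewrite /ptail fine_ge0. Qed.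

Lemma ptail_le1 mu x : ptail mu x <= 1.
Proof. by rewrite -lee_fin -ptailE probability_le1. Qed.

Lemma ptail_le mu x y : x <= y -> ptail mu y <= ptail mu x.
Proof.
move=> xy; rewrite -lee_fin -!ptailE le_measure ?inE//.
by apply: subset_itvr; rewrite bnd_simp.
Qed.

Lemma measurable_ptail mu : measurable_fun [set: R] (ptail mu).
Proof. by apply: nonincreasing_measurable => // x y; exact: ptail_le. Qed.

Definition joint_law mu nu : probability (R * R)%type R := (mu \x nu)%E.

Definition sum_tail mu nu (x : R) : R := fine (joint_law mu nu (sum_set x)).

Definition both_tail mu nu (K x : R) : R := fine (joint_law mu nu (both_set K x)).

Lemma sum_tailE mu nu x : (mu \x nu)%E (sum_set x) = (sum_tail mu nu x)%:E.
Proof.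
rewrite /sum_tail fineK//; apply: fin_num_measure.
exact: measurable_sum_set.
Qed.

Lemma both_tailE mu nu K x :
  (mu \x nu)%E (both_set K x) = (both_tail mu nu K x)%:E.
Proof.
rewrite /both_tail fineK//; apply: fin_num_measure.
exact: measurable_both_set.
Qed.

Lemma sum_tail_int1 mu nu x :
  (sum_tail mu nu x)%:E = (\int[mu]_y (ptail nu (x - y))%:E)%E.
Proof.
rewrite -sum_tailE; apply: eq_integral => y _ /=.
by rewrite xsection_sum_set ptailE.
Qed.

Lemma sum_tail_int2 mu nu x :
  (sum_tail mu nu x)%:E = (\int[nu]_y (ptail mu (x - y))%:E)%E.
Proof.
rewrite -sum_tailE product_measure12; last exact: measurable_sum_set.
by apply: eq_integral => y _ /=; rewrite ysection_sum_set ptailE.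
Qed.

Lemma sum_tailC mu nu x : sum_tail mu nu x = sum_tail nu mu x.
Proof. by apply: EFin_inj; rewrite sum_tail_int1 -sum_tail_int2. Qed.

(** The two factors are replaced one after the other, each time by integrating
    the inequality between sections. All sections of the events considered
    below are half-lines, so comparing tails is enough. *)
Lemma product_measure_le mu mu' nu nu' (A : set (R * R)) (a b : R) :
  0 <= a -> 0 <= b -> measurable A ->
  (forall z, (mu (ysection A z) <= a%:E * mu' (ysection A z))%E) ->
  (forall y, (nu (xsection A y) <= b%:E * nu' (xsection A y))%E) ->
  ((mu \x nu) A <= (a * b)%:E * (mu' \x nu') A)%E.
Proof.
move=> a0 b0 mA hy hx.
apply: (@le_trans _ _ (b%:E * (mu \x nu') A)%E).
  rewrite /product_measure1 -ge0_integralZl//; last first.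
    exact: measurable_fun_xsection.
  apply: ge0_le_integral => //=.
  - exact: measurable_fun_xsection.
  - by apply: measurable_funeM; exact: measurable_fun_xsection.
rewrite mulrC EFinM -muleA lee_wpmul2l ?lee_fin//.
rewrite !product_measure12// /product_measure2 -ge0_integralZl//; last first.
  exact: measurable_fun_ysection.
apply: ge0_le_integral => //=.
- exact: measurable_fun_ysection.
- by apply: measurable_funeM; exact: measurable_fun_ysection.
Qed.

End tails.

(** * One big jump *)

Section one_big_jump.
Context {R : realType}.
Implicit Types mu nu : probability R R.

Lemma ptail_ysection_cmp mu mu' a : 0 <= a ->
  (forall x, ptail mu x <= a * ptail mu' x) ->
  forall K x z, (mu (ysection (both_set K x) z) <=
                 a%:E * mu' (ysection (both_set K x) z))%E.
Proof.
move=> a0 h K x z; rewrite ysection_both_set; case: ifPn => _.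
  by rewrite !ptailE -EFinM lee_fin.
by rewrite !measure0 mule0.
Qed.

Lemma both_tail_cmp mu mu' nu nu' a b K x : 0 <= a -> 0 <= b ->
  (forall x, ptail mu x <= a * ptail mu' x) ->
  (forall x, ptail nu x <= b * ptail nu' x) ->
  both_tail mu nu K x <= a * b * both_tail mu' nu' K x.
Proof.
move=> a0 b0 ha hb; rewrite -lee_fin EFinM -!both_tailE.
apply: product_measure_le => //.
- exact: measurable_both_set.
- by move=> z; exact: ptail_ysection_cmp.
- move=> y; have := ptail_ysection_cmp b0 hb K x y.
  by rewrite ysection_both_set xsection_both_set.
Qed.

Lemma sum_tail_cmp mu mu' nu nu' a b x : 0 <= a -> 0 <= b ->
  (forall x, ptail mu x <= a * ptail mu' x) ->
  (forall x, ptail nu x <= b * ptail nu' x) ->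
  sum_tail mu nu x <= a * b * sum_tail mu' nu' x.
Proof.
move=> a0 b0 ha hb; rewrite -lee_fin EFinM -!sum_tailE.
apply: product_measure_le => //.
- exact: measurable_sum_set.
- by move=> z; rewrite ysection_sum_set !ptailE -EFinM lee_fin.
- by move=> z; rewrite xsection_sum_set !ptailE -EFinM lee_fin.
Qed.

Lemma joint_lawX mu nu (A B : set R) : measurable A -> measurable B ->
  joint_law mu nu (A `*` B) = (mu A * nu B)%E.
Proof. by move=> mA mB; rewrite /joint_law/= product_measure1E. Qed.

Lemma joint_law_rays mu nu x y :
  joint_law mu nu (`]x, +oo[%classic `*` `]y, +oo[%classic) =
  (ptail mu x * ptail nu y)%:E.
Proof.
by rewrite joint_lawX ?EFinM ?ptailE//; exact: measurable_itv.
Qed.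

Lemma measurable_rays (x y : R) :
  measurable (`]x, +oo[%classic `*` `]y, +oo[%classic).
Proof. by apply: measurableX; exact: measurable_itv. Qed.

Lemma measurable_fst_ray (x : R) :
  measurable (`]x, +oo[%classic `*` [set: R]).
Proof. by apply: measurableX => //; exact: measurable_itv. Qed.

Lemma measurable_snd_ray (x : R) :
  measurable ([set: R] `*` `]x, +oo[%classic).
Proof. by apply: measurableX => //; exact: measurable_itv. Qed.

Lemma ptail_mul_le mu nu x m : ptail mu (x - m) * ptail nu m <= sum_tail mu nu x.
Proof.
rewrite -lee_fin -joint_law_rays -sum_tailE.
apply: le_measure; rewrite ?inE.
- exact: measurable_rays.
- exact: measurable_sum_set.
- move=> [y z] /= []; rewrite /= !in_itv/= !andbT /sum_set/= => h1 h2; lra.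
Qed.

(** If one summand is at most [K], the other one exceeds [x - K]. *)
Lemma sum_tail_le_both mu nu K x :
  sum_tail mu nu x <= both_tail mu nu K x + ptail mu (x - K) + ptail nu (x - K).
Proof.
rewrite -lee_fin !EFinD -both_tailE -sum_tailE.
have -> : (ptail mu (x - K))%:E =
    joint_law mu nu (`]x - K, +oo[%classic `*` [set: R]).
  by rewrite joint_lawX// ptailE [X in (_ * X)%E]probability_setT mule1.
have -> : (ptail nu (x - K))%:E =
    joint_law mu nu ([set: R] `*` `]x - K, +oo[%classic).
  by rewrite joint_lawX// ptailE [X in (X * _)%E]probability_setT mul1e.
have m1 := measurable_fst_ray (x - K).
have m2 := measurable_snd_ray (x - K).
have mb := measurable_both_set K x.
apply: (@le_trans _ _ (joint_law mu nu (both_set K x `|`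
    (`]x - K, +oo[%classic `*` [set: R]) `|`
    ([set: R] `*` `]x - K, +oo[%classic)))).
  apply: le_measure; rewrite ?inE.
  - exact: measurable_sum_set.
  - by apply: measurableU => //; exact: measurableU.
  - move=> [y z]; rewrite /sum_set /both_set /= !in_itv/= !andbT => h.
    have [Ky|Ky] := ltP K y; last by right; split => //; lra.
    have [Kz|Kz] := ltP K z; last by left; right; split => //; lra.
    by left; left; split.
apply: (le_trans (measureU2 _ _ _)) => //; first exact: measurableU.
by apply: leeD => //; apply: (le_trans (measureU2 _ _ _)).
Qed.

Definition small_jumps_set (K x : R) : set (R * R) :=
  [set u | [/\ (u.1 <= x - K)%R, (u.2 <= x - K)%R & (x < u.1 + u.2)%R]].

Lemma measurable_small_jumps_set K x : measurable (small_jumps_set K x).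
Proof.
have -> : small_jumps_set K x = (`]-oo, x - K]%classic `*`
    `]-oo, x - K]%classic) `&` sum_set x.
  apply/seteqP; split=> u; rewrite /small_jumps_set /sum_set /=.
    by move=> [a b c]; rewrite !in_itv/=.
  by rewrite !in_itv/= => -[[]].
apply: measurableI; last exact: measurable_sum_set.
by apply: measurableX; exact: measurable_itv.
Qed.

Definition small_jumps mu nu K x : R :=
  fine (joint_law mu nu (small_jumps_set K x)).

Lemma small_jumpsE mu nu K x :
  joint_law mu nu (small_jumps_set K x) = (small_jumps mu nu K x)%:E.
Proof.
rewrite /small_jumps fineK//; apply: fin_num_measure.
exact: measurable_small_jumps_set.
Qed.

(** If both summands exceed [L], then either both stay below [x - K], or one
    exceeds [x - K] while the other, independent of it, exceeds [L]; the last
    two cases carry a small factor when [L] is large. *)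
Lemma both_tail_le_small mu K L x :
  both_tail mu mu L x <= small_jumps mu mu K x + 2 * (ptail mu (x - K) * ptail mu L).
Proof.
rewrite (_ : 2 * _ = ptail mu (x - K) * ptail mu L + ptail mu L * ptail mu (x - K));
  last by ring.
rewrite -lee_fin 2!EFinD -small_jumpsE -!joint_law_rays -both_tailE addeA.
have m1 := measurable_rays (x - K) L.
have m2 := measurable_rays L (x - K).
have mb := measurable_small_jumps_set K x.
apply: (@le_trans _ _ (joint_law mu mu (small_jumps_set K x `|`
    (`]x - K, +oo[%classic `*` `]L, +oo[%classic) `|`
    (`]L, +oo[%classic `*` `]x - K, +oo[%classic)))).
  apply: le_measure; rewrite ?inE.
  - exact: measurable_both_set.
  - by apply: measurableU => //; exact: measurableU.
  - move=> [y z]; rewrite /both_set /small_jumps_set /= !in_itv/= !andbT.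
    move=> [Ly Lz h].
    have [Ky|Ky] := ltP (x - K) y; first by left; right.
    have [Kz|Kz] := ltP (x - K) z; first by right.
    by left; left; split.
apply: (le_trans (measureU2 _ _ _)) => //; first exact: measurableU.
by apply: leeD => //; apply: (le_trans (measureU2 _ _ _)).
Qed.

Lemma sum_tail_le_small mu K x :
  sum_tail mu mu x <= small_jumps mu mu K x + 2 * ptail mu (x - K).
Proof.
rewrite (_ : 2 * _ = ptail mu (x - K) + ptail mu (x - K)); last by ring.
rewrite -lee_fin 2!EFinD -small_jumpsE -sum_tailE addeA.
rewrite [X in (_ <= _ + X + _)%E](_ : _ =
    joint_law mu mu (`]x - K, +oo[%classic `*` [set: R])); last first.
  by rewrite joint_lawX// ptailE [X in (_ * X)%E]probability_setT mule1.
rewrite [X in (_ <= _ + X)%E](_ : _ =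
    joint_law mu mu ([set: R] `*` `]x - K, +oo[%classic)); last first.
  by rewrite joint_lawX// ptailE [X in (X * _)%E]probability_setT mul1e.
have m1 := measurable_fst_ray (x - K).
have m2 := measurable_snd_ray (x - K).
have mb := measurable_small_jumps_set K x.
apply: (@le_trans _ _ (joint_law mu mu (small_jumps_set K x `|`
    (`]x - K, +oo[%classic `*` [set: R]) `|`
    ([set: R] `*` `]x - K, +oo[%classic)))).
  apply: le_measure; rewrite ?inE.
  - exact: measurable_sum_set.
  - by apply: measurableU => //; exact: measurableU.
  - move=> [y z]; rewrite /sum_set /small_jumps_set /= !in_itv/= !andbT => h.
    have [Ky|Ky] := ltP (x - K) y; first by left; right.
    have [Kz|Kz] := ltP (x - K) z; first by right.
    by left; left; split.
apply: (le_trans (measureU2 _ _ _)) => //; first exact: measurableU.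
by apply: leeD => //; apply: (le_trans (measureU2 _ _ _)).
Qed.

Definition dominated mu nu := exists2 C, 0 < C & forall x, ptail mu x <= C * ptail nu x.

Definition shift_bounded mu := forall L, exists2 C, 0 < C &
  forall x, ptail mu (x - L) <= C * ptail mu x.

Definition both_negligible mu := forall eps, 0 < eps -> exists K x0,
  forall x, x0 <= x -> both_tail mu mu K x <= eps * ptail mu x.

Definition sum_bounded mu := exists2 C, 0 < C &
  forall x, sum_tail mu mu x <= C * ptail mu x.

(** The membership of a law in the class J, expressed with the tails of one
    and of two independent copies, in a form that visibly survives a change of
    the law by bounded factors. *)
Definition one_big_jump mu := both_negligible mu /\ shift_bounded mu.

(** To the left of [x0] the tail of [mu] is at least [ptail mu x0], so a bound
    valid far out becomes global at the price of a larger constant. *)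
Lemma everywhere_bound mu (f : R -> R) x0 C : (forall x, 0 < ptail mu x) ->
  (forall x, f x <= 1) -> (forall x, x0 <= x -> f x <= C * ptail mu x) ->
  exists2 C', 0 < C' & forall x, f x <= C' * ptail mu x.
Proof.
move=> mu0 f1 hf; exists (Num.max C (ptail mu x0)^-1).
  by rewrite lt_max invr_gt0 mu0 orbT.
move=> x; have [xx0|xx0] := leP x0 x.
  by apply: (le_trans (hf _ xx0)); rewrite ler_wpM2r ?ptail_ge0// le_max lexx.
apply: (le_trans (f1 x)); apply: (@le_trans _ _ ((ptail mu x0)^-1 * ptail mu x)).
  by rewrite ler_pdivlMl// mulr1 ptail_le// ltW.
by rewrite ler_wpM2r ?ptail_ge0// le_max lexx orbT.
Qed.

Lemma sum_tail_le1 mu nu x : sum_tail mu nu x <= 1.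
Proof.
rewrite -lee_fin -sum_tailE; apply: probability_le1; exact: measurable_sum_set.
Qed.

Lemma one_big_jump_sum mu : (forall x, 0 < ptail mu x) -> one_big_jump mu ->
  sum_bounded mu.
Proof.
move=> mu0 [bn sb].
have [K [x0 h]] := bn 1 ltr01; have [C C0 hC] := sb K.
apply: (@everywhere_bound _ _ x0 (1 + C + C)) => //.
  by move=> x; exact: sum_tail_le1.
move=> x /h hx; apply: (le_trans (sum_tail_le_both mu mu K x)).
by rewrite !mulrDl; apply: lerD; [apply: lerD|].
Qed.

Lemma one_big_jump_dominated mu nu : dominated mu nu -> dominated nu mu ->
  one_big_jump mu -> one_big_jump nu.
Proof.
move=> [a a0 ha] [b b0 hb] [bn sb]; split.
  move=> e e0; have e'0 : 0 < e / (b * b * a) by rewrite divr_gt0// !mulr_gt0.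
  have [K [x0 h]] := bn _ e'0; exists K, x0 => x /h hx.
  apply: (le_trans (both_tail_cmp K x (ltW b0) (ltW b0) hb hb)).
  apply: (@le_trans _ _ (b * b * (e / (b * b * a) * (a * ptail nu x)))).
    rewrite ler_wpM2l ?mulr_ge0 ?(ltW b0)//; apply: (le_trans hx).
    by rewrite ler_wpM2l// ltW.
  by rewrite le_eqVlt; apply/orP; left; apply/eqP; field; rewrite !gt_eqF.
move=> L; have [C C0 hC] := sb L; exists (b * C * a); first by rewrite !mulr_gt0.
move=> x; apply: (le_trans (hb _)); rewrite -!mulrA ler_wpM2l ?(ltW b0)//.
by apply: (le_trans (hC _)); rewrite ler_wpM2l ?(ltW C0).
Qed.

Lemma ptail_cvg0 mu : forall e, 0 < e -> exists K, ptail mu K <= e.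
Proof.
move=> e e0.
pose X : R -> R := idfun.
pose Xm := HB.pack_for {mfun R >-> R} X (@isMeasurableFun.Build _ _ _ _ X (@measurable_id _ _ setT)).
have := @cvg_ccdfy0 _ _ _ mu Xm.
move=> /fine_cvgP[_ /cvgrPdist_le/(_ _ e0)] [K [_ hK]]; exists (K + 1).
have := hK (K + 1) ltac:(by rewrite ltrDl).
rewrite /= sub0r normrN ger0_norm ?fine_ge0//.
Qed.

(** The hypothesis with [eps = 1/2] bounds the tail of the sum at [x] by
    [4 * ptail mu (x - K)]. Since the sum exceeds [x + K] when one summand
    exceeds [x - 1] and the other one [K + 1], unit shifts of the tail cost a
    bounded factor; by iteration all shifts do, and the tail of the sum is then
    bounded by that of a summand. The hypothesis for small [eps] and
    [both_tail_le_small] give the rest. *)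
Lemma small_jumps_one_big_jump mu : (forall x, 0 < ptail mu x) ->
  (forall eps, 0 < eps -> exists K x0, forall x, x0 <= x ->
     small_jumps mu mu K x <= eps * sum_tail mu mu x) ->
  one_big_jump mu.
Proof.
move=> mu0 h.
have h2 : (0 < 2^-1 :> R) by rewrite invr_gt0.
have [K [x0 hK]] := h _ h2.
have s4 x : x0 <= x -> sum_tail mu mu x <= 4 * ptail mu (x - K).
  by move=> /hK hx; have := sum_tail_le_small mu K x; lra.
have sh1 : exists2 C, 0 < C & forall x, ptail mu (x - 1) <= C * ptail mu x.
  apply: (@everywhere_bound _ (fun x => ptail mu (x - 1)) (x0 - K)
    (4 / ptail mu (K + 1))) => //; first by move=> x; exact: ptail_le1.
  move=> x xx; rewrite mulrAC ler_pdivlMr//.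
  have -> : x - 1 = (x + K) - (K + 1) by ring.
  apply: (le_trans (ptail_mul_le _ _ _ _)).
  have := s4 (x + K); rewrite addrK; apply; lra.
have sb : shift_bounded mu.
  have [C C0 hC] := sh1.
  have hn (n : nat) x : ptail mu (x - n%:R) <= C ^+ n * ptail mu x.
    elim: n x => [|n IH] x; first by rewrite subr0 mul1r.
    rewrite -natr1 opprD addrA; apply: (le_trans (hC _)).
    by rewrite exprS -mulrA ler_wpM2l ?(ltW C0).
  move=> L; exists (C ^+ (Num.truncn `|L|).+1); first by rewrite exprn_gt0.
  move=> x; apply: le_trans (hn _ _); apply: ptail_le.
  rewrite lerD2l lerN2; apply: (le_trans (ler_norm _)).
  by apply: ltW; rewrite truncnS_gt.
have [C C0 hC] := sb K.
split => // e e0.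
have [D D0 hD] : sum_bounded mu.
  apply: (@everywhere_bound _ _ x0 (4 * C)) => //.
    by move=> x; exact: sum_tail_le1.
  by move=> x /s4 hx; apply: (le_trans hx); rewrite -mulrA ler_wpM2l.
have e1 : 0 < e / (2 * D) by rewrite divr_gt0// mulr_gt0.
have [K1 [x1 h1]] := h _ e1.
have [C1 C10 hC1] := sb K1.
have e2 : 0 < e / (4 * C1) by rewrite divr_gt0// mulr_gt0.
have [L hL] := ptail_cvg0 mu e2.
exists L, x1 => x /h1 hx.
apply: (le_trans (both_tail_le_small mu K1 L x)).
have -> : e * ptail mu x = e / (2 * D) * (D * ptail mu x) +
    2 * (C1 * ptail mu x * (e / (4 * C1))).
  by field; rewrite !gt_eqF.
apply: lerD; first by apply: (le_trans hx); rewrite ler_wpM2l// ltW.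
by rewrite ler_wpM2l// ler_pM// ?ptail_ge0.
Qed.

End one_big_jump.

(** * Independence of generated sigma-algebras *)

Section independence_of_sigma_algebras.
Context {R : realType} {d : measure_display} {T : measurableType d}.
Variable P : probability T R.
Local Open Scope ereal_scope.

Definition indep_sets (G1 G2 : set (set T)) :=
  forall A B, G1 A -> G2 B -> P (A `&` B) = P A * P B.

Lemma indep_setsC G1 G2 : indep_sets G1 G2 -> indep_sets G2 G1.
Proof. by move=> h A B GA GB; rewrite setIC h// muleC. Qed.

(** For fixed [B], the measures sending [A] to [P (A `&` B)] and to [P A * P B]
    agree on the pi-system [G1], hence on the sigma-algebra it generates. *)
Lemma indep_sets_sigmal (G1 G2 : set (set T)) :
  G1 `<=` measurable -> G2 `<=` measurable -> setI_closed G1 -> G1 setT ->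
  indep_sets G1 G2 -> indep_sets <<s G1 >> G2.
Proof.
move=> mG1 mG2 IG1 G1T h A B sA GB.
have mB : measurable B := mG2 _ GB.
have b0 : (0 <= fine (P B))%R by rewrite fine_ge0.
pose r : {nonneg R} := NngNum b0.
have PB : P B = r%:num%:E by rewrite /= fineK// fin_num_measure.
rewrite muleC PB.
apply: (g_sigma_algebra_measure_unique G1 mG1 (fun=> setT) _ _
  (mrestr P mB) (mscale r P)) => //.
- by apply/seteqP; split=> // t _; exists O.
- by move=> C GC; rewrite /= /mrestr /mscale h// muleC PB.
- move=> _; rewrite /= /mrestr setTI; apply: (@le_lt_trans _ _ 1).
    exact: probability_le1.
  by rewrite ltry.
Qed.

Lemma indep_sets_sigma (G1 G2 : set (set T)) :
  G1 `<=` measurable -> G2 `<=` measurable -> setI_closed G1 -> G1 setT ->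
  setI_closed G2 -> G2 setT ->
  indep_sets G1 G2 -> indep_sets <<s G1 >> <<s G2 >>.
Proof.
move=> mG1 mG2 IG1 G1T IG2 G2T h.
apply: indep_setsC; apply: indep_sets_sigmal => //.
  by apply: smallest_sub => //; exact: sigma_algebra_measurable.
by apply: indep_setsC; exact: indep_sets_sigmal.
Qed.

Section families.
Variables (I : choiceType) (Y : I -> {RV P >-> R}).

Definition events_of (J : set I) : set (set T) :=
  [set A | exists i B, [/\ J i, measurable B & A = Y i @^-1` B]].

(** A pi-system that generates the same sigma-algebra as [events_of J]. *)
Definition cylinders (J : set I) : set (set T) :=
  [set A | exists (F : {fset I}) (B : I -> set R),
    [/\ [set` F] `<=` J, forall i, measurable (B i) &
        A = \bigcap_(i in [set` F]) (Y i @^-1` B i)]].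

(** The sample space with the sigma-algebra of the variables indexed by [J]: a
    set measurable for it is an event that depends on these variables only. *)
Definition history (J : set I) := g_sigma_algebraType (events_of J).

Lemma events_of_measurable J : events_of J `<=` measurable.
Proof. by move=> _ [i [B [_ mB ->]]]; exact: measurable_funPTI. Qed.

Lemma history_measurable J (A : set T) :
  measurable (A : set (history J)) -> measurable A.
Proof.
apply: smallest_sub; first exact: sigma_algebra_measurable.
exact: events_of_measurable.
Qed.

Lemma measurable_history J i : J i ->
  measurable_fun [set: history J] (Y i : history J -> R).
Proof.
move=> Ji _ B mB; rewrite setTI; apply: sub_sigma_algebra.
by exists i, B.
Qed.

Lemma history_sub J K (A : set T) : J `<=` K ->
  measurable (A : set (history J)) -> measurable (A : set (history K)).
Proof.
move=> JK; apply: smallest_sub; first exact: smallest_sigma_algebra.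
by move=> _ [i [B [Ji mB ->]]]; apply: sub_sigma_algebra; exists i, B; split => //; exact: JK.
Qed.

Lemma cylinders_measurable J : cylinders J `<=` measurable.
Proof.
move=> _ [F [B [_ mB ->]]]; rewrite bigcap_fset.
elim/big_ind: _ => //; first by move=> C D; exact: measurableI.
by move=> i _; exact: measurable_funPTI.
Qed.

Lemma cylindersT J : cylinders J setT.
Proof.
exists fset0, (fun=> setT); split => //.
by apply/seteqP; split=> // t _ i /=; rewrite inE.
Qed.

Lemma cylindersI J : setI_closed (cylinders J).
Proof.
move=> _ _ [F [B [FJ mB ->]]] [F' [B' [F'J mB' ->]]].
exists (F `|` F')%fset,
  (fun i => (if i \in F then B i else setT) `&` (if i \in F' then B' i else setT)).
split.
- by move=> i /=; rewrite in_fsetU => /orP[/FJ|/F'J].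
- by move=> i; apply: measurableI; case: ifPn.
- apply/seteqP; split=> t /=.
    move=> [h h'] i /= _; split; case: ifPn => //=; [exact: h|exact: h'].
  move=> h; split=> i /= Fi.
    have := h i; rewrite /= in_fsetU Fi => /(_ isT) []; rewrite /= => hB _.
  exact: hB.
have := h i; rewrite /= in_fsetU Fi orbT => /(_ isT) []; rewrite /= => _ hB.
exact: hB.
Qed.

Lemma events_of_cylinders J : events_of J `<=` cylinders J.
Proof.
move=> _ [i [B [Ji mB ->]]]; exists [fset i]%fset, (fun=> B); split => //.
  by move=> j /=; rewrite in_fset1 => /eqP ->.
apply/seteqP; split=> t /= h; last by apply: (h i); rewrite /= in_fset1.
by move=> j /=; rewrite in_fset1 => /eqP ->.
Qed.

Lemma sigma_cylinders J (A : set T) :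
  measurable (A : set (history J)) -> <<s cylinders J >> A.
Proof.
apply: smallest_sub; first exact: smallest_sigma_algebra.
by move=> B /events_of_cylinders; exact: sub_sigma_algebra.
Qed.

Hypothesis indY : mutually_independent Y.

Lemma indep_cylinders J K : J `&` K = set0 ->
  indep_sets (cylinders J) (cylinders K).
Proof.
move=> JK _ _ [F [B [FJ mB ->]]] [F' [B' [F'K mB' ->]]].
have dFF' i : i \in F -> i \in F' -> False.
  by move=> /FJ Ji /F'K Ki; have : (J `&` K) i by []; rewrite JK.
pose C i := if i \in F then B i else B' i.
have mC i : measurable (C i) by rewrite /C; case: ifPn.
have -> : \bigcap_(i in [set` F]) (Y i @^-1` B i) `&`
    \bigcap_(i in [set` F']) (Y i @^-1` B' i) =
    \bigcap_(i in [set` (F `|` F')%fset]) (Y i @^-1` C i).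
  apply/seteqP; split=> t /=.
    move=> [h h'] i /=; rewrite in_fsetU /C; case: ifPn => //= Fi.
      by move=> _; exact: h.
    exact: h'.
  move=> h; split=> i /= Fi; have := h i; rewrite /= in_fsetU Fi ?orbT /C.
    by rewrite Fi; exact.
  by case: ifPn => [/dFF'/(_ Fi)//|_]; exact.
rewrite !indY// (big_fsetID _ (fun i => i \in F))/=; congr (_ * _).
  rewrite [LHS](_ : _ = \prod_(i <- F) P (Y i @^-1` C i)).
    by rewrite big_seq_cond [RHS]big_seq_cond; apply: eq_bigr => i; rewrite andbT /C => ->.
  congr (\prod_(i <- _) _); congr enum_fset; apply/fsetP => i; rewrite !inE/=.
  by case: (i \in F); rewrite ?andbF.
rewrite [LHS](_ : _ = \prod_(i <- F') P (Y i @^-1` C i)).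
  rewrite big_seq_cond [RHS]big_seq_cond; apply: eq_bigr => i; rewrite andbT /C.
  by case: ifPn => // /dFF' h /h.
congr (\prod_(i <- _) _); congr enum_fset; apply/fsetP => i; rewrite !inE/=.
have := dFF' i; case: (i \in F); case: (i \in F') => //=; by [rewrite ?andbF|move=> /(_ isT isT)].
Qed.

Lemma indep_history J K (A B : set T) : J `&` K = set0 ->
  measurable (A : set (history J)) -> measurable (B : set (history K)) ->
  P (A `&` B) = P A * P B.
Proof.
move=> JK /sigma_cylinders sA /sigma_cylinders sB.
apply: (@indep_sets_sigma (cylinders J) (cylinders K)) => //.
- exact: cylinders_measurable.
- exact: cylinders_measurable.
- exact: cylindersI.
- exact: cylindersT.
- exact: cylindersI.
- exact: cylindersT.
- exact: indep_cylinders.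
Qed.

End families.
End independence_of_sigma_algebras.

Section law_on_event.
Context {R : realType} {d : measure_display} {T : measurableType d}.
Variable P : probability T R.
Local Open Scope ereal_scope.

Definition law_on (A : set T) of measurable A := fun (U : {mfun T >-> R})
  (B : set R) => P (A `&` U @^-1` B).

Section instances.
Variables (A : set T) (mA : measurable A) (U : {mfun T >-> R}).

Let law_onE : law_on mA U = pushforward (mrestr P mA) U.
Proof. by apply/funext => B; rewrite /law_on /pushforward /mrestr setIC. Qed.

Let law_on0 : law_on mA U set0 = 0.
Proof. by rewrite law_onE; exact: measure0. Qed.

Let law_on_ge0 B : 0 <= law_on mA U B.
Proof. by rewrite law_onE; exact: measure_ge0. Qed.

Let law_on_sigma_additive : semi_sigma_additive (law_on mA U).
Proof. by rewrite law_onE; exact: measure_semi_sigma_additive. Qed.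

HB.instance Definition _ := isMeasure.Build _ _ _ (law_on mA U)
  law_on0 law_on_ge0 law_on_sigma_additive.

Let law_on_fin : fin_num_fun (law_on mA U).
Proof.
move=> B mB; apply: fin_num_measure; apply: measurableI => //.
exact: measurable_funPTI.
Qed.

HB.instance Definition _ :=
  @Measure_isFinite.Build _ _ _ (law_on mA U) law_on_fin.

End instances.

Lemma indep_joint (A : set T) (mA : measurable A) (U V : {mfun T >-> R}) :
  (forall B C, measurable B -> measurable C ->
    P (A `&` U @^-1` B `&` V @^-1` C) = P (A `&` U @^-1` B) * P (V @^-1` C)) ->
  forall S, measurable S ->
  P (A `&` [set w | S (U w, V w)]) = (law_on mA U \x distribution P V) S.
Proof.
move=> h S mS.
have mUV : measurable_fun [set: T] (fun w => (U w, V w)).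
  exact: measurable_fun_pair.
rewrite (@product_measure_unique _ _ _ _ _ _ _
  (pushforward (mrestr P mA) (fun w => (U w, V w)))) //.
  by rewrite /pushforward /mrestr setIC.
move=> B C mB mC; rewrite /law_on /distribution /pushforward -h// /mrestr.
by congr (P _); apply/seteqP; split=> w /=; tauto.
Qed.

(** Here [V] is independent of the pair formed by the event [A] and [U], which
    may depend on each other. The two formulas are the sections of one
    half-plane along either coordinate. *)
Lemma indep_sum_law (A : set T) (mA : measurable A) (U V : {mfun T >-> R}) :
  (forall B C, measurable B -> measurable C ->
    P (A `&` U @^-1` B `&` V @^-1` C) = P (A `&` U @^-1` B) * P (V @^-1` C)) ->
  forall x,
  P (A `&` [set w | (x < U w + V w)%R]) =
    \int[law_on mA U]_u P (V @^-1` `](x - u)%R, +oo[%classic) /\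
  P (A `&` [set w | (x < U w + V w)%R]) =
    \int[distribution P V]_v P (A `&` U @^-1` `](x - v)%R, +oo[%classic).
Proof.
move=> h x; have e := indep_joint mA h (measurable_sum_set x).
rewrite [X in P (A `&` X)](_ : _ = [set w | sum_set x (U w, V w)]) // e; split.
  by apply: eq_integral => u _ /=; rewrite xsection_sum_set.
rewrite product_measure12; last exact: measurable_sum_set.
by apply: eq_integral => u _ /=; rewrite ysection_sum_set.
Qed.

End law_on_event.

(** * Upper and lower limits at infinity; laws with a given distribution function *)

Section limsup_liminf.
Context {R : realType}.
Local Open Scope ereal_scope.
Implicit Types (f : R -> \bar R) (a : \bar R).

Lemma limf_esup_lt_near f a : limf_esup f +oo%R < a -> \forall x \near +oo%R, f x < a.
Proof.
rewrite limf_esupE => /ereal_inf_lt[_ [V FV <-] h].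
apply: filterS FV => x Vx; apply: le_lt_trans h.
by apply: ereal_sup_ubound; exists x.
Qed.

Lemma near_limf_esup_le f a : (\forall x \near +oo%R, f x <= a) -> limf_esup f +oo%R <= a.
Proof.
move=> h; rewrite limf_esupE.
apply: ge_ereal_inf; exists (ereal_sup (f @` [set x | f x <= a])).
  by exists [set x | f x <= a].
by apply: ge_ereal_sup => _ [x /= fx <-].
Qed.

Lemma limf_einf_gt_near f a : a < limf_einf f +oo%R -> \forall x \near +oo%R, a < f x.
Proof.
rewrite /limf_einf lteNr => /limf_esup_lt_near.
by apply: filterS => x; rewrite /= lteN2.
Qed.

Lemma near_limf_einf_ge f a : (\forall x \near +oo%R, a <= f x) -> a <= limf_einf f +oo%R.
Proof.
move=> h; rewrite /limf_einf leeNr; apply: near_limf_esup_le.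
by apply: filterS h => x; rewrite /= leeN2.
Qed.

Lemma limf_einf_le_esup f : limf_einf f +oo%R <= limf_esup f +oo%R.
Proof.
rewrite limf_einfE limf_esupE; apply: ge_ereal_sup => _ [V FV <-].
apply: le_ereal_inf_tmp => _ [W FW <-].
have [x [Vx Wx]] := filter_ex (filterI FV FW).
apply: (@le_trans _ _ (f x)).
  by apply: ereal_inf_lbound; exists x.
by apply: ereal_sup_ubound; exists x.
Qed.

End limsup_liminf.

Section law_of_distribution_function.
Context {R : realType}.

(** [law_of_df H] is a measure on the copy of the line that carries the Stieltjes
    measures; its image under the identity is a law on the line itself. *)
Lemma law_of_df_spec (H : R -> R) : is_df H -> exists mu : probability R R,
  (forall x, ptail mu x = tail H x) /\
  (forall f : R -> \bar R, measurable_fun setT f -> (forall x, 0 <= f x)%E ->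
    \int[law_of_df H]_x f x = \int[mu]_x f x)%E.
Proof.
move=> dfH; rewrite /law_of_df; case: pselect => // h.
pose P : probability (measurableTypeR R) R := lebesgue_stieltjes_measure (df_cumulative h).
pose X : measurableTypeR R -> R := idfun.
pose Xm := HB.pack_for {mfun (measurableTypeR R) >-> R} X (@isMeasurableFun.Build _ _ _ _ X (@measurable_id _ _ setT)).
exists (distribution P Xm); split.
  move=> x; apply: EFin_inj; rewrite -ptailE.
  transitivity (1 - cdf (Xm : {RV P >-> R}) x)%E; first exact: ccdf_1_cdf.
  rewrite EFinB; congr (_ - _)%E.
  exact: (cdf_lebesgue_stieltjes_id (df_cumulative h) x).
by move=> f mf f0; rewrite ge0_integral_distribution.
Qed.

End law_of_distribution_function.

(** * The class J as a property of two summands *)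

Section independent_sums.
Context {R : realType} {d : measure_display} {T : measurableType d}.
Variable P : probability T R.

Definition mk_rv (f : T -> R) (mf : measurable_fun setT f) : {mfun T >-> R} :=
  HB.pack_for {mfun T >-> R} f (@isMeasurableFun.Build _ _ _ _ f mf).

Lemma ptail_distribution (X : {mfun T >-> R}) x :
  ptail (distribution P X) x = fine (P [set w | x < X w]).
Proof.
rewrite /ptail /distribution /pushforward; congr (fine (P _)).
by apply/seteqP; split => w /=; rewrite in_itv/= andbT.
Qed.

Lemma indep_rv_joint (U V : {mfun T >-> R}) :
  (forall B C, measurable B -> measurable C ->
    P (U @^-1` B `&` V @^-1` C) = (P (U @^-1` B) * P (V @^-1` C))%E) ->
  forall S, measurable S ->
  P [set w | S (U w, V w)] = joint_law (distribution P U) (distribution P V) S.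
Proof.
move=> h S mS; rewrite /joint_law /=.
have mUV : measurable_fun [set: T] (fun w => (U w, V w)).
  exact: measurable_fun_pair.
by rewrite (@product_measure_unique _ _ _ _ _ _ _
  (pushforward P (fun w => (U w, V w)))).
Qed.

Variables (I : choiceType) (Y : I -> {RV P >-> R}).
Hypothesis indY : mutually_independent Y.

Lemma measurable_seq_sum (s : seq I) (J : set I) : (forall i, i \in s -> J i) ->
  measurable_fun [set: history Y J] (fun w : history Y J => \sum_(i <- s) Y i w).
Proof.
elim: s => [|i s IH] h.
  by rewrite (_ : (fun _ => _) = cst 0)//; apply/funext => w; rewrite big_nil.
rewrite (_ : (fun _ => _) = (fun w => Y i w + \sum_(i <- s) Y i w)); last first.
  by apply/funext => w; rewrite big_cons.
apply: measurable_funD.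
  by apply: measurable_history; apply: h; rewrite inE eqxx.
by apply: IH => j js; apply: h; rewrite inE js orbT.
Qed.

Lemma history_measurable_fun (J : set I) (f : T -> R) :
  measurable_fun [set: history Y J] (f : history Y J -> R) ->
  measurable_fun [set: T] f.
Proof.
move=> mf _ B mB; rewrite setTI; apply: (@history_measurable _ _ _ P _ Y J).
by rewrite -[X in measurable X]setTI; exact: mf.
Qed.

Lemma measurable_seq_sumT (s : seq I) :
  measurable_fun setT (fun w => \sum_(i <- s) Y i w).
Proof. by apply: (@history_measurable_fun [set` s]); exact: measurable_seq_sum. Qed.

Definition seq_sum (s : seq I) : {mfun T >-> R} := mk_rv (measurable_seq_sumT s).

Lemma indep_head_sum i s : i \notin s -> forall B C, measurable B -> measurable C ->
  P (Y i @^-1` B `&` seq_sum s @^-1` C) =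
  (P (Y i @^-1` B) * P (seq_sum s @^-1` C))%E.
Proof.
move=> si B C mB mC; apply: (indep_history indY (J := [set i]) (K := [set` s])).
- by apply/seteqP; split=> // j /= [-> is_]; move: si; rewrite is_.
- rewrite -[X in measurable X]setTI; exact: (@measurable_history _ _ _ P _ Y [set i]).
- rewrite -[X in measurable X]setTI.
  exact: (@measurable_seq_sum s [set` s]).
Qed.

Lemma head_sum_joint i s : i \notin s -> forall S, measurable S ->
  P [set w | S (Y i w, \sum_(j <- s) Y j w)] =
  joint_law (distribution P (Y i)) (distribution P (seq_sum s)) S.
Proof.
by move=> si S mS; rewrite -indep_rv_joint//; exact: indep_head_sum.
Qed.

Lemma ptail_seq_sum_cons i s x : i \notin s ->
  ptail (distribution P (seq_sum (i :: s))) x =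
  sum_tail (distribution P (Y i)) (distribution P (seq_sum s)) x.
Proof.
move=> si; apply: EFin_inj; rewrite -sum_tailE -ptailE.
rewrite -[RHS](head_sum_joint si (measurable_sum_set x)).
rewrite /distribution /pushforward; congr (P _); apply/seteqP; split => w /=;
  by rewrite in_itv/= andbT big_cons.
Qed.

Lemma ptail_seq_sum0 x : ptail (distribution P (seq_sum [::])) x = (x < 0)%R%:R.
Proof.
rewrite ptail_distribution; case: ltP => x0.
  rewrite (_ : [set w | _] = setT) ?probability_setT//.
  by apply/seteqP; split => // w _ /=; rewrite big_nil.
rewrite (_ : [set w | _] = set0) ?measure0//.
by apply/seteqP; split => // w /=; rewrite big_nil ltNge x0.
Qed.

Variable mu : probability R R.
Hypothesis mu_neg : forall x, x < 0 -> ptail mu x = 1.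
Hypothesis mu_gt0 : forall x, 0 < ptail mu x.
Hypothesis sb : sum_bounded mu.
Hypothesis hY : forall i x, ptail (distribution P (Y i)) x = ptail mu x.

(** Each new summand costs one factor of [sum_bounded]. *)
Lemma seq_sum_dominated s : uniq s -> dominated (distribution P (seq_sum s)) mu.
Proof.
elim: s => [|i s IH] /=.
  move=> _; exists 1 => // x; rewrite ptail_seq_sum0 mul1r; case: ltP => x0.
    by rewrite mu_neg.
  exact: ptail_ge0.
move=> /andP[si /IH[C C0 hC]]; have [D D0 hD] := sb.
exists (C * D); first exact: mulr_gt0.
move=> x; rewrite ptail_seq_sum_cons//.
have h1 z : ptail (distribution P (Y i)) z <= 1 * ptail mu z by rewrite mul1r hY.
apply: (le_trans (sum_tail_cmp x ler01 (ltW C0) h1 hC)).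
by rewrite mul1r -mulrA ler_wpM2l// ltW.
Qed.

Lemma ptail_seq_sum_neg s x : uniq s -> x < 0 ->
  ptail (distribution P (seq_sum s)) x = 1.
Proof.
elim: s x => [|i s IH] x /=; first by rewrite ptail_seq_sum0 => _ ->.
move=> /andP[si us] x0; apply/eqP; rewrite eq_le ptail_le1/= ptail_seq_sum_cons//.
have h : x / 2 < 0 by lra.
have := ptail_mul_le (distribution P (Y i)) (distribution P (seq_sum s)) x (x / 2).
by rewrite (IH _ us h) mulr1 hY mu_neg//; lra.
Qed.

End independent_sums.

Lemma finite_union_bound {R : realType} {d : measure_display}
  {T : measurableType d} (P : probability T R) (I : Type) (s : seq I)
  (F : I -> set T) : (forall i, measurable (F i)) ->
  (P (\big[setU/set0]_(i <- s) F i) <= \sum_(i <- s) P (F i))%E.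
Proof.
move=> mF; elim: s => [|i s IH]; first by rewrite !big_nil measure0.
rewrite !big_cons; apply: (le_trans (measureU2 _ _ _)) => //.
  exact: bigsetU_measurable.
exact: leeD.
Qed.

Section J_characterization.
Context {R : realType}.

Lemma classF_tail (H : R -> R) (mu : probability R R) :
  classF H -> (forall x, ptail mu x = tail H x) ->
  (forall x, 0 < ptail mu x) /\ (forall x, x < 0 -> ptail mu x = 1).
Proof.
move=> [_ H0 H1] h; split=> x; first by rewrite h /tail subr_gt0.
by move=> x0; rewrite h /tail H0// subr0.
Qed.

Lemma iid_law d (T : measurableType d) (P : probability T R) (I : choiceType)
  (Y : I -> {RV P >-> R}) (H : R -> R) (mu : probability R R) :
  (forall x, ptail mu x = tail H x) -> iid_with_df Y H ->
  forall i x, ptail (distribution P (Y i)) x = ptail mu x.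
Proof.
move=> h [_ hY] i x; rewrite h /tail; apply: EFin_inj; rewrite -ptailE.
transitivity (1 - cdf (Y i) x)%E; first exact: ccdf_1_cdf.
by rewrite hY EFinB.
Qed.

Section one_big_jump_classJ.
Variables (H : R -> R) (mu : probability R R).
Hypotheses (FH : classF H) (muH : forall x, ptail mu x = tail H x).
Hypothesis obj : one_big_jump mu.
Variables (n : nat) (n2 : (2 <= n)%N).
Variables (d : measure_display) (T : measurableType d) (P : probability T R).
Variables (Y : 'I_n -> {RV P >-> R}) (iidY : iid_with_df Y H).

Let S (w : T) := \sum_(i < n) Y i w.
Let others (i : 'I_n) := [seq j <- index_enum 'I_n | j != i].

Let S_others i w : S w = Y i w + \sum_(j <- others i) Y j w.
Proof. by rewrite /S (bigD1 i)//= /others big_filter. Qed.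

Let i_others i : i \notin others i.
Proof. by rewrite mem_filter eqxx. Qed.

Let others_uniq i : uniq (others i).
Proof. by rewrite filter_uniq// index_enum_uniq. Qed.

Let mS : measurable_fun setT S.
Proof. exact: measurable_seq_sumT. Qed.

Let mSx x : measurable [set w | x < S w].
Proof.
rewrite (_ : [set w | _] = setT `&` S @^-1` `]x, +oo[%classic).
  by apply: mS => //; exact: measurable_itv.
by rewrite setTI; apply/seteqP; split=> w /=; rewrite in_itv/= andbT.
Qed.

Let max_big K x := [set w | ((x - K)%:E < \big[maxe/-oo]_(i < n) (Y i w)%:E)%E /\ x < S w].

Let max_bigE K x : max_big K x =
  [set w | x < S w] `&` \bigcup_(i in [set: 'I_n]) (Y i @^-1` `]x - K, +oo[%classic).
Proof.
apply/seteqP; split => w.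
  move=> [h Sx]; split => //; apply: contrapT => h'.
  suff : (\big[maxe/-oo]_(i < n) (Y i w)%:E <= (x - K)%:E)%E by rewrite leNgt h.
  apply/bigmax_leP; split=> [|i _]; first by rewrite leNye.
  rewrite lee_fin leNgt; apply/negP => hi; apply: h'; exists i => //=.
  by rewrite in_itv/= andbT.
move=> [Sx [i _ /=]]; rewrite in_itv/= andbT => hi; split => //.
by apply: (@lt_le_trans _ _ (Y i w)%:E); rewrite ?lte_fin//; exact: le_bigmax.
Qed.

Let mmax_big K x : measurable (max_big K x).
Proof.
rewrite max_bigE; apply: measurableI => //.
apply: fin_bigcup_measurable; first exact: finite_finset.
by move=> i _; apply: measurable_funPTI; exact: measurable_itv.
Qed.

Let mu_gt0 x : 0 < ptail mu x.
Proof. by have [+ _] := classF_tail FH muH; exact. Qed.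

Let mu_neg x : x < 0 -> ptail mu x = 1.
Proof. by have [_ +] := classF_tail FH muH; exact. Qed.

Let i0 : 'I_n := Ordinal (ltnW n2).

Let hY := iid_law muH iidY.
Let indY : mutually_independent Y := iidY.1.
Let sbmu : sum_bounded mu := one_big_jump_sum mu_gt0 obj.

Let split_tail i K x : fine (P [set w | both_set K x (Y i w, \sum_(j <- others i) Y j w)]) =
  both_tail (distribution P (Y i)) (distribution P (seq_sum Y (others i))) K x.
Proof.
rewrite (head_sum_joint indY)//; last exact: measurable_both_set.
Qed.

(** The sum exceeds [x] when one summand exceeds [x + 1] and the sum of the
    others exceeds [- 1], which is almost sure; bounded shifts absorb the 1. *)
Let PS_ge : exists2 C, 0 < C & forall x, ptail mu x <= C * fine (P [set w | x < S w]).
Proof.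
have [C C0 hC] := obj.2 1.
exists C => // x; have := hC (x + 1); rewrite addrK => /le_trans; apply.
rewrite ler_wpM2l ?(ltW C0)//.
apply: (@le_trans _ _ (sum_tail (distribution P (Y i0))
    (distribution P (seq_sum Y (others i0))) x)).
  have := ptail_mul_le (distribution P (Y i0))
    (distribution P (seq_sum Y (others i0))) x (-1).
  rewrite (ptail_seq_sum_neg indY mu_neg hY)//.
  by rewrite hY mulr1 opprK.
rewrite -lee_fin -sum_tailE -[X in (X <= _)%E](head_sum_joint indY)//; last exact: measurable_sum_set.
rewrite fineK ?fin_num_measure// le_eqVlt; apply/orP; left; apply/eqP.
congr (P _); apply/seteqP; split => w; rewrite /sum_set/=;
  by rewrite (S_others i0).
Qed.

(** Suppose that the sum exceeds [x] while no summand exceeds [x - K]. For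
    large [x] some [Y i] exceeds [K1], because the sum is large; the sum of the
    others then exceeds [K] too. So the pair formed by [Y i] and the sum of
    the others has two large entries, and the tail of that sum is dominated by
    the one of [mu]. *)
Let deficit e : 0 < e -> exists K0, forall K, K0 <= K -> exists x0, forall x, x0 <= x ->
  fine (P ([set w | x < S w] `\` max_big K x)) <= e * fine (P [set w | x < S w]).
Proof.
move=> e0; have [C C0 hC] := PS_ge.
have /boolp.choice[D hD] : forall i : 'I_n, exists D : R, 0 < D /\ forall x,
    ptail (distribution P (seq_sum Y (others i))) x <= D * ptail mu x.
  move=> i.
  by have [D D0 hD] := seq_sum_dominated indY mu_neg sbmu hY (others_uniq i); exists D.
(* each of the n events costs D i times the bound for mu *)
pose Dm := \sum_i D i.
have Dm0 : 0 < Dm.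
  rewrite /Dm (bigD1 i0)//= ltr_pwDl ?sumr_ge0//; first by have [] := hD i0.
  by move=> i _; have [/ltW] := hD i.
have e'0 : 0 < e / (C * Dm) by rewrite divr_gt0// mulr_gt0.
have [K1 [x1 h1]] := obj.1 _ e'0.
exists K1 => K K1K; exists (Num.max x1 (n%:R * `|K1|)) => x.
rewrite ge_max => /andP[x1x nKx].
pose B i := [set w | both_set K1 x (Y i w, \sum_(j <- others i) Y j w)].
have sub : [set w | x < S w] `\` max_big K x `<=` \big[setU/set0]_(i < n) B i.
  move=> w [/= Sx hm].
  have hle i : Y i w <= x - K.
    rewrite leNgt; apply/negP => hi; apply: hm; rewrite max_bigE; split => //=.
    by exists i => //=; rewrite in_itv/= andbT.
  have [i hi] : exists i, K1 < Y i w.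
    apply: contrapT => /forallNP hn.
    have : S w <= \sum_(i < n) K1 by apply: ler_sum => i _; rewrite leNgt; apply/negP/hn.
    rewrite sumr_const card_ord -mulr_natl => h.
    have : n%:R * K1 <= n%:R * `|K1| by rewrite ler_wpM2l// ler_norm.
    by move: Sx; lra.
  rewrite -bigcup_seq; exists i; first exact: mem_index_enum.
  split => //=; last by rewrite -S_others.
  by have := hle i; have := S_others i w; lra.
have mb i : measurable (B i).
  have mp : measurable_fun setT (fun w => (Y i w, \sum_(j <- others i) Y j w)).
    by apply: measurable_fun_pair => //; exact: measurable_seq_sumT.
  by rewrite -[X in measurable X]setTI; apply: mp => //; exact: measurable_both_set.
have PSx0 : 0 <= fine (P [set w | x < S w]) by rewrite fine_ge0.
rewrite -lee_fin fineK ?fin_num_measure//; last exact: measurableD.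
apply: (@le_trans _ _ (\sum_(i < n) P (B i))%E).
  apply: le_trans (finite_union_bound _ _ _) => //.
  apply: le_measure => //; rewrite inE; first exact: measurableD.
  by apply: bigsetU_measurable.
apply: (@le_trans _ _ (\sum_(i < n) (D i * (e / (C * Dm) * ptail mu x))%:E)%E).
  apply: lee_sum => i _; rewrite -[X in (X <= _)%E]fineK ?fin_num_measure//.
  rewrite split_tail lee_fin.
  have h i' z : ptail (distribution P (Y i')) z <= 1 * ptail mu z by rewrite mul1r hY.
  have [Di0 hDi] := hD i.
  apply: (le_trans (both_tail_cmp K1 x ler01 (ltW Di0) (h i) hDi)).
  by rewrite mul1r ler_wpM2l ?(ltW Di0)// h1.
rewrite sumEFin lee_fin -mulr_suml -/Dm.
apply: (@le_trans _ _ (Dm * (e / (C * Dm) * (C * fine (P [set w | x < S w]))))).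
  rewrite ler_wpM2l ?(ltW Dm0)// ler_wpM2l ?(ltW e'0)//; exact: hC.
by rewrite le_eqVlt; apply/orP; left; apply/eqP; field; rewrite !gt_eqF.
Qed.

Lemma one_big_jump_liminf :
  liminf_ratio (fun x => fine (P (max_big K x))) (fun x => fine (P [set w | x < S w])) @[K --> +oo] --> 1%E.
Proof.
pose Lr K := liminf_ratio (fun x => fine (P (max_big K x))) (fun x => fine (P [set w | x < S w])).
have [C C0 hC] := PS_ge.
have PSx x : 0 < fine (P [set w | x < S w]).
  by have := lt_le_trans (mu_gt0 x) (hC x); rewrite pmulr_rgt0.
have Pmax x K : fine (P (max_big K x)) = fine (P [set w | x < S w]) -
   fine (P ([set w | x < S w] `\` max_big K x)).
  have msub : max_big K x `<=` [set w | x < S w] by move=> w [].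
  rewrite measureD//; last by rewrite -ge0_fin_numE ?fin_num_measure.
  rewrite setIidr// fineB ?fin_num_measure//; by ring.
have up K : (Lr K <= 1)%E.
  apply: le_trans (limf_einf_le_esup _) _.
  apply: near_limf_esup_le; apply: nearW => x; rewrite lee_fin ler_pdivrMr// mul1r Pmax.
  by rewrite gerBl fine_ge0.
have lo e : 0 < e -> exists K0, forall K, K0 <= K ->
   ((1 - e)%:E <= Lr K)%E.
  move=> /deficit[K0 hK0]; exists K0 => K /hK0[x0 hx0].
  apply: near_limf_einf_ge; near=> x; rewrite lee_fin ler_pdivlMr// Pmax.
  rewrite mulrBl mul1r lerD2l lerN2; apply: hx0.
  by near: x; apply: nbhs_pinfty_ge; exact: num_real.
apply/fine_cvgP; split.
  have [K0 hK0] := lo 1 ltr01.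
  near=> K; rewrite fin_numElt; apply/andP; split.
    by apply: (@lt_le_trans _ _ (1 - 1)%:E); rewrite ?ltNyr//; apply: hK0; near: K; apply: nbhs_pinfty_ge; exact: num_real.
  by apply: le_lt_trans (up K) _; rewrite ltry.
apply/cvgrPdist_le => e e0; have [K0 hK0] := lo _ e0.
near=> K; have hK : K0 <= K by near: K; apply: nbhs_pinfty_ge; exact: num_real.
have := hK0 _ hK; have := up K.
rewrite -/(Lr K) [X in `|X|](_ : _ = 1 - fine (Lr K))//.
case: (Lr K) => [r| |] //=; rewrite !lee_fin => h1 h2.
by rewrite ler_norml; apply/andP; split; lra.
Unshelve. all: by end_near. Qed.

End one_big_jump_classJ.

Section classJ_one_big_jump.
Variables (H : R -> R) (mu : probability R R).
Hypotheses (muH : forall x, ptail mu x = tail H x).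

Let P2 : probability (R * R)%type R := joint_law mu mu.

(** The coordinates of the square: an i.i.d. pair with law [mu]. *)
Let coord (i : 'I_2) : {mfun (R * R)%type >-> R} :=
  if i == ord0 then mk_rv (@measurable_fst _ _ R R) else mk_rv (@measurable_snd _ _ R R).

Let law_coord i B : measurable B -> P2 (coord i @^-1` B) = mu B.
Proof.
move=> mB; rewrite /P2 /coord; case: ifP => _.
  rewrite (_ : _ @^-1` B = B `*` setT); last by apply/seteqP; split=> u /=; tauto.
  by rewrite joint_lawX// [X in (_ * X)%E]probability_setT mule1.
rewrite (_ : _ @^-1` B = setT `*` B); last by apply/seteqP; split=> u /=; tauto.
by rewrite joint_lawX// [X in (X * _)%E]probability_setT mul1e.
Qed.

Let coord_indep : mutually_independent (P := P2) coord.
Proof.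
move=> J B mB; pose C i := if i \in J then B i else setT.
have mC i : measurable (C i) by rewrite /C; case: ifP.
have -> : \bigcap_(i in [set` J]) (coord i @^-1` B i) = C ord0 `*` C ord_max.
  apply/seteqP; split => u.
    move=> h; split; rewrite /C; case: ifP => // iJ; exact: h _ iJ.
  move=> [h0 h1] i /= iJ; have [ii|ii] : i = ord0 \/ i = ord_max.
  - by case: i {iJ} => -[|[|//]] ?; [left|right]; exact: val_inj.
  - by move: h0 iJ; rewrite ii /C /coord /=; case: ifP.
  - by move: h1 iJ; rewrite ii /C /coord /=; case: ifP.
rewrite joint_lawX// (big_uniq _ (fset_uniq J))/= big_mkcond/=.
rewrite big_ord_recl big_ord1 (_ : lift ord0 ord0 = ord_max); last exact: val_inj.
rewrite /C; congr (_ * _)%E; case: ifP => _; rewrite ?law_coord ?probability_setT//.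
Qed.

Let coord_iid : is_df H -> iid_with_df (P := P2) coord H.
Proof.
move=> _; split; first exact: coord_indep.
move=> i x; rewrite /cdf /distribution /pushforward law_coord//.
have := @ccdf_1_cdf _ _ _ mu (mk_rv (@measurable_id _ R setT)) x.
rewrite /ccdf /cdf /distribution /pushforward !preimage_id ptailE muH /tail.
have : mu `]-oo, x]%classic \is a fin_num by rewrite fin_num_measure.
case: (mu `]-oo, x]%classic) => //= r _ [] h; congr (_%:E).
by apply: (@addrI _ 1); apply: oppr_inj; lra.
Qed.

(** For two summands, the event that the sum exceeds [x] while the maximum does
    not exceed [x - K] is [small_jumps_set K x]. *)
Lemma classJ_one_big_jump : classJ H -> one_big_jump mu.
Proof.
move=> [FH HJ]; have [mu_gt0 mu_neg] := classF_tail FH muH.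
have dfH : is_df H by case: FH.
have := HJ 2%N isT _ _ P2 coord (coord_iid dfH).
set Lr := (X in fmap X _ --> _) => cL.
apply: small_jumps_one_big_jump => // e e0.
have e'0 : ((1 - e)%:E < 1)%E by rewrite lte_fin; lra.
have [K0 [_ hK0]] : \forall K \near +oo, ((1 - e)%:E < Lr K)%E.
  move/fine_cvgP : cL => [fL /cvgrPdist_lt/(_ _ e0) dL].
  near=> K; have fK : Lr K \is a fin_num by near: K.
  rewrite -(fineK fK) lte_fin.
  have : `|1 - fine (Lr K)| < e by near: K.
  by rewrite ltr_norml => /andP[_]; lra.
have := hK0 (K0 + 1) ltac:(by rewrite ltrDl); set K := K0 + 1.
move=> /limf_einf_gt_near[x0 [_ hx0]].
exists K, (x0 + 1) => x x0x; have := hx0 x ltac:(lra).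
rewrite lte_fin.
have eS : [set w : R * R | x < \sum_(i < 2) coord i w] = sum_set x.
  by apply/seteqP; split => u /=; rewrite /sum_set /= big_ord_recl big_ord1 /coord/=.
set A := [set w | _ /\ _].
have PS0 : 0 < fine (P2 (sum_set x)).
  rewrite [fine _](_ : _ = sum_tail mu mu x)//.
  apply: lt_le_trans (ptail_mul_le mu mu x 0).
  exact: mulr_gt0.
have EA : A = sum_set x `\` small_jumps_set K x.
  apply/seteqP; split => u; rewrite /A /sum_set /small_jumps_set /=.
    rewrite !big_ord_recl !big_ord0 /coord /= maxeNy addr0 => -[hm hs].
    split => // -[h1 h2 _]; move: hm; rewrite ltNge ge_max !lee_fin.
    by rewrite h1 h2.
  rewrite !big_ord_recl !big_ord0 /coord /= maxeNy addr0 => -[hs hm].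
  split => //; rewrite lt_max !lte_fin; apply/negbNE; rewrite negb_or -!leNgt.
  by apply/negP => /andP[h1 h2]; apply: hm.
have PA : fine (P2 A) = sum_tail mu mu x - small_jumps mu mu K x.
  rewrite EA; have msm := measurable_small_jumps_set K x.
  have mss := measurable_sum_set x.
  have sub : small_jumps_set K x `<=` sum_set x by move=> u [].
  rewrite measureD//; last by rewrite -ge0_fin_numE ?fin_num_measure.
  by rewrite setIidr// fineB ?fin_num_measure.
rewrite eS ltr_pdivlMr// PA [fine (P2 (sum_set x))](_ : _ = sum_tail mu mu x)//.
lra.
Unshelve. all: by end_near. Qed.

(** The class J concerns every number [n] of summands; it is decided by [n = 2],
    since the sum of all summands but one is dominated by a single one. *)
Lemma classJP : classF H -> classJ H <-> one_big_jump mu.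
Proof.
move=> FH; split; first exact: classJ_one_big_jump.
move=> obj; split => // n n2 d T P Y iidY.
exact: (one_big_jump_liminf FH muH obj n2 iidY).
Qed.

End classJ_one_big_jump.
End J_characterization.

(** * The steps of the random walk are i.i.d. *)

Section net_claims.
Context {R : realType} {d : measure_display} {T : measurableType d}.
Variable P : probability T R.

Lemma mutually_independent_step (I : choiceType) (Y : I -> {RV P >-> R}) :
  (forall i (F : {fset I}) (B : I -> set R), i \notin F ->
    (forall j, measurable (B j)) ->
    P (Y i @^-1` B i `&` \bigcap_(j in [set` F]) (Y j @^-1` B j)) =
    (P (Y i @^-1` B i) * P (\bigcap_(j in [set` F]) (Y j @^-1` B j)))%E) ->
  mutually_independent Y.
Proof.
move=> h J B mB; elim/finSet_rect : J => J IH.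
have [->|[i iJ]] := fset_0Vmem J.
  rewrite big_seq_fset0 (_ : \bigcap_(_ in _) _ = setT) ?probability_setT//.
  by apply/seteqP; split => // w _ j.
rewrite -(fsetD1K iJ) bigcap_fsetU1 h ?in_fsetD1 ?eqxx//.
by rewrite big_fsetU1 ?in_fsetD1 ?eqxx//= IH// fproperD1.
Qed.

Lemma history_generated (I : choiceType) (Y : I -> {RV P >-> R}) J (A : set T) :
  measurable (A : set (history Y J)) -> generated_sigma Y A.
Proof.
apply: smallest_sub; first exact: smallest_sigma_algebra.
by move=> _ [i [B [_ mB ->]]]; apply: sub_sigma_algebra; exists i, B.
Qed.

Lemma history_bigcap (I I' : choiceType) (Y : I -> {RV P >-> R})
    (F : {fset I'}) (J : set I) (A : I' -> set T) :
  (forall i, i \in F -> measurable (A i : set (history Y J))) ->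
  measurable (\bigcap_(i in [set` F]) A i : set (history Y J)).
Proof.
move=> h; rewrite bigcap_fset big_seq.
apply: (big_ind (fun B : set T => measurable (B : set (history Y J)))) => //.
by move=> B C; exact: (@measurableI _ (history Y J)).
Qed.

Variables (X W : nat -> {RV P >-> R}) (c : R).
Hypotheses (iidX : iid X) (iidW : iid W) (indXW : independent_families X W).

(** Both sequences as one independent family: the step [k] depends on the two
    indices [inl k] and [inr k], and these pairs are disjoint. *)
Let Z (i : nat + nat) : {RV P >-> R} :=
  match i with inl k => X k | inr k => W k end.

Let Z_indep : mutually_independent Z.
Proof.
apply: mutually_independent_step => i F B iF mB.
pose FX := [set k | inl k \in F]; pose FW := [set k | inr k \in F].
pose A := \bigcap_k (if inl k \in F then X k @^-1` B (inl k) else setT).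
pose C := \bigcap_k (if inr k \in F then W k @^-1` B (inr k) else setT).
have E : \bigcap_(j in [set` F]) (Z j @^-1` B j) = A `&` C.
  apply/seteqP; split=> w.
    by move=> h; split=> k _; case: ifPn => // Fk; [exact: (h (inl k))|exact: (h (inr k))].
  move=> [hA hC] [k|k] Fk /=.
    by have := hA k I; rewrite ifT.
  by have := hC k I; rewrite ifT.
have mA : measurable (A : set (history X FX)).
  apply: (@bigcapT_measurable _ (history X FX)) => k; case: ifPn => // Fk.
  by apply: sub_sigma_algebra; exists k, (B (inl k)).
have mC : measurable (C : set (history W FW)).
  apply: (@bigcapT_measurable _ (history W FW)) => k; case: ifPn => // Fk.
  by apply: sub_sigma_algebra; exists k, (B (inr k)).
have sA := history_generated mA; have sC := history_generated mC.
rewrite E (indXW sA sC); case: i iF => [k|k] iF /=.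
- have mk : measurable (X k @^-1` B (inl k) : set (history X [set k])).
    by apply: sub_sigma_algebra; exists k, (B (inl k)).
  have mkA : measurable (X k @^-1` B (inl k) `&` A : set (history X setT)).
    by apply: (@measurableI _ (history X setT)); [exact: history_sub mk|exact: history_sub mA].
  rewrite setIA (indXW (history_generated mkA) sC).
  rewrite (indep_history iidX.1 (J := [set k]) (K := FX)) ?muleA//.
  by apply/seteqP; split => // j /= [-> jF]; rewrite jF in iF.
- have mk : measurable (W k @^-1` B (inr k) : set (history W [set k])).
    by apply: sub_sigma_algebra; exists k, (B (inr k)).
  have mkC : measurable (W k @^-1` B (inr k) `&` C : set (history W setT)).
    by apply: (@measurableI _ (history W setT)); [exact: history_sub mk|exact: history_sub mC].
  rewrite setICA (indXW sA (history_generated mkC)).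
  rewrite (indep_history iidW.1 (J := [set k]) (K := FW)) ?(muleCA (P A))//.
  by apply/seteqP; split => // j /= [-> jF]; rewrite jF in iF.
Qed.

Let pair k : set (nat + nat) := [set inl k; inr k].

Let Xbar_history k B (J : set (nat + nat)) : pair k `<=` J -> measurable B ->
  measurable (Xbar X W c k @^-1` B : set (history Z J)).
Proof.
move=> kJ mB; rewrite -[X in measurable X]setTI.
have mX : measurable_fun setT (X k : history Z J -> R).
  by apply: (@measurable_history _ _ _ P _ Z J (inl k)); apply: kJ; left.
have mW : measurable_fun setT (W k : history Z J -> R).
  by apply: (@measurable_history _ _ _ P _ Z J (inr k)); apply: kJ; right.
suff : measurable_fun setT (Xbar X W c k : history Z J -> R) by exact.
apply: measurable_funB => //.
exact: measurable_funM.
Qed.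

Lemma Xbar_indep : mutually_independent (Xbar X W c).
Proof.
apply: mutually_independent_step => k F B kF mB.
apply: (indep_history Z_indep (J := pair k)
  (K := \bigcup_(j in [set` F]) pair j)).
- apply/seteqP; split => // i [] ik [j jF] ij.
  have kj : k = j by move: ik ij; rewrite /pair /=; case=> -> [] // [].
  by move: kF; rewrite kj jF.
- exact: Xbar_history.
- apply: history_bigcap => j jF; apply: Xbar_history => //.
  by move=> i ij; exists j.
Qed.

(** The step [k] is a fixed function of the pair [(X k, W k)], whose law is a product. *)
Lemma Xbar_ident : identically_distributed (Xbar X W c).
Proof.
move=> i j B mB.
pose f (u : R * R) := u.1 - u.2 * c.
have mf : measurable_fun setT f.
  by apply: measurable_funB => //; apply: measurable_funM.
have mS : measurable (f @^-1` B) by rewrite -[X in measurable X]setTI; exact: mf.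
have law k : distribution P (Xbar X W c k) B =
    joint_law (distribution P (X k)) (distribution P (W k)) (f @^-1` B).
  transitivity (P [set w | (f @^-1` B) (X k w, W k w)]); first by [].
  apply: indep_rv_joint => // A C mA mC; apply: indXW.
    by apply: sub_sigma_algebra; exists k, A.
  by apply: sub_sigma_algebra; exists k, C.
rewrite !law; apply: product_measure_unique => // A C mA mC.
rewrite [LHS](joint_lawX _ _ mA mC).
by congr (_ * _)%E; [exact: (iidX.2 j i)|exact: (iidW.2 j i)].
Qed.

End net_claims.

(** * Negative drift: the walk may stay below its starting point for ever *)

Section random_walk_maxima.
Context {R : realType} {d : measure_display} {T : measurableType d}.
Variable P : probability T R.
Variable xi : nat -> {RV P >-> R}.
Hypotheses (xi_indep : mutually_independent xi)
  (xi_ident : identically_distributed xi).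

Definition past n := history xi [set k | (k < n)%N].
Definition future n := history xi [set k | (n <= k)%N].

Definition incr n j (w : T) : R := \sum_(n <= k < n + j) xi k w.

Lemma incr0 n w : incr n 0 w = 0.
Proof. by rewrite /incr addn0 big_geq. Qed.

Lemma incrS n j w : incr n j.+1 w = xi n w + incr n.+1 j w.
Proof. by rewrite /incr addnS big_ltn ?ltnS ?leq_addr// addSn. Qed.

Lemma incrSr n j w : incr n j.+1 w = incr n j w + xi (n + j)%N w.
Proof. by rewrite /incr addnS big_nat_recr//= leq_addr. Qed.

Lemma incrD n i j w : incr n (i + j) w = incr n i w + incr (n + i) j w.
Proof.
by rewrite /incr addnA -big_cat_nat// ?leq_addr// leq_addr.
Qed.

(** The maximum over [j <= N] of [incr n j], in the recursive form that exhibits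
    the first step as an independent term. *)
Fixpoint fmax n N (w : T) : R :=
  if N is N'.+1 then Num.max 0 (xi n w + fmax n.+1 N' w) else 0.

Lemma fmax_ge0 n N w : 0 <= fmax n N w.
Proof. by case: N => //= N; rewrite le_max lexx. Qed.

Lemma incr_le_fmax n N j w : (j <= N)%N -> incr n j w <= fmax n N w.
Proof.
elim: N n j => [|N IH] n [|j]; rewrite ?incr0 ?fmax_ge0// ltnS => jN /=.
by rewrite incrS le_max lerD2l IH ?orbT.
Qed.

Lemma fmax_incr n N w : exists2 j, (j <= N)%N & fmax n N w = incr n j w.
Proof.
elim: N n => [|N IH] n; first by exists 0%N; rewrite ?incr0.
have [j jN hj] := IH n.+1; rewrite /= hj.
have [h|h] := leP 0 (xi n w + incr n.+1 j w).
  by exists j.+1; rewrite // incrS.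
by exists 0%N; rewrite ?incr0.
Qed.

Lemma fmax_gtP n N w x :
  (x < fmax n N w) <-> exists2 j, (j <= N)%N & x < incr n j w.
Proof.
split; first by have [j jN ->] := fmax_incr n N w => h; exists j.
by move=> [j jN h]; apply: lt_le_trans h _; exact: incr_le_fmax.
Qed.

Lemma fmax_leP n N w x : (fmax n N w <= x) <-> forall j, (j <= N)%N -> incr n j w <= x.
Proof.
split=> [h j jN|h]; first exact: le_trans (incr_le_fmax _ _ jN) h.
by have [j jN ->] := fmax_incr n N w; exact: h.
Qed.

Lemma fmax_nd n N w : fmax n N w <= fmax n N.+1 w.
Proof. by apply/fmax_leP => j jN; apply: incr_le_fmax; exact: leqW. Qed.

Lemma measurable_incr (J : set nat) n j :
  (forall k, (n <= k < n + j)%N -> J k) ->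
  measurable_fun [set: history xi J] (incr n j : history xi J -> R).
Proof.
move=> h; have := @measurable_seq_sum _ _ _ P _ xi (index_iota n (n + j)) J.
by apply => k; rewrite mem_index_iota; exact: h.
Qed.

Lemma measurable_fmax (J : set nat) n N : (forall k, (n <= k < n + N)%N -> J k) ->
  measurable_fun [set: history xi J] (fmax n N : history xi J -> R).
Proof.
elim: N n => [|N IH] n h; first exact: measurable_cst.
rewrite (_ : fmax n N.+1 = cst 0 \max (fun w => xi n w + fmax n.+1 N w))//.
apply: measurable_maxr; first exact: measurable_cst.
apply: measurable_funD.
  by apply: measurable_history; apply: h; rewrite leqnn/= addnS ltnS leq_addr.
by apply: IH => k /andP[nk kN]; apply: h; rewrite (ltnW nk) addnS -addSn.
Qed.

Lemma measurable_fmaxT n N : measurable_fun setT (fmax n N).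
Proof.
by apply: (history_measurable_fun (Y := xi) (J := setT)); apply: measurable_fmax.
Qed.

Definition fmax_rv n N : {mfun T >-> R} := mk_rv (measurable_fmaxT n N).

Lemma history_preimage (J : set nat) (f : T -> R) B : measurable B ->
  measurable_fun [set: history xi J] (f : history xi J -> R) ->
  measurable (f @^-1` B : set (history xi J)).
Proof. by move=> mB mf; rewrite -[X in measurable X]setTI; exact: mf. Qed.

Lemma past_future n (A B : set T) : measurable (A : set (past n)) ->
  measurable (B : set (future n)) -> P (A `&` B) = (P A * P B)%E.
Proof.
move=> mA mB; apply: (indep_history xi_indep _ mA mB).
by apply/seteqP; split=> // k /= [kn]; rewrite leqNgt kn.
Qed.

Lemma xi_future n B C : measurable B -> measurable (C : set (future n.+1)) ->
  P (xi n @^-1` B `&` C) = (P (xi n @^-1` B) * P C)%E.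
Proof.
move=> mB mC; apply: (indep_history xi_indep (J := [set n]) _ _ mC).
- by apply/seteqP; split=> // k /= [->]; rewrite ltnn.
- by apply: history_preimage => //; exact: measurable_history.
Qed.

Lemma law_xi n B : measurable B -> P (xi n @^-1` B) = P (xi 0%N @^-1` B).
Proof. by move=> mB; exact: (xi_ident n 0%N). Qed.

Lemma ptail_fmaxS n N x : 0 <= x -> ptail (distribution P (fmax_rv n N.+1)) x =
  sum_tail (distribution P (xi n)) (distribution P (fmax_rv n.+1 N)) x.
Proof.
move=> x0; apply: EFin_inj; rewrite -sum_tailE ptail_distribution fineK; last first.
  apply: fin_num_measure; rewrite -[X in measurable X]setTI.
  have := measurable_fmaxT n N.+1 measurableT (measurable_itv `]x, +oo[).
  by congr measurable; apply/seteqP; split=> w /=; rewrite in_itv/= andbT.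
transitivity (P [set w | sum_set x (xi n w, fmax n.+1 N w)]).
  congr (P _); apply/seteqP; split=> w; rewrite /sum_set /= lt_max ltNge x0//=.
apply: (indep_rv_joint (V := fmax_rv n.+1 N)) => [B C mB mC|].
  apply: xi_future => //; apply: history_preimage => //.
  by apply: measurable_fmax => k /andP[].
exact: measurable_sum_set.
Qed.

Lemma ptail_fmax_neg n N x : x < 0 -> ptail (distribution P (fmax_rv n N)) x = 1.
Proof.
move=> x0; rewrite ptail_distribution (_ : [set w | _] = setT) ?probability_setT//.
apply/seteqP; split => // w _ /=; exact: lt_le_trans x0 (fmax_ge0 n N w).
Qed.

(** The law of the maximum does not depend on the starting epoch: the step [n]
    is independent of the maximum from [n.+1] on, so both sides satisfy the same
    recursion. *)
Lemma ptail_fmax n N x :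
  ptail (distribution P (fmax_rv n N)) x = ptail (distribution P (fmax_rv 0 N)) x.
Proof.
elim: N n x => [|N IH] n x; first by rewrite !ptail_distribution.
have [x0|x0] := ltP x 0; first by rewrite !ptail_fmax_neg.
rewrite !ptail_fmaxS//; apply: EFin_inj; rewrite !sum_tail_int1.
under eq_integral do rewrite IH.
under [RHS]eq_integral do rewrite IH.
by apply: eq_measure_integral => A mA _; exact: law_xi.
Qed.

Lemma prob_le (X : {mfun T >-> R}) x :
  P [set w | X w <= x] = (1 - ptail (distribution P X) x)%:E.
Proof.
rewrite EFinB -ptailE; transitivity (cdf (X : {RV P >-> R}) x).
  congr (P _); apply/seteqP; split=> w /=; by rewrite in_itv.
have := cdf_ccdf_1 (X : {RV P >-> R}) x; rewrite /ccdf => <-.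
by rewrite addeK// fin_num_measure.
Qed.

Lemma fmax_le_prob n N x :
  P [set w | fmax n N w <= x] = P [set w | fmax 0 N w <= x].
Proof.
transitivity (P [set w | fmax_rv n N w <= x]); first by [].
by rewrite prob_le ptail_fmax -prob_le.
Qed.

Lemma integral_xi n (f : R -> \bar R) : measurable_fun setT f ->
  (forall x, (0 <= f x)%E) ->
  (\int[P]_w f (xi n w) = \int[P]_w f (xi 0%N w))%E.
Proof.
move=> mf f0; rewrite -[LHS](ge0_integral_distribution (xi n) mf f0).
rewrite -[RHS](ge0_integral_distribution (xi 0%N) mf f0).
by apply: eq_measure_integral => A mA _; exact: law_xi.
Qed.

Lemma integral_fmax n N :
  (\int[P]_w (fmax n N w)%:E = \int[P]_w (fmax 0 N w)%:E)%E.
Proof.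
have h m : (\int[P]_w (fmax m N w)%:E =
    \int[lebesgue_measure]_(r in `[0%R, +oo[) (ptail (distribution P (fmax_rv m N)) r)%:E)%E.
  transitivity ('E_P[fmax_rv m N])%E; first by rewrite expectation_def.
  rewrite ge0_expectation_ccdf; last by move=> w; exact: fmax_ge0.
  by apply: eq_integral => r _; rewrite /ccdf ptailE.
by rewrite !h; apply: eq_integral => r _; rewrite ptail_fmax.
Qed.

Section negative_drift.
Local Open Scope ereal_scope.

Let up (x : R) := (Num.max 0 x)%:E.
Let down (x : R) := (Num.max 0 (- x)%R)%:E.

Hypothesis drift : \int[P]_w up (xi 0%N w) < \int[P]_w down (xi 0%N w).
Hypothesis down_fin : \int[P]_w down (xi 0%N w) < +oo.

Let up_ge0 x : 0 <= up x. Proof. by rewrite lee_fin le_max lexx. Qed.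
Let down_ge0 x : 0 <= down x. Proof. by rewrite lee_fin le_max lexx. Qed.

Let mup : measurable_fun setT up.
Proof. by apply/measurable_EFinP; apply: measurable_maxr. Qed.

Let mdown : measurable_fun setT down.
Proof.
apply/measurable_EFinP.
have : measurable_fun setT ((cst 0%R : R -> R) \max (fun x : R => - x)%R).
  by apply: measurable_maxr => //; exact: measurable_funN.
by [].
Qed.

Lemma fmax_integrable n N : \int[P]_w (fmax n N w)%:E < +oo.
Proof.
elim: N n => [|N IH] n; first by rewrite integral0_eq ?ltry.
apply: (@le_lt_trans _ _ (\int[P]_w (up (xi n w) + (fmax n.+1 N w)%:E))).
  apply: ge0_le_integral => //.
  - by move=> w _; rewrite lee_fin fmax_ge0.
  - by apply/measurable_EFinP; exact: measurable_fmaxT.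
  - apply: emeasurable_funD; first exact: measurableT_comp.
    by apply/measurable_EFinP; exact: measurable_fmaxT.
  - move=> w _; rewrite /up -EFinD lee_fin /= ge_max.
    have := fmax_ge0 n.+1 N w; rewrite -subr_ge0 => h.
    by rewrite lerD2r le_max lexx orbT addr_ge0 ?le_max ?lexx ?fmax_ge0.
rewrite ge0_integralD//; last 3 first.
- exact: measurableT_comp.
- by move=> w _; rewrite lee_fin fmax_ge0.
- by apply/measurable_EFinP; exact: measurable_fmaxT.
apply: lte_add_pinfty => //.
rewrite (integral_xi n mup)//; exact: lt_trans drift down_fin.
Qed.

(** The amount by which the walk, seen through the recursion of [fmax], would
    have gone below 0. *)
Let under N (w : T) := down (xi 0%N w + fmax 1 N w)%R.

Let munder N : measurable_fun setT (under N).
Proof.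
apply: (measurableT_comp mdown); apply: measurable_funD => //.
exact: measurable_fmaxT.
Qed.

Let mfm n N : measurable_fun setT (fun w => (fmax n N w)%:E).
Proof. by apply/measurable_EFinP; exact: measurable_fmaxT. Qed.

(** Write [F] for the maximum over [N] steps after the first one, so that the
    maximum over [N.+1] steps is the positive part of [xi 0 + F]. Then
    [max 0 (xi 0 + F) + down (xi 0) = F + up (xi 0) + under N] pointwise, and the
    expectation of the maximum is finite and nondecreasing in [N]. *)
Lemma lindley N : \int[P]_w down (xi 0%N w) <=
  \int[P]_w up (xi 0%N w) + \int[P]_w under N w.
Proof.
have E : \int[P]_w (fmax 0 N.+1 w)%:E + \int[P]_w down (xi 0%N w) =
    \int[P]_w (fmax 1 N w)%:E + (\int[P]_w up (xi 0%N w) + \int[P]_w under N w).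
  have fm0 n k w : 0 <= (fmax n k w)%:E by rewrite lee_fin fmax_ge0.
  have mupxi : measurable_fun setT (fun w => up (xi 0%N w)) by exact: measurableT_comp.
  have mdownxi : measurable_fun setT (fun w => down (xi 0%N w)) by exact: measurableT_comp.
  have e1 : \int[P]_w (fmax 0 N.+1 w)%:E + \int[P]_w down (xi 0%N w) =
    \int[P]_w ((fmax 0 N.+1 w)%:E + down (xi 0%N w)).
    by rewrite ge0_integralD.
  have e2 : \int[P]_w up (xi 0%N w) + \int[P]_w under N w =
    \int[P]_w (up (xi 0%N w) + under N w).
    by rewrite ge0_integralD// => w _; exact: down_ge0.
  have e3 : \int[P]_w (fmax 1 N w)%:E + \int[P]_w (up (xi 0%N w) + under N w) =
    \int[P]_w ((fmax 1 N w)%:E + (up (xi 0%N w) + under N w)).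
    rewrite [RHS]ge0_integralD//; first by move=> w _; apply: adde_ge0 => //; exact: down_ge0.
    by apply: emeasurable_funD => //; exact: munder.
  rewrite e1 e2 e3; apply: eq_integral => w _.
  rewrite /up /under /down -!EFinD; congr EFin.
  (* the pointwise identity, by the signs of xi 0 and of xi 0 + F *)
  rewrite /= /Num.max; repeat case: ifPn => /=; rewrite -?leNgt; lra.
rewrite -(@leeD2lE _ (\int[P]_w (fmax 0 N.+1 w)%:E)); last first.
  rewrite ge0_fin_numE ?fmax_integrable// integral_ge0// => w _.
  by rewrite lee_fin fmax_ge0.
rewrite E leeD2r// integral_fmax.
apply: ge0_le_integral => // w _; rewrite lee_fin ?fmax_ge0//; exact: fmax_nd.
Qed.

(** If the maximum exceeds [a], the undershoot is at most [down (xi 0 + a)];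
    otherwise it is at most [down (xi 0)], which is at most
    [down (xi 0 + a) + a]. *)
Lemma under_le N (a : R) : (0 <= a)%R -> \int[P]_w under N w <=
  \int[P]_w down (xi 0%N w + a)%R + a%:E * P [set w | (fmax 1 N w <= a)%R].
Proof.
move=> a0; set A := [set w | _].
have mA : measurable A.
  rewrite -[A]setTI (_ : A = fmax 1 N @^-1` `]-oo, a]%classic).
    by apply: measurable_fmaxT => //; exact: measurable_itv.
  by apply/seteqP; split=> w /=; rewrite in_itv.
have m1 : measurable_fun setT (fun w => down (xi 0%N w + a)).
  by apply: (measurableT_comp mdown); exact: measurable_funD.
have m2 : measurable_fun setT (fun w => a%:E * (\1_A w)%:E).
  by apply: measurable_funeM; apply/measurable_EFinP.
have -> : a%:E * P A = \int[P]_w (a%:E * (\1_A w)%:E).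
  rewrite ge0_integralZl//; last by apply/measurable_EFinP.
  by rewrite integral_indic// setIT.
rewrite -ge0_integralD//; last by move=> w _; rewrite mule_ge0.
apply: ge0_le_integral => //.
- by move=> w _; exact: down_ge0.
- exact: emeasurable_funD.
move=> w _; rewrite /under /down indicE -EFinM -EFinD lee_fin.
have := fmax_ge0 1 N w; case: (boolP (w \in A)) => [/set_mem|/negP] /=.
  by rewrite /A /= /Num.max; repeat case: ifPn => /=; rewrite -?leNgt; lra.
rewrite inE /A /= => /negP; rewrite -ltNge.
by rewrite /Num.max; repeat case: ifPn => /=; rewrite -?leNgt; lra.
Qed.

Lemma excess_small (e : R) : (0 < e)%R -> exists2 a : R, (0 < a)%R &
  \int[P]_w down (xi 0%N w + a)%R <= e%:E.
Proof.
move=> e0.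
have mf n : measurable_fun setT (fun w => down (xi 0%N w + n%:R)).
  by apply: (measurableT_comp mdown); exact: measurable_funD.
have mdx : measurable_fun setT (fun w => down (xi 0%N w)) by exact: measurableT_comp.
have dct := @dominated_convergence _ _ _ P setT measurableT
  (fun n w => down (xi 0%N w + n%:R)) (cst 0) (fun w => down (xi 0%N w)) mf
  (measurable_cst _).
have h : \int[P]_w down (xi 0%N w + n%:R) @[n --> \oo] --> 0.
  have [| | |_ _] := dct.
  - apply/aeW => w _; apply: cvg_near_cst; near=> n.
    rewrite /down; congr EFin; apply/max_idPl; rewrite oppr_le0.
    have : (- xi 0%N w <= n%:R)%R by near: n; exact: nbhs_infty_ger.
    by rewrite -subr_ge0 opprK addrC.
  - apply/integrableP; split => //.
    by under eq_integral do rewrite gee0_abs//.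
  - apply/aeW => w n _; rewrite gee0_abs// lee_fin.
    by rewrite ge_max le_max lexx/= le_max lerN2 lerDl ler0n orbT.
  by rewrite integral0.
have [_ /cvgrPdist_le/(_ _ e0)] := (fine_cvgP _ _).1 h.
move=> [n0 _ hn]; exists n0.+1%:R => //.
have := hn n0.+1 (leqnSn _); rewrite /= sub0r normrN => hh.
have fin : \int[P]_w down (xi 0%N w + n0.+1%:R) \is a fin_num.
  rewrite ge0_fin_numE; last exact: integral_ge0.
  apply: le_lt_trans down_fin; apply: ge0_le_integral => // w _.
  by rewrite lee_fin ge_max le_max lexx/= le_max lerN2 lerDl ler0n orbT.
rewrite -(fineK fin) lee_fin; apply: le_trans hh; exact: ler_norm.
Unshelve. all: by end_near. Qed.

(** By [lindley] the expected undershoot is at least the absolute value of the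
    drift. By [under_le] and [excess_small] it is at most half of this value plus
    [a * P (fmax <= a)] for some [a], whatever [N] is. *)
Lemma fmax_tight : exists a delta : R, [/\ (0 <= a)%R, (0 < delta)%R &
  forall n N, delta%:E <= P [set w | (fmax n N w <= a)%R]].
Proof.
have up_fin := lt_trans drift down_fin.
have fu : \int[P]_w up (xi 0%N w) \is a fin_num.
  by rewrite ge0_fin_numE// integral_ge0.
have fd : \int[P]_w down (xi 0%N w) \is a fin_num.
  by rewrite ge0_fin_numE// integral_ge0.
move: drift; rewrite -(fineK fu) -(fineK fd) lte_fin.
set u := fine _; set v := fine _ => uv.
have e0 : (0 < (v - u) / 2)%R by lra.
have [a a0 ha] := excess_small e0.
exists a, ((v - u) / 2 / a)%R; split; [exact: ltW|by rewrite divr_gt0|].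
move=> n N; rewrite fmax_le_prob -(fmax_le_prob 1).
have := lindley N; rewrite -(fineK fu) -(fineK fd) -/u -/v => h1.
have h2 := under_le N (ltW a0).
set A := [set w | _] in h2 *.
have mA : measurable A.
  rewrite -[A]setTI (_ : A = fmax 1 N @^-1` `]-oo, a]%classic).
    by apply: measurable_fmaxT => //; exact: measurable_itv.
  by apply/seteqP; split=> w /=; rewrite in_itv.
have fA : P A \is a fin_num by rewrite fin_num_measure.
have h3 : v%:E <= u%:E + (((v - u) / 2)%:E + a%:E * P A).
  apply: (le_trans h1); rewrite leeD2l//; apply: (le_trans h2); rewrite leeD2r//.
move: h3; rewrite -(fineK fA) -EFinM -!EFinD !lee_fin => h3.
rewrite ler_pdivrMr// mulrC; lra.
Qed.

(** If the step exceeded [- v / 2] almost surely, where [v] is the expectation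
    of its negative part, this expectation would be at most [v / 2]. *)
Lemma step_down : exists eta pi0 : R, [/\ (0 < eta)%R, (0 < pi0)%R &
  pi0%:E = P [set w | (xi 0%N w <= - eta)%R]].
Proof.
have fd : \int[P]_w down (xi 0%N w) \is a fin_num.
  by rewrite ge0_fin_numE// integral_ge0.
have v0 : (0 < fine (\int[P]_w down (xi 0%N w)))%R.
  rewrite fine_gt0// down_fin andbT; apply: le_lt_trans drift.
  exact: integral_ge0.
set v := fine _ in v0.
set A := [set w | (xi 0%N w <= - (v / 2))%R].
have mA : measurable A.
  rewrite (_ : A = xi 0%N @^-1` `]-oo, (- (v / 2))%R]%classic).
    by apply: measurable_funPTI; exact: measurable_itv.
  by apply/seteqP; split=> w /=; rewrite in_itv.
have fA : P A \is a fin_num by rewrite fin_num_measure.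
exists (v / 2)%R, (fine (P A)); split; [lra| |by rewrite fineK].
rewrite lt_neqAle fine_ge0// andbT eq_sym; apply/negP => /eqP PA0.
have {}PA0 : P A = 0 by rewrite -(fineK fA) PA0.
suff : v%:E <= (v / 2)%:E by rewrite lee_fin; lra.
have mdx : measurable_fun setT (fun w => down (xi 0%N w)) by exact: measurableT_comp.
rewrite {1}/v fineK// -(setUv A) ge0_integral_setU//=; last 3 first.
- exact: measurableC.
- by rewrite setUv.
- by apply/disj_setPCl.
rewrite null_set_integral ?add0e//; last exact: measurable_funTS.
apply: (@le_trans _ _ (\int[P]_(w in ~` A) (v / 2)%:E)).
  apply: ge0_le_integral => //.
  - exact: measurableC.
  - exact: measurable_funTS.
  - move=> w /= /negP; rewrite -ltNge => h; rewrite lee_fin ge_max; lra.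
rewrite integral_cst//; last exact: measurableC.
rewrite -[leRHS]mule1 lee_wpmul2l ?lee_fin//; first by lra.
by apply: probability_le1; exact: measurableC.
Qed.

Definition drop (eta : R) n N := [set w | (xi n w <= - eta)%R /\ (fmax n.+1 N w <= 0)%R].

(** The maximum stays below [a] with probability at least [d1]. Preceding the
    walk by an independent step below [- eta] lowers the level by [eta] at the
    price of a factor [pi0]; finitely many such steps bring it to 0. The bounds
    do not depend on the horizon [N]. *)
Lemma drop_positive : exists eta delta : R, [/\ (0 < eta)%R, (0 < delta)%R,
  forall n N, delta%:E <= P [set w | (fmax n N w <= 0)%R] &
  forall n N, delta%:E <= P (drop eta n N)].
Proof.
have [a [d1 [a0 d10 ha]]] := fmax_tight.
have [eta [pi0 [eta0 pi00 hpi]]] := step_down.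
have mle (f : T -> R) x : measurable_fun setT f -> measurable [set w | (f w <= x)%R].
  move=> mf; rewrite -[X in measurable X]setTI (_ : [set w | _] = f @^-1` `]-oo, x]%classic).
    by apply: mf => //; exact: measurable_itv.
  by apply/seteqP; split=> w /=; rewrite in_itv.
have hxi n : P [set w | (xi n w <= - eta)%R] = pi0%:E.
  rewrite hpi (_ : [set w | (xi 0%N w <= _)%R] = xi 0%N @^-1` `]-oo, (- eta)%R]%classic).
    rewrite -(law_xi n); last exact: measurable_itv.
    by congr (P _); apply/seteqP; split=> w /=; rewrite in_itv.
  by apply/seteqP; split=> w /=; rewrite in_itv.
have joint n N (z : R) : P ([set w | (xi n w <= - eta)%R] `&` [set w | (fmax n.+1 N w <= z)%R]) =
    pi0%:E * P [set w | (fmax n.+1 N w <= z)%R].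
  rewrite -(hxi n) (_ : [set w | (xi n w <= _)%R] = xi n @^-1` `]-oo, (- eta)%R]%classic); last first.
    by apply/seteqP; split=> w /=; rewrite in_itv.
  apply: xi_future; first exact: measurable_itv.
  rewrite (_ : [set w | _] = fmax n.+1 N @^-1` `]-oo, z]%classic); last first.
    by apply/seteqP; split=> w /=; rewrite in_itv.
  apply: history_preimage; first exact: measurable_itv.
  by apply: measurable_fmax => k /andP[].
have down_step (m : nat) : exists2 dm : R, (0 < dm)%R &
    forall n N, dm%:E <= P [set w | (fmax n N w <= Num.max 0 (a - m%:R * eta))%R].
  elim: m => [|m [dm dm0 IH]].
    by exists d1 => // n N; rewrite mul0r subr0 (max_idPr a0).
  exists (pi0 * dm)%R; first exact: mulr_gt0.
  move=> n N; set z := Num.max _ _.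
  have z0 : (0 <= z)%R by rewrite le_max lexx.
  have zE : (Num.max 0 (a - m%:R * eta) <= z + eta)%R.
    have : (a - m.+1%:R * eta <= z)%R by rewrite le_max lexx orbT.
    by rewrite -natr1 ge_max => ?; apply/andP; split; lra.
  rewrite EFinM; apply: (@le_trans _ _ (pi0%:E * P [set w | (fmax n.+1 N w <= z + eta)%R])).
    rewrite lee_wpmul2l// ?lee_fin ?(ltW pi00)//; apply: (le_trans (IH n.+1 N)).
    apply: le_measure; rewrite ?inE.
    - by apply: mle; exact: measurable_fmaxT.
    - by apply: mle; exact: measurable_fmaxT.
    - by move=> w /= h; exact: le_trans h zE.
  rewrite -joint; apply: le_measure; rewrite ?inE.
  - by apply: measurableI; apply: mle => //; exact: measurable_fmaxT.
  - by apply: mle; exact: measurable_fmaxT.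
  - move=> w [/= h1 h2]; apply: (le_trans (fmax_nd n N w)).
    rewrite /= ge_max z0/=; lra.
have [d2 d20 hd2] : exists2 d2 : R, (0 < d2)%R &
    forall n N, d2%:E <= P [set w | (fmax n N w <= 0)%R].
  have [d2 d20 hd2] := down_step (Num.truncn (a / eta)).+1.
  exists d2 => // n N; have := hd2 n N; rewrite (max_idPl _)//.
  by rewrite subr_le0 -ler_pdivrMr// ltW// truncnS_gt.
exists eta, (pi0 * d2)%R; split => //; first exact: mulr_gt0.
  move=> n N; apply: le_trans (hd2 n N); rewrite lee_fin ler_piMl ?(ltW d20)//.
  by rewrite -lee_fin hpi; apply: probability_le1; exact: mle.
move=> n N; rewrite /drop.
rewrite [X in P X](_ : _ = [set w | (xi n w <= - eta)%R] `&` [set w | (fmax n.+1 N w <= 0)%R])//.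
by rewrite joint EFinM lee_wpmul2l// lee_fin (ltW pi00).
Qed.

End negative_drift.
End random_walk_maxima.

(** * Time spent above a level before the first ascent *)

Lemma series_le {R : realType} (f : nat -> \bar R) (c : \bar R) :
  (forall n, (0 <= f n)%E) -> (forall N, (\sum_(k < N) f k <= c)%E) ->
  (\sum_(k <oo) f k <= c)%E.
Proof.
move=> f0 h; apply: lime_le; first by apply: is_cvg_nneseries => k _ _.
by apply: nearW => N; rewrite big_mkord.
Qed.

Lemma partial_sum_le_series {R : realType} (f : nat -> \bar R) N :
  (forall n, (0 <= f n)%E) -> (\sum_(k < N) f k <= \sum_(k <oo) f k)%E.
Proof.
move=> f0; rewrite -(big_mkord xpredT f).
by apply: nneseries_lim_ge => k _ _.
Qed.

Section sums_of_probabilities.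
Context {R : realType} {d : measure_display} {T : measurableType d}.
Variable P : probability T R.

Lemma integral_sum_indic N (A : nat -> set T) : (forall n, measurable (A n)) ->
  (\int[P]_w (\sum_(k < N) \1_(A k) w)%:E = \sum_(k < N) P (A k))%E.
Proof.
move=> mA; under eq_integral do rewrite -sumEFin.
rewrite ge0_integral_sum//.
  by apply: eq_bigr => k _; rewrite integral_indic// setIT.
by move=> k; apply/measurable_EFinP.
Qed.

Lemma sum_prob_le N (A : nat -> set T) (c : R) : (forall n, measurable (A n)) ->
  (forall w, \sum_(k < N) \1_(A k) w <= c) -> (\sum_(k < N) P (A k) <= c%:E)%E.
Proof.
move=> mA h; rewrite -integral_sum_indic//.
have c0 : 0 <= c.
  apply: le_trans (h point); apply: sumr_ge0 => k _; by rewrite indicE ler0n.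
apply: (@le_trans _ _ (\int[P]_w c%:E)%E).
  apply: ge0_le_integral => //.
  - by move=> w _; rewrite lee_fin; apply: sumr_ge0 => k _; rewrite indicE ler0n.
  - under eq_fun do rewrite -sumEFin.
    by apply: emeasurable_sum => k; apply/measurable_EFinP.
  - by move=> w _; rewrite lee_fin.
by rewrite integral_cst// [X in (_ * X)%E]probability_setT mule1.
Qed.

End sums_of_probabilities.

Section ladder.
Context {R : realType} {d : measure_display} {T : measurableType d}.
Variable P : probability T R.
Variable xi : nat -> {RV P >-> R}.
Hypotheses (xi_indep : mutually_independent xi)
  (xi_ident : identically_distributed xi).
Local Notation S := (incr xi 0).
Local Notation fmax := (fmax xi).

Definition noup n : set T := [set w | fmax 0 n w <= 0].

Definition noup_above (s : R) n : set T := noup n `&` [set w | - s < S n w].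

Lemma past_noup n : measurable (noup n : set (past xi n)).
Proof.
rewrite (_ : noup n = fmax 0 n @^-1` `]-oo, 0%R]%classic); last first.
  by apply/seteqP; split=> w /=; rewrite in_itv.
apply: history_preimage; first exact: measurable_itv.
by apply: measurable_fmax => k /andP[].
Qed.

Lemma measurable_S n : measurable_fun setT (S n).
Proof.
by apply: (history_measurable_fun (Y := xi) (J := setT)); exact: measurable_incr.
Qed.

Definition S_rv n : {mfun T >-> R} := mk_rv (measurable_S n).

Lemma past_S n B : measurable B -> measurable (S n @^-1` B : set (past xi n)).
Proof.
move=> mB; apply: history_preimage => //.
by apply: measurable_incr => k /andP[].
Qed.

Lemma past_noup_above s n : measurable (noup_above s n : set (past xi n)).
Proof.
apply: (@measurableI _ (past xi n)); first exact: past_noup.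
rewrite (_ : [set w | _] = S n @^-1` `](- s), +oo[%classic).
  by apply: past_S; exact: measurable_itv.
by apply/seteqP; split=> w /=; rewrite in_itv/= andbT.
Qed.

Lemma measurable_past n (A : set T) : measurable (A : set (past xi n)) -> measurable A.
Proof. exact: history_measurable. Qed.

(** The expected number of epochs at which the walk is above [- s] without
    having been positive so far. *)
Definition occ (s : R) : \bar R := (\sum_(n <oo) P (noup_above s n))%E.

Lemma noup_S n w : noup n w -> S n w <= 0.
Proof. by move=> h; apply: le_trans h; exact: incr_le_fmax. Qed.

Lemma noup_le m n w : (m <= n)%N -> noup n w -> noup m w.
Proof.
move=> mn; apply: le_trans; apply/fmax_leP => j jm; apply: incr_le_fmax.
exact: leq_trans jm mn.
Qed.

Lemma occ_nonpos s : s <= 0 -> occ s = 0%E.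
Proof.
move=> s0; rewrite /occ eseries0// => n _ _.
rewrite (_ : noup_above s n = set0) ?measure0//.
apply/seteqP; split=> // w [/noup_S h /= h']; lra.
Qed.

Section occupation_bounds.
Variables (eta delta : R).
Hypotheses (eta0 : 0 < eta) (delta0 : 0 < delta)
  (noup_ge : forall n, (delta%:E <= P (noup n))%E)
  (drop_ge : forall n N, (delta%:E <= P (drop xi eta n N))%E).

Lemma future_drop n N : measurable (drop xi eta n N : set (future xi n)).
Proof.
rewrite (_ : drop xi eta n N = (xi n @^-1` `]-oo, (- eta)%R]%classic) `&`
  (fmax n.+1 N @^-1` `]-oo, 0%R]%classic)); last first.
  by apply/seteqP; split=> w /=; rewrite /drop /= !in_itv.
apply: (@measurableI _ (future xi n)).
- apply: history_preimage; first exact: measurable_itv.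
  by apply: measurable_history => /=.
- apply: history_preimage; first exact: measurable_itv.
  by apply: measurable_fmax => k /andP[/ltnW].
Qed.

Let count N n (w : T) (s : R) : R :=
  \sum_(k < n) \1_(noup_above s k `&` drop xi eta k N) w.

Let countS N n w s : count N n.+1 w s =
  count N n w s + \1_(noup_above s n `&` drop xi eta n N) w.
Proof. by rewrite /count big_ord_recr. Qed.

Let drop_S N n l w : drop xi eta n N w -> (n < l <= N)%N -> S l w <= S n w - eta.
Proof.
move=> [h1 h2] /andP[nl lN]; rewrite -(subnKC nl) addSn -addnS incrD add0n.
rewrite lerD2l incrS; have : incr xi n.+1 (l - n.+1) w <= 0.
  apply: le_trans h2; apply: incr_le_fmax; apply: leq_trans lN.
  by rewrite leq_subLR leq_addl.
by move=> ?; lra.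
Qed.

(** Up to the horizon [N], the walk stays at least [eta] below each counted
    position once it has left it, so the depth is at least [eta] times the
    number of counted epochs. *)
Let count_le N n l w s : (n <= l <= N)%N -> noup l w ->
  eta * count N n w s <= - S l w.
Proof.
elim: n l => [|n IH] l /andP[nl lN] Al.
  by rewrite /count big_ord0 mulr0 oppr_ge0; exact: noup_S.
rewrite countS indicE; case: (boolP (w \in _)) => [/set_mem[[An _] D]|_] /=.
  have := drop_S D (_ : (n < l <= N)%N); rewrite nl lN => /(_ isT).
  have := IH n _ An; rewrite leqnn (ltnW (leq_trans nl lN)) => /(_ isT).
  by rewrite mulrDr mulr1; lra.
by rewrite addr0; apply: IH => //; rewrite (ltnW nl).
Qed.

(** At the last counted epoch the depth is still less than [s]. *)
Let count_bound N n w s : 0 < s -> (n <= N)%N -> eta * count N n w s <= s + eta.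
Proof.
move=> s0; elim: n => [|n IH] nN.
  by rewrite /count big_ord0 mulr0 addr_ge0// ltW.
rewrite countS indicE; case: (boolP (w \in _)) => [/set_mem[[An sn] D]|_] /=.
  have := @count_le N n n w s; rewrite leqnn (ltnW nN) => /(_ isT An).
  by move: sn; rewrite /= mulrDr mulr1; lra.
by rewrite addr0; apply: IH; exact: ltnW.
Qed.

(** Each epoch that contributes to [occ s] is followed, independently of the
    past and with probability at least [delta], by a drop; [count_bound] limits
    the number of epochs followed by a drop. *)
Lemma occ_upper s : 0 < s -> (occ s <= ((s / eta + 1) / delta)%:E)%E.
Proof.
move=> s0; apply: series_le => // N.
have h : (delta%:E * \sum_(k < N) P (noup_above s k) <= (s / eta + 1)%:E)%E.
  apply: (@le_trans _ _ (\sum_(k < N) P (noup_above s k `&` drop xi eta k N))%E).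
    rewrite ge0_sume_distrr//; apply: lee_sum => k _.
    rewrite (past_future xi_indep (@past_noup_above s k) (@future_drop k N)) muleC.
    by rewrite lee_wpmul2l.
  apply: (@sum_prob_le R d T P N (fun k => noup_above s k `&` drop xi eta k N)) => [n|w].
    apply: measurableI; first exact: (measurable_past (@past_noup_above s _)).
    exact: (history_measurable (@future_drop _ _)).
  have := count_bound w s0 (leqnn N).
  rewrite -ler_pdivlMl// => /le_trans; apply.
  by rewrite mulrDr mulVf ?gt_eqF// mulrC.
have fN : (\sum_(k < N) P (noup_above s k) \is a fin_num)%E.
  apply/sum_fin_numP => k _ _; rewrite fin_num_measure//.
  exact: (measurable_past (@past_noup_above s _)).
move: h; rewrite -(fineK fN) -EFinM !lee_fin => h.
by rewrite ler_pdivlMr// mulrC.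
Qed.

Let neg n (w : T) : R := Num.max 0 (- xi n w).

Let neg_ge0 n w : 0 <= neg n w. Proof. by rewrite le_max lexx. Qed.

Let mneg n : measurable_fun setT (neg n).
Proof.
have : measurable_fun setT ((cst 0 : T -> R) \max (fun w => - xi n w)).
  by apply: measurable_maxr => //; exact: measurable_funN.
by [].
Qed.

(** The step [n] is independent of the past; the expectation of the product is
    read off its tail, where the factor [P A] comes out. *)
Lemma integral_past_neg n (A : set T) : measurable (A : set (past xi n)) ->
  (\int[P]_w (\1_A w * neg n w)%:E = P A * \int[P]_w (neg n w)%:E)%E.
Proof.
move=> pA; have mA := measurable_past pA.
have mAn : measurable_fun setT (fun w => \1_A w * neg n w).
  by apply: measurable_funM => //.
have a0 w : 0 <= \1_A w * neg n w by rewrite mulr_ge0// indicE.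
have e1 := ge0_expectation_ccdf (X := (mk_rv mAn : {RV P >-> R})) a0.
have e2 := ge0_expectation_ccdf (X := (mk_rv (mneg n) : {RV P >-> R})) (neg_ge0 n).
rewrite expectation_def in e1; rewrite expectation_def in e2.
rewrite [LHS]e1 [X in (_ * X)%E]e2 -ge0_integralZl//; last first.
  apply/measurable_funTS.
  exact: ccdf_measurable.
apply: eq_integral => r; rewrite inE/= in_itv/= andbT => r0.
rewrite /ccdf /distribution /pushforward.
transitivity (P (A `&` (xi n @^-1` `]-oo, (- r)%R[%classic))).
  congr (P _); apply/seteqP; split=> w /=; rewrite !in_itv/= andbT indicE.
    case: (boolP (w \in A)) => [/set_mem Aw|_] /=; last by rewrite mul0r ltNge r0.
    by rewrite mul1r /neg lt_max (ltNge r 0) r0/= ltrNr; split.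
  move=> [/mem_set ->]; rewrite mul1r /neg lt_max => h.
  by rewrite ltrNr h orbT.
rewrite (past_future xi_indep pA) //.
  congr (_ * P _)%E; apply/seteqP; split=> w /=; rewrite !in_itv/= andbT /neg lt_max (ltNge r 0) r0/= ltrNr//.
apply: history_preimage; first exact: measurable_itv.
by apply: measurable_history => /=.
Qed.

Lemma integral_neg n : (\int[P]_w (neg n w)%:E = \int[P]_w (neg 0 w)%:E)%E.
Proof.
apply: (integral_xi xi_ident n (f := fun x => (Num.max 0 (- x))%:E)).
  apply/measurable_EFinP.
  have : measurable_fun setT ((cst 0 : R -> R) \max (fun x : R => - x)).
    by apply: measurable_maxr => //; exact: measurable_funN.
  by [].
by move=> x; rewrite lee_fin le_max lexx.
Qed.

Let descent N n w s : noup N w -> (n <= N)%N -> (forall k, (k < n)%N -> - s < S k w) ->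
  - S n w <= \sum_(k < n) \1_(noup_above s k) w * neg k w.
Proof.
move=> AN; elim: n => [|n IH] nN h; first by rewrite big_ord0 incr0 oppr0.
rewrite big_ord_recr/= incrSr add0n opprD indicE mem_set/=; last first.
  by split; [apply: noup_le AN; exact: ltnW|exact: h].
rewrite mul1r lerD//; last by rewrite le_max lexx orbT.
by apply: IH => [|k kn]; [exact: ltnW|apply: h; exact: ltnW].
Qed.

(** Either the walk goes below [- s] within [N] steps, and the downward parts of
    the steps made above [- s] add up to at least [s], or all [N] epochs are
    spent above [- s], and the second term is [s]. *)
Let descent_or_stay N w s : 0 < s -> (0 < N)%N -> noup N w ->
  s <= \sum_(k < N) \1_(noup_above s k) w * neg k w +
       s / N%:R * \sum_(k < N) \1_(noup_above s k) w.
Proof.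
move=> s0 N0 AN.
have t0 : 0 <= s / N%:R * \sum_(k < N) \1_(noup_above s k) w.
  by rewrite mulr_ge0 ?divr_ge0 ?(ltW s0)// sumr_ge0// => k _; rewrite indicE.
pose F k := \1_(noup_above s k) w * neg k w.
have F0 k : 0 <= F k by rewrite /F mulr_ge0// indicE.
have [h|h] := pselect (exists n, (n <= N)%N && (S n w <= - s)).
  case: (ex_minnP h) => m /andP[mN Sm] mmin.
  apply: (@le_trans _ _ (- S m w)); first by rewrite lerNr.
  apply: (@le_trans _ _ (\sum_(k < m) F k)).
    apply: (descent AN mN) => k km; rewrite ltNge; apply/negP => Sk.
    have := mmin k; rewrite (leq_trans (ltnW km) mN) Sk => /(_ isT).
    by rewrite leqNgt km.
  have e : \sum_(k < N) F k = \sum_(k < m) F k + \sum_(m <= k < N) F k.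
    by rewrite -!(big_mkord xpredT F) -big_cat_nat.
  by rewrite -[X in _ <= X + _]/(\sum_(k < N) F k) e -addrA lerDl addr_ge0// sumr_ge0.
have -> : \sum_(k < N) \1_(noup_above s k) w = N%:R :> R.
  transitivity (\sum_(k < N) (1 : R)); last by rewrite sumr_const card_ord.
  apply: eq_bigr => k _.
  rewrite indicE mem_set//; split; first by apply: noup_le AN; exact: ltnW.
  rewrite /= ltNge; apply/negP => Sk; apply: h; exists k.
  by rewrite Sk (ltnW (ltn_ord k)).
rewrite mulfVK ?pnatr_eq0 -?lt0n//.
by rewrite lerDr; apply: sumr_ge0 => k _; exact: F0.
Qed.

(** Integrate [descent_or_stay] over the event that the walk has not been positive
    up to time [N], of probability at least [delta]: the first sum has
    expectation at most [occ s] times the mean downward step, and the second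
    term vanishes as [N] grows because [occ s] is finite. *)
Lemma occ_lower s : 0 < s -> (\int[P]_w (neg 0 w)%:E < +oo)%E ->
  ((s * delta)%:E <= \int[P]_w (neg 0 w)%:E * occ s)%E.
Proof.
move=> s0 En_fin.
have mA k : measurable (noup_above s k) := measurable_past (@past_noup_above s k).
have occ_fin : occ s \is a fin_num.
  rewrite ge0_fin_numE; last by apply: nneseries_ge0 => n _ _.
  by apply: le_lt_trans (occ_upper s0) _; rewrite ltry.
have En_num : (\int[P]_w (neg 0 w)%:E \is a fin_num)%E.
  rewrite ge0_fin_numE// integral_ge0// => w _; by rewrite lee_fin.
set En := (\int[P]_w (neg 0 w)%:E)%E in En_fin En_num *.
have key N : (0 < N)%N -> ((s * delta)%:E <= En * occ s + (s / N%:R)%:E * occ s)%E.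
  move=> N0; have sN0 : 0 <= s / N%:R by rewrite divr_ge0// ltW.
  pose F (w : T) : R := \sum_(k < N) \1_(noup_above s k) w * neg k w.
  pose C (w : T) : R := \sum_(k < N) \1_(noup_above s k) w.
  have F0 w : 0 <= F w by apply: sumr_ge0 => k _; rewrite mulr_ge0// indicE.
  have C0 w : 0 <= C w by apply: sumr_ge0 => k _; rewrite indicE.
  have mF : measurable_fun setT (fun w => (F w)%:E).
    under eq_fun do rewrite -sumEFin.
    apply: emeasurable_sum => k; apply/measurable_EFinP.
    exact: measurable_funM.
  have mC : measurable_fun setT (fun w => (C w)%:E).
    under eq_fun do rewrite -sumEFin.
    by apply: emeasurable_sum => k; apply/measurable_EFinP.
  have IF : (\int[P]_w (F w)%:E <= En * occ s)%E.
    under eq_integral do rewrite -sumEFin.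
    rewrite ge0_integral_sum//; last 2 first.
    - by move=> k; apply/measurable_EFinP; exact: measurable_funM.
    - by move=> k w _; rewrite lee_fin mulr_ge0// indicE.
    rewrite (eq_bigr (fun k : 'I_N => (En * P (noup_above s k))%E)); last first.
      move=> k _.
      by rewrite (integral_past_neg (@past_noup_above s k)) integral_neg muleC.
    rewrite -ge0_sume_distrr// lee_wpmul2l//.
      by apply: integral_ge0 => w _; rewrite lee_fin.
    exact: (@partial_sum_le_series _ (fun k => P (noup_above s k))).
  have IC : (\int[P]_w (C w)%:E <= occ s)%E.
    rewrite integral_sum_indic//.
    exact: (@partial_sum_le_series _ (fun k => P (noup_above s k))).
  have mN : measurable (noup N) := measurable_past (@past_noup N).
  apply: (@le_trans _ _ (s%:E * P (noup N))%E).
    by rewrite EFinM lee_wpmul2l// lee_fin ltW.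
  apply: (@le_trans _ _ (\int[P]_w ((F w)%:E + (s / N%:R)%:E * (C w)%:E))%E).
    have -> : (s%:E * P (noup N) = \int[P]_w (s%:E * (\1_(noup N) w)%:E))%E.
      rewrite ge0_integralZl//; last by rewrite lee_fin ltW.
        by rewrite integral_indic// setIT.
      by apply/measurable_EFinP.
    apply: ge0_le_integral => //.
    - by move=> w _; rewrite mule_ge0// lee_fin ltW.
    - by apply: measurable_funeM; apply/measurable_EFinP.
    - by apply: emeasurable_funD => //; exact: measurable_funeM.
    move=> w _; rewrite -!EFinM -EFinD lee_fin indicE.
    case: (boolP (w \in noup N)) => [/set_mem AN|_]; first by rewrite mulr1; exact: descent_or_stay.
    by rewrite mulr0 addr_ge0// mulr_ge0.
  rewrite ge0_integralD//; last 2 first.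
  - by move=> w _; rewrite mule_ge0// lee_fin.
  - exact: measurable_funeM.
  - by rewrite ge0_integralZl//; [apply: leeD => //; rewrite lee_wpmul2l|move=> w _; rewrite lee_fin].
  - by move=> w _; rewrite lee_fin.
move: key; rewrite -(fineK occ_fin) -(fineK En_num).
set o := fine (occ s); set e := fine En; move=> key.
have o0 : 0 <= o by rewrite fine_ge0// nneseries_ge0.
rewrite -EFinM lee_fin leNgt; apply/negP => hlt.
have [N hN] : exists N, s * o / (s * delta - e * o) < N.+1%:R.
  exists (Num.truncn (s * o / (s * delta - e * o))); exact: truncnS_gt.
have := key N.+1 isT; rewrite -!EFinM -EFinD lee_fin leNgt => /negP; apply.
have pos : 0 < s * delta - e * o by rewrite subr_gt0.
by rewrite -ltrBrDl mulrAC ltr_pdivrMr// [ltRHS]mulrC -ltr_pdivrMr.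
Qed.

End occupation_bounds.
End ladder.

(** * The ladder height tail against the integrated tail *)

Section integrated_tail.
Context {R : realType}.
Local Open Scope ereal_scope.

(** Tonelli on the region [x <= y < t]. *)
Lemma integrated_tail_excess (mu : probability R R) (x : R) :
  \int[lebesgue_measure]_(y in `[x, +oo[) (ptail mu y)%:E =
  \int[mu]_t (Num.max 0 (t - x))%:E.
Proof.
pose A := [set u : R * R | (x <= u.2)%R /\ (u.2 < u.1)%R].
have mA : measurable A.
  have -> : A = ([set: R] `*` `[x, +oo[%classic) `&`
      (fun u : R * R => (u.1 - u.2)%R) @^-1` `]0%R, +oo[%classic.
    apply/seteqP; split=> u; rewrite /A /= !in_itv/= !andbT subr_gt0; tauto.
  apply: measurableI.
    by apply: measurableX => //; exact: measurable_itv.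
  have mf : measurable_fun [set: R * R] (fun u : R * R => (u.1 - u.2)%R).
    by apply: measurable_funB; [exact: measurable_fst|exact: measurable_snd].
  by rewrite -[X in measurable X]setTI; apply: mf => //; exact: measurable_itv.
have := product_measure12 mu (@lebesgue_measure R) mA.
rewrite /product_measure1 /product_measure2 => E.
rewrite integral_mkcond; transitivity (\int[lebesgue_measure]_y (mu \o ysection A) y).
  apply: eq_integral => y _; rewrite patchE /=.
  case: ifPn => [|/negP]; rewrite inE/= in_itv/= andbT => xy.
    rewrite -ptailE; congr (mu _); apply/seteqP; split=> t; rewrite /ysection /= inE /A /= in_itv/= andbT.
      by move=> ?; split.
    by case.
  rewrite (_ : ysection A y = set0) ?measure0//.
  by apply/seteqP; split=> // t; rewrite /ysection /= inE /A /= => -[].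
rewrite -E; apply: eq_integral => t _ /=.
rewrite (_ : xsection A t = `[x, t[%classic); last first.
  apply/seteqP; split=> y; rewrite /xsection /= inE /A /= in_itv/=.
    by move=> [-> ->].
  by move=> /andP[].
rewrite lebesgue_measure_itv/= lte_fin; case: ltP => xt.
  by rewrite -EFinD (max_idPr _)// subr_ge0 ltW.
by rewrite (max_idPl _)// subr_le0.
Qed.

End integrated_tail.

Section ladder_height_tail.
Context {R : realType} {d : measure_display} {T : measurableType d}.
Variable P : probability T R.
Variable xi : nat -> {RV P >-> R}.
Hypotheses (xi_indep : mutually_independent xi)
  (xi_ident : identically_distributed xi).
Local Notation S := (incr xi 0).
Local Open Scope ereal_scope.

Let mu : probability R R := distribution P (xi 0%N).

Lemma measurable_noup_above_prob n (x : R) :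
  measurable_fun setT (fun v : R => P (noup_above xi (v - x)%R n)).
Proof.
have mA s : measurable (noup_above xi s n) := measurable_past (@past_noup_above _ _ _ P xi s n).
have -> : (fun v => P (noup_above xi (v - x)%R n)) =
    EFin \o (fun v => fine (P (noup_above xi (v - x)%R n))).
  by apply/funext => v /=; rewrite fineK// fin_num_measure.
apply/measurable_EFinP; apply: nondecreasing_measurable => // v w vw.
rewrite fine_le ?fin_num_measure//; apply: le_measure; rewrite ?inE//.
by move=> t [h /= h']; split => //=; apply: le_lt_trans h'; lra.
Qed.

Lemma ladder_step n (x : R) : P (noup xi n `&` [set w | (x < S n.+1 w)%R]) =
  \int[mu]_v P (noup_above xi (v - x)%R n).
Proof.
have mA := measurable_past (@past_noup _ _ _ P xi n).
have [|_ ] := @indep_sum_law _ _ _ P (noup xi n) mA (S_rv xi n) (xi n) _ x.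
  move=> B C mB mC; rewrite (past_future xi_indep (n := n))//.
    apply: (@measurableI _ (past xi n)); first exact: past_noup.
    exact: past_S.
  by apply: history_preimage => //; apply: measurable_history => /=.
move=> E; transitivity (P (noup xi n `&` [set w | (x < S_rv xi n w + xi n w)%R])).
  congr (P (_ `&` _)); apply/seteqP; split=> w /=; by rewrite incrSr add0n.
rewrite E; transitivity (\int[distribution P (xi n)]_v P (noup_above xi (v - x)%R n)).
  apply: eq_integral => v _; congr (P (_ `&` _)).
  by apply/seteqP; split=> w /=; rewrite in_itv/= andbT opprB.
by apply: eq_measure_integral => B mB _; exact: (law_xi xi_ident).
Qed.

Definition ladder_sum (x : R) : \bar R :=
  \sum_(n <oo) P (noup xi n `&` [set w | (x < S n.+1 w)%R]).

(** If the next step has size [v], the walk exceeds [x] exactly when it was above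
    [x - v] before. *)
Lemma ladder_sum_occ x : ladder_sum x = \int[mu]_v occ xi (v - x)%R.
Proof.
rewrite /ladder_sum /occ integral_nneseries//.
  by apply: eq_eseriesr => n _; exact: ladder_step.
by move=> n; exact: measurable_noup_above_prob.
Qed.

Variables (eta delta : R).
Hypotheses (eta0 : (0 < eta)%R) (delta0 : (0 < delta)%R)
  (noup_ge : forall n, delta%:E <= P (noup xi n))
  (drop_ge : forall n N, delta%:E <= P (drop xi eta n N))
  (neg_fin : \int[P]_w (Num.max 0 (- xi 0%N w))%:E < +oo).

Let mocc (x : R) : measurable_fun setT (fun v : R => occ xi (v - x)%R).
Proof.
apply: ge0_emeasurable_sum => // n _.
exact: measurable_noup_above_prob.
Qed.

Let mexcess x : measurable_fun setT (fun t : R => (Num.max 0 (t - x))%:E).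
Proof.
apply/measurable_EFinP.
have : measurable_fun setT ((cst 0%R : R -> R) \max (fun t : R => t - x)%R).
  by apply: measurable_maxr => //; exact: measurable_funB.
by [].
Qed.

(** The occupation time vanishes for [t <= x] and grows at most linearly beyond;
    the unit shift makes the affine bound proportional to the excess. *)
Lemma ladder_sum_le : exists2 C : R, (0 < C)%R & forall x,
  ladder_sum x <= C%:E * \int[mu]_t (Num.max 0 (t - (x - 1)))%:E.
Proof.
exists ((eta^-1 + 1) / delta)%R; first by rewrite divr_gt0// addr_gt0// invr_gt0.
move=> x; rewrite ladder_sum_occ -ge0_integralZl//; last 2 first.
- by move=> t _; rewrite lee_fin le_max lexx.
- by rewrite lee_fin divr_ge0 ?(ltW delta0)// addr_ge0// invr_ge0 ltW.
apply: ge0_le_integral => //.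
- by move=> t _; apply: nneseries_ge0.
- exact: measurable_funeM.
move=> t _; have [tx|tx] := leP (t - x)%R 0%R.
  rewrite occ_nonpos// mule_ge0 ?lee_fin ?le_max ?lexx//.
  by rewrite divr_ge0 ?(ltW delta0)// addr_ge0// invr_ge0 ltW.
apply: (le_trans (occ_upper xi_indep eta0 delta0 drop_ge tx)).
rewrite -EFinM lee_fin mulrAC ler_wpM2r ?invr_ge0 ?(ltW delta0)//.
rewrite (max_idPr _); last by lra.
have : (0 < eta^-1)%R by rewrite invr_gt0.
by move=> e0; nra.
Qed.

Lemma ladder_sum_ge x :
  delta%:E * \int[mu]_t (Num.max 0 (t - x))%:E <=
  \int[P]_w (Num.max 0 (- xi 0%N w))%:E * ladder_sum x.
Proof.
set E := \int[P]_w _.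
have E0 : 0 <= E by apply: integral_ge0 => w _; rewrite lee_fin le_max lexx.
rewrite ladder_sum_occ -!ge0_integralZl//; last 3 first.
- by move=> t _; apply: nneseries_ge0.
- by move=> t _; rewrite lee_fin le_max lexx.
- by rewrite lee_fin ltW.
apply: ge0_le_integral => //.
- by move=> t _; rewrite mule_ge0 ?lee_fin ?le_max ?lexx// ltW.
- exact: measurable_funeM.
- exact: measurable_funeM.
move=> t _; have [tx|tx] := leP (t - x)%R 0%R.
  by rewrite mule0 mule_ge0//; apply: nneseries_ge0.
have := occ_lower xi_indep xi_ident eta0 delta0 noup_ge drop_ge tx neg_fin.
by rewrite mulrC EFinM.
Qed.

End ladder_height_tail.

(** * The renewal equation at the first ladder epoch *)

Section measure_of_total_mass_one.
Context {R : realType} {d : measure_display} {T : measurableType d}.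
Variable nu : {measure set T -> \bar R}.

(** The phantom proof lets a measure of total mass 1 carry the structure of a
    probability. *)
Definition as_probability of nu setT = 1%E : set T -> \bar R := nu.

Hypothesis nu1 : nu setT = 1%E.

Let as_probability0 : as_probability nu1 set0 = 0%E.
Proof. exact: measure0. Qed.

Let as_probability_ge0 A : (0 <= as_probability nu1 A)%E.
Proof. exact: measure_ge0. Qed.

Let as_probability_sigma_additive : semi_sigma_additive (as_probability nu1).
Proof. exact: measure_semi_sigma_additive. Qed.

HB.instance Definition _ := isMeasure.Build _ _ _ (as_probability nu1)
  as_probability0 as_probability_ge0 as_probability_sigma_additive.

HB.instance Definition _ := Measure_isProbability.Build _ _ _
  (as_probability nu1) nu1.

End measure_of_total_mass_one.

Section renewal.
Context {R : realType} {d : measure_display} {T : measurableType d}.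
Variable P : probability T R.
Variable xi : nat -> {RV P >-> R}.
Hypotheses (xi_indep : mutually_independent xi)
  (xi_ident : identically_distributed xi).
Local Notation S := (incr xi 0).
Local Notation fmax := (fmax xi).
Local Notation noup := (noup xi).

Definition exceeds (x : R) : set T := \bigcup_n [set w | x < S n w].

(** The first ladder epoch is [n.+1]. *)
Definition ladder_at n : set T := noup n `&` [set w | 0 < S n.+1 w].

Lemma measurable_S_gt n (x : R) : measurable [set w | x < S n w].
Proof.
rewrite (_ : [set w | _] = S n @^-1` `]x, +oo[%classic).
  rewrite -[X in measurable X]setTI.
  by apply: (@measurable_S _ _ _ P xi) => //; exact: measurable_itv.
by apply/seteqP; split=> w /=; rewrite in_itv/= andbT.
Qed.

Lemma measurable_exceeds x : measurable (exceeds x).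
Proof. by apply: bigcupT_measurable => n; exact: measurable_S_gt. Qed.

Lemma past_ladder_at n : measurable (ladder_at n : set (past xi n.+1)).
Proof.
apply: (@measurableI _ (past xi n.+1)).
  by apply: history_sub (@past_noup _ _ _ P xi n) => k /=; exact: ltnW.
rewrite (_ : [set w | _] = S n.+1 @^-1` `]0, +oo[%classic).
  by apply: past_S; exact: measurable_itv.
by apply/seteqP; split=> w /=; rewrite in_itv/= andbT.
Qed.

Lemma measurable_ladder_at n : measurable (ladder_at n).
Proof. exact: measurable_past (@past_ladder_at n). Qed.

Lemma trivIset_ladder_at (A : nat -> set T) : (forall n, A n `<=` ladder_at n) ->
  trivIset setT A.
Proof.
move=> sub; apply/trivIsetP => m n _ _.
wlog mn : m n / (m < n)%N.
  move=> h; rewrite neq_ltn => /orP[mn|nm]; first by apply: h => //; rewrite neq_ltn mn.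
  by rewrite setIC; apply: h => //; rewrite neq_ltn nm.
move=> _; apply/seteqP; split => // w [/sub[_ /= Sm] /sub[nn _]].
have : S m.+1 w <= 0 by apply: noup_S; apply: noup_le nn.
by rewrite leNgt Sm.
Qed.

Lemma exceeds_ladder_at x w : 0 <= x -> exceeds x w -> exists n, ladder_at n w.
Proof.
move=> x0 [k _ /= Sk].
have h : exists n, 0 < S n w by exists k; exact: le_lt_trans Sk.
case: (ex_minnP h) => -[|n] Sn nmin; first by rewrite incr0 ltxx in Sn.
exists n; split => //; apply/fmax_leP => j jn; rewrite leNgt; apply/negP => /nmin.
by rewrite leqNgt ltnS jn.
Qed.

Lemma ladder_at_exceeds n x w : 0 <= x -> ladder_at n w ->
  exceeds x w <-> exists N, x < S n.+1 w + fmax n.+1 N w.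
Proof.
move=> x0 [An Sn]; split.
  move=> [k _ /= Sk]; have nk : (n < k)%N.
    rewrite ltnNge; apply/negP => kn.
    have : S k w <= 0 by apply: noup_S; apply: noup_le An.
    by move=> h; lra.
  exists (k - n.+1)%N; apply: (lt_le_trans Sk).
  rewrite -[in leLHS](subnKC nk) incrD add0n lerD2l.
  exact: incr_le_fmax.
move=> [N]; have [j jN ->] := fmax_incr xi n.+1 N w.
move=> h; exists (n.+1 + j)%N => //=.
by rewrite incrD add0n.
Qed.

Let m n := law_on P (measurable_ladder_at n) (S_rv xi n.+1).

Lemma fmax_cvg_exceeds (x : R) :
  (ptail (distribution P (fmax_rv xi 0 N)) x)%:E @[N --> \oo] --> P (exceeds x).
Proof.
pose F N := [set w | x < fmax 0 N w].
have mF N : measurable (F N).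
  rewrite (_ : F N = fmax 0 N @^-1` `]x, +oo[%classic).
    rewrite -[X in measurable X]setTI.
    by apply: (@measurable_fmaxT _ _ _ P xi) => //; exact: measurable_itv.
  by apply/seteqP; split=> w /=; rewrite in_itv/= andbT.
have E : exceeds x = \bigcup_N F N.
  apply/seteqP; split=> w.
    move=> [n _ /= Sn]; exists n => //=; apply: lt_le_trans Sn _.
    exact: incr_le_fmax.
  move=> [N _ /fmax_gtP[j _ h]]; by exists j.
rewrite E (_ : (fun N => _) = P \o F); last first.
  apply/funext => N /=; rewrite ptail_distribution fineK// fin_num_measure//.
  exact: mF.
apply: nondecreasing_cvg_mu => //; first exact: bigcupT_measurable.
apply/nondecreasing_seqP => N; apply/subsetPset => w /= h.
exact: lt_le_trans h (fmax_nd _ _ _ _).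
Qed.

Lemma ptail_fmax_nd M N x : (M <= N)%N ->
  ptail (distribution P (fmax_rv xi 0 M)) x <= ptail (distribution P (fmax_rv xi 0 N)) x.
Proof.
move=> MN; rewrite -lee_fin -!ptailE.
have mF K : measurable (fmax_rv xi 0 K @^-1` `]x, +oo[%classic).
  by apply: measurable_funPTI; exact: measurable_itv.
apply: (@le_measure _ _ _ P); rewrite ?inE; [exact: mF|exact: mF|].
move=> w /=; rewrite !in_itv/= !andbT => h; apply: (lt_le_trans h).
by apply/fmax_leP => j jM; apply: incr_le_fmax; exact: leq_trans jM MN.
Qed.

(** Given that the first ladder epoch is [n.+1], the later maximum is independent
    of the past and distributed as the maximum from time 0. This is used for
    a finite horizon [N], which then grows. *)
Lemma ladder_at_renewal n x : 0 <= x ->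
  P (ladder_at n `&` exceeds x) = (\int[m n]_u P (exceeds (x - u)))%E.
Proof.
move=> x0.
pose F N := ladder_at n `&` [set w | x < S_rv xi n.+1 w + fmax_rv xi n.+1 N w].
have mF N : measurable (F N).
  apply: measurableI; first exact: measurable_ladder_at.
  rewrite (_ : [set w | _] = (fun w => S n.+1 w + fmax n.+1 N w) @^-1` `]x, +oo[%classic).
    rewrite -[X in measurable X]setTI.
    have mf : measurable_fun setT (fun w => S n.+1 w + fmax n.+1 N w).
      apply: measurable_funD; first exact: (measurable_S xi n.+1).
      exact: (@measurable_fmaxT _ _ _ P xi).
    by apply: mf => //; exact: measurable_itv.
  by apply/seteqP; split=> w /=; rewrite in_itv/= andbT.
have E : ladder_at n `&` exceeds x = \bigcup_N F N.
  apply/seteqP; split=> w.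
    move=> [An /(ladder_at_exceeds x0 An)[N h]]; by exists N.
  move=> [N _ [An h]]; split => //; apply/(ladder_at_exceeds x0 An); by exists N.
have cF : (P \o F) N @[N --> \oo] --> P (ladder_at n `&` exceeds x).
  rewrite E; apply: nondecreasing_cvg_mu => //; first exact: bigcupT_measurable.
  apply/nondecreasing_seqP => N; apply/subsetPset => w [An /= h]; split => //=.
  by apply: (lt_le_trans h); rewrite lerD2l fmax_nd.
have PF N : P (F N) = (\int[m n]_u (ptail (distribution P (fmax_rv xi 0 N)) (x - u))%:E)%E.
  have [|-> _] := @indep_sum_law _ _ _ P _ (measurable_ladder_at n) (S_rv xi n.+1) (fmax_rv xi n.+1 N) _ x.
    move=> B C mB mC; rewrite (past_future xi_indep (n := n.+1))//.
      apply: (@measurableI _ (past xi n.+1)); first exact: past_ladder_at.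
      exact: past_S.
    apply: history_preimage => //.
    by apply: measurable_fmax => k /andP[].
  apply: eq_integral => u _; rewrite -(ptail_fmax xi_indep xi_ident n.+1) -ptailE.
  by [].
apply/esym; rewrite -(cvg_lim _ cF)//.
rewrite (_ : P \o F = fun N => (\int[m n]_u (ptail (distribution P (fmax_rv xi 0 N)) (x - u))%:E)%E);
  last by apply/funext => N /=; exact: PF.
rewrite -monotone_convergence//.
- apply: eq_integral => u _; apply/esym/cvg_lim => //.
  exact: fmax_cvg_exceeds.
- move=> N; apply/measurable_EFinP; apply: measurableT_comp; first exact: measurable_ptail.
  exact: measurable_funB.
- by move=> N u _; rewrite lee_fin ptail_ge0.
- by move=> u _ M N MN; rewrite lee_fin; exact: ptail_fmax_nd.
Qed.

Lemma exceeds_renewal x : 0 <= x ->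
  P (exceeds x) = (\sum_(n <oo) \int[m n]_u P (exceeds (x - u)))%E.
Proof.
move=> x0; have E : exceeds x = \bigcup_n (ladder_at n `&` exceeds x).
  rewrite -setI_bigcupl setIidr// => w h.
  by have [n An] := exceeds_ladder_at x0 h; exists n.
have mA n : measurable (ladder_at n `&` exceeds x).
  by apply: measurableI; [exact: measurable_ladder_at|exact: measurable_exceeds].
rewrite [LHS](_ : _ = P (\bigcup_n (ladder_at n `&` exceeds x))); last by rewrite -E.
rewrite measure_semi_bigcup//; last 2 first.
- by apply: trivIset_ladder_at => n w [].
- exact: bigcupT_measurable.
by apply: eq_eseriesr => n _; exact: ladder_at_renewal.
Qed.

Let p : R := fine (P (\bigcup_n ladder_at n)).

Lemma ladder_prob : (\sum_(n <oo) P (ladder_at n))%E = p%:E.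
Proof.
rewrite /p fineK; last first.
  apply: fin_num_measure; apply: bigcupT_measurable => n.
  exact: measurable_ladder_at.
rewrite measure_semi_bigcup//.
- exact: measurable_ladder_at.
- by apply: trivIset_ladder_at => n w.
- by apply: bigcupT_measurable => n; exact: measurable_ladder_at.
Qed.

(** [m n] is the law of the walk at time [n.+1] on the event that this is the
    first ladder epoch; the sum of these measures has total mass [p]. *)
Lemma ladder_height_law : 0 < p -> exists mu : probability R R,
  (forall B, measurable B ->
    (p%:E * mu B = \sum_(n <oo) P (ladder_at n `&` S n.+1 @^-1` B))%E) /\
  (forall f : R -> \bar R, measurable_fun setT f -> (forall x, (0 <= f x)%E) ->
    (p%:E * \int[mu]_u f u = \sum_(n <oo) \int[m n]_u f u)%E).
Proof.
move=> p0; have ip0 : 0 <= p^-1 by rewrite invr_ge0 ltW.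
have pK (z : \bar R) : (p%:E * (p^-1%:E * z) = z)%E.
  by rewrite muleA -EFinM mulfV ?mul1e// gt_eqF.
pose r : {nonneg R} := NngNum ip0.
pose nu : {measure set R -> \bar R} := mscale r (mseries m 0).
have nu1 : nu setT = 1%E.
  have e : (\sum_(n <oo) m n setT = p%:E)%E.
    rewrite -ladder_prob; apply: eq_eseriesr => n _.
    by rewrite /m /law_on preimage_setT setIT.
  transitivity (p^-1%:E * p%:E)%E; first by congr (_ * _)%E; exact: e.
  by rewrite -EFinM mulVf// gt_eqF.
pose mu : probability R R := as_probability nu1.
exists mu; split.
  by move=> B mB; rewrite -[mu B]/(nu B) /nu /mscale /= pK.
move=> f mf f0.
rewrite -[X in (_ * X)%E]/(\int[nu]_u f u)%E /nu ge0_integral_mscale//= pK.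
by rewrite ge0_integral_measure_series.
Qed.

End renewal.

(** * The laws of the ladder height and of the supremum *)

Section walk_laws.
Context {R : realType} {d : measure_display} {T : measurableType d}.
Variable P : probability T R.
Variable xi : nat -> {RV P >-> R}.
Hypotheses (xi_indep : mutually_independent xi)
  (xi_ident : identically_distributed xi).
Hypothesis drift : (\int[P]_w (Num.max 0 (xi 0%N w))%:E <
  \int[P]_w (Num.max 0 (- xi 0%N w))%:E)%E.
Hypothesis down_fin : (\int[P]_w (Num.max 0 (- xi 0%N w))%:E < +oo)%E.
Local Notation S := (incr xi 0).
Local Notation ladder_at := (ladder_at xi).
Local Notation exceeds := (exceeds xi).

Let p : R := fine (P (\bigcup_n ladder_at n)).
Let Rt (x : R) : R := fine (P (exceeds x)).

Hypothesis p0 : 0 < p.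

Let RtE x : P (exceeds x) = (Rt x)%:E.
Proof. by rewrite fineK// fin_num_measure//; exact: measurable_exceeds. Qed.

Let Rt_ge0 x : 0 <= Rt x. Proof. by rewrite fine_ge0. Qed.

Let Rt_le1 x : Rt x <= 1.
Proof. by rewrite -lee_fin -RtE probability_le1//; exact: measurable_exceeds. Qed.

Let Rt_le x y : x <= y -> Rt y <= Rt x.
Proof.
move=> xy; rewrite -lee_fin -!RtE; apply: le_measure; rewrite ?inE.
- exact: measurable_exceeds.
- exact: measurable_exceeds.
- by move=> w [n _ /= h]; exists n => //=; exact: le_lt_trans h.
Qed.

Let mRt : measurable_fun setT Rt.
Proof. by apply: nonincreasing_measurable => // x y _ _; exact: Rt_le. Qed.

(** With probability at least [delta] the walk never becomes positive. *)
Lemma ladder_prob_lt1 : p < 1.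
Proof.
have [eta [delta [_ delta0 hn _]]] := drop_positive xi_indep xi_ident drift down_fin.
have E : \bigcup_n ladder_at n = exceeds 0.
  apply/seteqP; split=> w; last by move=> /(exceeds_ladder_at (lexx 0))[n h]; exists n.
  by move=> [n _ [_ h]]; exists n.+1.
suff : (P (exceeds 0) <= (1 - delta)%:E)%E.
  by rewrite /p E RtE /= lee_fin => /le_lt_trans; apply; lra.
have c := @fmax_cvg_exceeds _ _ _ P xi (0 : R).
rewrite -(cvg_lim _ c)//; apply: lime_le; first exact: cvgP c.
apply: nearW => N.
have := hn 0%N N.
rewrite -[X in P X]/([set w | fmax_rv xi 0 N w <= 0]) prob_le !lee_fin; lra.
Qed.

Let muG_spec := ladder_height_law p0.
Let muG : probability R R := projT1 (cid muG_spec).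
Let muGB := (projT2 (cid muG_spec)).1.
Let muGf := (projT2 (cid muG_spec)).2.

Lemma renewal_Rt x : 0 <= x ->
  ((Rt x)%:E = p%:E * \int[muG]_u (Rt (x - u))%:E)%E.
Proof.
move=> x0; rewrite -RtE (exceeds_renewal xi_indep xi_ident x0) muGf//; last first.
- by move=> u; rewrite lee_fin.
- apply/measurable_EFinP; apply: measurableT_comp => //; exact: measurable_funB.
- by apply: eq_eseriesr => n _; apply: eq_integral => u _; rewrite RtE.
Qed.

(** In the renewal equation, separate the ladder heights below and above [x / 2]. *)
Lemma Rt_half x : 0 <= x -> Rt x <= p * (Rt (x / 2) + ptail muG (x / 2)).
Proof.
move=> x0; rewrite -lee_fin renewal_Rt// EFinM lee_wpmul2l ?lee_fin ?(ltW p0)//.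
have mI : measurable (`](x / 2), +oo[%classic : set R) := measurable_itv _.
rewrite EFinD -ptailE -(setIT `]x/2, +oo[%classic) -integral_indic//.
have -> : ((Rt (x / 2))%:E = \int[muG]_u (Rt (x / 2))%:E)%E.
  by rewrite integral_cst// [X in (_ * X)%E]probability_setT mule1.
rewrite -ge0_integralD//; last 2 first.
- by move=> u _; rewrite lee_fin.
- by apply/measurable_EFinP.
apply: ge0_le_integral => //.
- by move=> u _; rewrite lee_fin.
- apply/measurable_EFinP; apply: measurableT_comp => //; exact: measurable_funB.
- by apply/measurable_EFinP; apply: measurable_funD.
move=> u _; rewrite -EFinD lee_fin indicE.
have [ux|ux] := leP u (x / 2).
  apply: (@le_trans _ _ (Rt (x / 2))); first by apply: Rt_le; lra.
  by rewrite lerDl.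
rewrite mem_set /=; last by rewrite in_itv/= ux.
by apply: (le_trans (Rt_le1 _)); rewrite lerDr.
Qed.

Let inf_set := \bigcap_k exceeds k%:R.

Let minf : measurable inf_set.
Proof. by apply: bigcapT_measurable => k; exact: measurable_exceeds. Qed.

(** The probability [q] of an infinite supremum is the limit of [Rt], so
    [Rt_half] gives [q <= p * q] in the limit, while [p < 1]. *)
Lemma sup_infinite_null : P inf_set = 0%E.
Proof.
have absurd (u v z t : R) : 4 * z = t - u -> t <= u + v -> v <= 2 * z -> 0 < z -> False.
  by move=> ? ? ? ?; lra.
have c : (P \o (fun k => exceeds k%:R)) k @[k --> \oo] --> P inf_set.
  apply: nonincreasing_cvg_mu => //.
  - by apply: (le_lt_trans (probability_le1 _ _)) => //; [exact: measurable_exceeds|rewrite ltry].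
  - by move=> k; exact: measurable_exceeds.
  - apply/nonincreasing_seqP => k; apply/subsetPset => w [n _ /= h].
    by exists n => //=; apply: le_lt_trans h; rewrite ler_nat.
have fin : P inf_set \is a fin_num by rewrite fin_num_measure.
set q := fine (P inf_set); have PE : P inf_set = q%:E by rewrite fineK.
have q0 : 0 <= q by rewrite fine_ge0.
have qR x : 0 <= x -> q <= Rt x.
  move=> x0; rewrite -lee_fin -PE -RtE; apply: le_measure; rewrite ?inE//.
    exact: measurable_exceeds.
  have xb : x <= (Num.truncn x).+1%:R by rewrite ltW// truncnS_gt.
  move=> w /(_ (Num.truncn x).+1 I)[n _ /= h]; exists n => //=; exact: le_lt_trans h.
rewrite PE; congr EFin; apply/eqP; rewrite eq_le q0 andbT leNgt; apply/negP => qp.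
have p1 := ladder_prob_lt1.
(* with q <= Rt (2 k), Rt k <= q + e and ptail muG k <= e, the bound
   q <= p * (q + 2 * e) contradicts 4 * e = q - p * q *)
have e0 : 0 < q * (1 - p) / 4 by rewrite divr_gt0// mulr_gt0// subr_gt0.
set e := q * (1 - p) / 4 in e0.
have [K hK] := ptail_cvg0 muG e0.
have [k [Kk Rk]] : exists k : nat, K <= k%:R /\ Rt k%:R <= q + e.
  rewrite PE in c; have [_ /cvgrPdist_le/(_ _ e0)[N _ hN]] := (fine_cvgP _ _).1 c.
  exists (maxn N (Num.truncn K).+1); split.
    apply: (@le_trans _ _ (Num.truncn K).+1%:R); first by rewrite ltW// truncnS_gt.
    by rewrite ler_nat leq_maxr.
  have := hN (maxn N (Num.truncn K).+1) (leq_maxl _ _).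
  by rewrite /= -/(Rt _) ler_norml => /andP[h _]; lra.
have := Rt_half (x := 2 * k%:R) ltac:(by rewrite mulr_ge0).
have -> : 2 * k%:R / 2 = k%:R :> R by field.
have := qR (2 * k%:R) ltac:(by rewrite mulr_ge0).
have hK2 : ptail muG k%:R <= e by apply: le_trans hK; exact: ptail_le.
have : p * (Rt k%:R + ptail muG k%:R) <= p * (q + 2 * e) by rewrite ler_pM2l//; lra.
move=> h1 h2 h3.
have h4 : q <= p * (q + 2 * e) by lra.
have h5 : p * (2 * e) <= 2 * e by rewrite ler_piMl//; lra.
have eE : 4 * e = q - p * q by rewrite /e; field.
have h6 : p * (q + 2 * e) = p * q + p * (2 * e) by ring.
rewrite h6 in h4.
exact: absurd eE h4 h5 e0.
Qed.

(** On the null event that the supremum is infinite the walk is replaced by 0, so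
    that its supremum is a real random variable. *)
Let Mseq n (w : T) : R := S n w * \1_(~` inf_set) w.

Let Mseq_bounded w : has_ubound (range (Mseq ^~ w)).
Proof.
have [h|h] := pselect (inf_set w).
  exists 0 => _ [n _ <-]; rewrite /Mseq indicE memNset ?mulr0//; exact.
have [k hk] : exists k : nat, ~ exceeds k%:R w.
  by apply: contrapT => /forallNP hh; apply: h => k _; apply: contrapT; exact: hh.
exists k%:R => _ [n _ <-]; rewrite /Mseq indicE mem_set//= mulr1 leNgt.
by apply/negP => Sn; apply: hk; exists n.
Qed.

Let M (w : T) : R := sups (Mseq ^~ w) 0%N.

Let mM : measurable_fun setT M.
Proof.
apply: measurable_fun_sups => // n.
apply: measurable_funM; first exact: (measurable_S xi n).
by apply: measurable_indic; exact: measurableC.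
Qed.

Let M_gt x w : ~ inf_set w -> (x < M w) <-> exceeds x w.
Proof.
move=> hw; have E n : Mseq n w = S n w by rewrite /Mseq indicE mem_set//= mulr1.
split.
  move=> /sup_gt [|y [n _ <-]]; first by exists (Mseq 0%N w), 0%N.
  by rewrite E => h; exists n.
move=> [n _ /= h]; apply: (lt_le_trans h); rewrite -E.
apply: ub_le_sup; last by exists n.
have [b hb] := Mseq_bounded w; exists b => _ [k _ <-]; exact: hb.
Qed.

Lemma supremum_law : exists muM : probability R R,
  forall x, ptail muM x = fine (P (exceeds x)).
Proof.
exists (distribution P (mk_rv mM)) => x; rewrite ptail_distribution; congr fine.
have mE := @measurable_exceeds _ _ _ P xi x.
have mMx : measurable [set w | x < M w].
  rewrite (_ : [set w | _] = M @^-1` `]x, +oo[%classic).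
    by rewrite -[X in measurable X]setTI; apply: mM => //; exact: measurable_itv.
  by apply/seteqP; split=> w /=; rewrite in_itv/= andbT.
rewrite -[X in P X](setIT [set w | x < M w]) -[X in _ = P X](setIT (exceeds x)).
rewrite -(setUv inf_set) !setIUr.
have nul A : measurable A -> P (A `&` inf_set) = 0%E.
  move=> mA; apply/eqP; rewrite eq_le measure_ge0 andbT -sup_infinite_null.
  by apply: le_measure; rewrite ?inE//; exact: measurableI.
have mC : measurable (~` inf_set) by exact: measurableC.
have split A : measurable A -> P (A `&` inf_set `|` A `&` ~` inf_set) = P (A `&` ~` inf_set).
  move=> mA; transitivity (P (A `&` inf_set) + P (A `&` ~` inf_set))%E.
    apply: measureU; [exact: measurableI|exact: measurableI|].
    by apply/seteqP; split=> // w [[_ h] [_]].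
  by rewrite nul// add0e.
rewrite !split//; congr (P _); apply/seteqP; split=> w [h hw]; split => //.
  by apply/M_gt.
by apply/(M_gt x hw).
Qed.

End walk_laws.

Section walk_summary.
Context {R : realType} {d : measure_display} {T : measurableType d}.
Variable P : probability T R.
Variable xi : nat -> {RV P >-> R}.
Hypotheses (xi_indep : mutually_independent xi)
  (xi_ident : identically_distributed xi).
Hypothesis drift : (\int[P]_w (Num.max 0 (xi 0%N w))%:E <
  \int[P]_w (Num.max 0 (- xi 0%N w))%:E)%E.
Hypothesis down_fin : (\int[P]_w (Num.max 0 (- xi 0%N w))%:E < +oo)%E.
Local Notation S := (incr xi 0).

Let p : R := fine (P (\bigcup_n ladder_at xi n)).
Let Phi (x : R) : \bar R := (\int[lebesgue_measure]_(y in `[x, +oo[)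
  (ptail (distribution P (xi 0%N)) y)%:E)%E.

(** What the comparison of tails uses about the walk: the supremum is a geometric
    compound of ladder heights, and the ladder height tail is comparable with the
    integrated tail [Phi] up to a unit shift. *)
Lemma walk_summary : 0 < p -> exists muG muM : probability R R,
  [/\ forall x, (p%:E * (ptail muG x)%:E =
        \sum_(n <oo) P (ladder_at xi n `&` [set w | (x < S n.+1 w)%R]))%E,
      forall x, x < 0 -> ptail muG x = 1,
      forall x, ptail muM x = fine (P (exceeds xi x)),
      forall x, 0 <= x -> ptail muM x = p * sum_tail muG muM x &
      exists b B, [/\ 0 < b, 0 < B, forall x, 0 <= x -> (b%:E * Phi x <= (ptail muG x)%:E)%E
        & forall x, 0 <= x -> ((ptail muG x)%:E <= B%:E * Phi (x - 1))%E]].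
Proof.
move=> p0.
have [muG hG] : exists muG : probability R R, (forall B, measurable B ->
    (p%:E * muG B = \sum_(n <oo) P (ladder_at xi n `&` S n.+1 @^-1` B))%E) /\
    (forall x, 0 <= x -> ((fine (P (exceeds xi x)))%:E =
       p%:E * \int[muG]_u (fine (P (exceeds xi (x - u))))%:E)%E).
  exists (projT1 (cid (ladder_height_law p0))); split.
    exact: (projT2 (cid (ladder_height_law p0))).1.
  move=> x x0; exact: (renewal_Rt xi_indep xi_ident p0 x0).
have [muM hM] := supremum_law xi_indep xi_ident drift down_fin p0.
have tG x : (p%:E * (ptail muG x)%:E =
    \sum_(n <oo) P (ladder_at xi n `&` [set w | (x < S n.+1 w)%R]))%E.
  rewrite -ptailE hG.1; last exact: measurable_itv.
  apply: eq_eseriesr => n _; congr (P (_ `&` _)).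
  by apply/seteqP; split=> w /=; rewrite in_itv/= andbT.
have [eta [delta [eta0 delta0 hn hd]]] := drop_positive xi_indep xi_ident drift down_fin.
have LS x : 0 <= x -> ladder_sum xi x = (p%:E * (ptail muG x)%:E)%E.
  move=> x0; rewrite tG; apply: eq_eseriesr => n _; congr (P _).
  apply/seteqP; split=> w; first by move=> [An /= h]; split => //; split => //=; exact: le_lt_trans h.
  by move=> [[An _] h].
exists muG, muM; split => //.
- move=> x x0; have := tG x.
  rewrite (_ : (\sum_(n <oo) _)%E = p%:E); last first.
    rewrite -ladder_prob; apply: eq_eseriesr => n _; congr (P _).
    apply/seteqP; split=> w; first by case.
    by move=> [An /= h]; split => //=; exact: lt_trans h.
  rewrite -EFinM => -[] h; apply: (@mulfI _ p); first by rewrite gt_eqF.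
  by rewrite h mulr1.
- move=> x x0; apply: EFin_inj; rewrite hM hG.2// EFinM; congr (_ * _)%E.
  by rewrite sum_tail_int1; apply: eq_integral => u _; rewrite hM.
have En0 : (0 < \int[P]_w (Num.max 0 (- xi 0%N w))%:E)%E.
  apply: le_lt_trans drift; apply: integral_ge0 => w _.
  by rewrite lee_fin le_max lexx.
have fEn : (\int[P]_w (Num.max 0 (- xi 0%N w))%:E)%E \is a fin_num.
  by rewrite ge0_fin_numE// ltW.
have lower x := ladder_sum_ge xi_indep xi_ident eta0 delta0 (hn 0%N) hd down_fin x.
have [C C0 upper] := ladder_sum_le xi_indep xi_ident eta0 delta0 hd.
pose en := fine (\int[P]_w (Num.max 0 (- xi 0%N w))%:E)%E.
have en0 : 0 < en by rewrite /en fine_gt0// En0.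
exists (delta / (en * p)), (C / p); split.
- by rewrite divr_gt0// mulr_gt0.
- by rewrite divr_gt0.
- move=> x x0; rewrite /Phi integrated_tail_excess.
  have := lower x; rewrite LS// -(fineK fEn) -/en => h.
  have -> : ptail muG x = (en * p)^-1 * (en * (p * ptail muG x)).
    by field; rewrite !gt_eqF.
  rewrite (mulrC delta) EFinM -muleA [leRHS]EFinM lee_wpmul2l//.
    by rewrite lee_fin invr_ge0 ltW// mulr_gt0.
- move=> x x0; rewrite /Phi integrated_tail_excess.
  have := upper x; rewrite LS// => h.
  have -> : ptail muG x = p^-1 * (p * ptail muG x) by field; rewrite gt_eqF.
  rewrite (mulrC C) [leLHS]EFinM [in leRHS]EFinM -[leRHS]muleA lee_wpmul2l//.
  by rewrite lee_fin invr_ge0 ltW.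
Qed.

End walk_summary.

(** * Bounding the supremum by the ladder height *)

Section convolution_of_laws.
Context {R : realType}.
Implicit Types mu nu : probability R R.

Let add_pair (u : R * R) : R := u.1 + u.2.

Let measurable_add_pair : measurable_fun [set: R * R] add_pair.
Proof. by apply: measurable_funD; [exact: measurable_fst|exact: measurable_snd]. Qed.

Definition conv mu nu : probability R R :=
  distribution (joint_law mu nu) (mk_rv measurable_add_pair).

Lemma ptail_conv mu nu x : ptail (conv mu nu) x = sum_tail mu nu x.
Proof. by rewrite ptail_distribution. Qed.

Lemma measurable_ptail_sub mu (x : R) :
  measurable_fun setT (fun y : R => (ptail mu (x - y))%:E).
Proof.
apply/measurable_EFinP; apply: measurableT_comp; first exact: measurable_ptail.
exact: measurable_funB.
Qed.

Lemma sum_tail_ge_right mu nu x : (forall z, z < 0 -> ptail nu z = 1) ->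
  ptail mu x <= sum_tail mu nu x.
Proof.
move=> h; rewrite -lee_fin sum_tail_int1 -ptailE.
have mI : measurable (`]x, +oo[%classic : set R) := measurable_itv _.
rewrite -(setIT `]x, +oo[%classic) -integral_indic//.
apply: ge0_le_integral => //.
- by apply/measurable_EFinP.
- exact: measurable_ptail_sub.
move=> y _; rewrite lee_fin indicE; case: (boolP (y \in _)) => [|_]; last exact: ptail_ge0.
by rewrite inE/= in_itv/= andbT => xy; rewrite h// subr_lt0.
Qed.

Lemma sum_tail_neg mu nu x : (forall z, z < 0 -> ptail mu z = 1) ->
  (forall z, z < 0 -> ptail nu z = 1) -> x < 0 -> sum_tail mu nu x = 1.
Proof.
move=> hm hn x0; apply/eqP; rewrite eq_le sum_tail_le1/=.
by rewrite -[leLHS](hm x x0) sum_tail_ge_right.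
Qed.

Lemma sum_tail_mix mu (a b : R) nu nu1 nu2 x : 0 <= a -> 0 <= b ->
  (forall z, ptail nu z = a * ptail nu1 z + b * ptail nu2 z) ->
  sum_tail mu nu x = a * sum_tail mu nu1 x + b * sum_tail mu nu2 x.
Proof.
move=> a0 b0 h; apply: EFin_inj; rewrite EFinD !EFinM !sum_tail_int1.
rewrite -!ge0_integralZl//; try exact: measurable_ptail_sub;
  try (by move=> y _; rewrite lee_fin ptail_ge0).
rewrite -ge0_integralD//.
- by apply: eq_integral => y _; rewrite h EFinD !EFinM.
- by move=> y _; rewrite mule_ge0// lee_fin ptail_ge0.
- by apply: measurable_funeM; exact: measurable_ptail_sub.
- by move=> y _; rewrite mule_ge0// lee_fin ptail_ge0.
- by apply: measurable_funeM; exact: measurable_ptail_sub.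
Qed.

Lemma sum_tail_conv_swap mu nu la x :
  sum_tail mu (conv nu la) x = sum_tail nu (conv mu la) x.
Proof.
apply: EFin_inj.
rewrite (sum_tail_int1 mu (conv nu la)) (sum_tail_int1 nu (conv mu la)).
have mf : measurable_fun [set: R * R]
    (fun u : R * R => (ptail la (x - u.1 - u.2))%:E).
  apply/measurable_EFinP; apply: (measurableT_comp (measurable_ptail la)).
  apply: measurable_funB; last exact: measurable_snd.
  by apply: measurable_funB => //; exact: measurable_fst.
transitivity (\int[mu]_y \int[nu]_z (ptail la (x - y - z))%:E)%E.
  by apply: eq_integral => y _; rewrite ptail_conv sum_tail_int1.
rewrite (@fubini_tonelli _ _ _ _ _ mu nu _ mf); last by move=> u; rewrite lee_fin ptail_ge0.
apply: eq_integral => z _; rewrite ptail_conv sum_tail_int1.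
by apply: eq_integral => y _ /=; congr (ptail la _)%:E; ring.
Qed.

End convolution_of_laws.

Section compound_geometric.
Context {R : realType}.
Variables (G M : probability R R) (p : R).
Hypotheses (p0 : 0 < p) (p1 : p < 1).
Hypotheses (G_neg : forall x, x < 0 -> ptail G x = 1)
  (M_neg : forall x, x < 0 -> ptail M x = 1)
  (G_gt0 : forall x, 0 < ptail G x).
Hypothesis renewal_eq : forall x, 0 <= x -> ptail M x = p * sum_tail G M x.

Lemma ladder_le_sup x : p * ptail G x <= ptail M x.
Proof.
have [x0|x0] := ltP x 0.
  by rewrite M_neg// G_neg// mulr1 ltW.
by rewrite renewal_eq// ler_pM2l// sum_tail_ge_right.
Qed.

Lemma M_gt0 x : 0 < ptail M x.
Proof. by apply: lt_le_trans (ladder_le_sup x); rewrite mulr_gt0. Qed.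

Lemma G_dominated : dominated G M.
Proof.
exists p^-1; first by rewrite invr_gt0.
by move=> x; rewrite ler_pdivlMl//; exact: ladder_le_sup.
Qed.

(** Comparison principle: the kernel [p * G] has mass [p < 1], so iterating it
    shows that the tail of [M] is at most [V + p ^+ n] for every [n]. *)
Lemma supersolution_bound (V : R -> \bar R) (x0 : R) : 0 <= x0 ->
  measurable_fun setT V -> (forall x, (0 <= V x)%E) ->
  (forall x, x < x0 -> ((ptail M x)%:E <= V x)%E) ->
  (forall x, x0 <= x -> (p%:E * \int[G]_y V (x - y)%R <= V x)%E) ->
  forall x, ((ptail M x)%:E <= V x)%E.
Proof.
move=> x00 mV V0 hlt hge.
have h (n : nat) x : ((ptail M x)%:E <= V x + (p ^+ n)%:E)%E.
  elim: n x => [|n IH] x.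
    rewrite expr0; apply: (@le_trans _ _ 1%E); first by rewrite lee_fin ptail_le1.
    by rewrite leeDr.
  have [xx0|xx0] := ltP x x0.
    apply: (le_trans (hlt _ xx0)); rewrite leeDl// lee_fin.
    by rewrite exprn_ge0 ?(ltW p0).
  rewrite renewal_eq; last exact: le_trans xx0.
  apply: (@le_trans _ _ (p%:E * \int[G]_y V (x - y)%R + (p ^+ n.+1)%:E)%E); last first.
    by rewrite leeD2r// hge.
  rewrite exprS !EFinM -ge0_muleDr ?lee_fin ?exprn_ge0 ?(ltW p0)//; last first.
    by apply: integral_ge0 => y _; exact: V0.
  rewrite lee_wpmul2l ?lee_fin ?(ltW p0)// sum_tail_int1.
  have -> : ((p ^+ n)%:E = \int[G]_y (p ^+ n)%:E)%E.
    by rewrite integral_cst// [X in (_ * X)%E]probability_setT mule1.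
  have mVx : measurable_fun setT (fun y : R => V (x - y)%R).
    by apply: (measurableT_comp mV); exact: measurable_funB.
  rewrite -ge0_integralD//; last by move=> y _; rewrite lee_fin exprn_ge0 ?(ltW p0).
  apply: ge0_le_integral => //.
  - by move=> y _; rewrite lee_fin ptail_ge0.
  - exact: measurable_ptail_sub.
  - exact: emeasurable_funD.
move=> x; have [->|Vfin] := eqVneq (V x) +oo%E; first by rewrite leey.
have fV : V x \is a fin_num by rewrite ge0_fin_numE// lt_neqAle Vfin leey.
rewrite -(fineK fV) lee_fin leNgt; apply/negP => hlt'.
have e0 : 0 < ptail M x - fine (V x) by rewrite subr_gt0.
have : (p ^+ n)%R @[n --> \oo] --> (0 : R).
  by apply: cvg_expr; rewrite ger0_norm ?ltW.
move=> /cvgrPdist_lt/(_ _ e0)[N _ /(_ N (leqnn _))].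
rewrite /= sub0r normrN ger0_norm ?exprn_ge0 ?(ltW p0)// => hN.
have := h N x; rewrite -(fineK fV) -EFinD lee_fin; lra.
Qed.

(** Take [V = 1] on the negative half-line and [V = A * ptail G] on the other one.
    Then [p * G] applied to [V] is, beyond [x0], at most
    [(p + p * A * (r - 1)) * ptail G], which is at most [V] for large [A] because
    [p * (r - 1) < 1]; before [x0] a large [A] makes [V] at least 1. *)
Lemma kesten_bound (r x0 : R) : p * (r - 1) < 1 ->
  (forall x, x0 <= x -> sum_tail G G x <= r * ptail G x) -> dominated M G.
Proof.
move=> hr hx0.
pose t := Num.max x0 0.
have t0 : 0 <= t by rewrite le_max lexx orbT.
pose A := Num.max (ptail G t)^-1 (p / (1 - p * (r - 1))).
have A1 : 1 <= A.
  by rewrite le_max invf_ge1 ?ptail_le1.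
have Ap : p + p * A * (r - 1) <= A.
  have : p / (1 - p * (r - 1)) <= A by rewrite le_max lexx orbT.
  by rewrite ler_pdivrMr ?subr_gt0//; lra.
have A0 : 0 < A by lra.
exists A => // x.
pose V (x : R) : R := A * ptail G x - (A - 1) * \1_(`]-oo, 0%R[%classic : set R) x.
have V_neg z : z < 0 -> V z = 1.
  by move=> z0; rewrite /V G_neg// indicE mem_set/= ?in_itv//=; ring.
have V_pos z : 0 <= z -> V z = A * ptail G z.
  move=> z0; rewrite /V indicE memNset/= ?mulr0 ?subr0//.
  by rewrite in_itv/= ltNge z0.
have V0 z : 0 <= V z.
  by have [/V_neg->//|/V_pos->] := ltP z 0; rewrite mulr_ge0 ?ptail_ge0// ltW.
have mV : measurable_fun setT V.
  by apply: measurable_funB; apply: measurable_funM => //; exact: measurable_ptail.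
have VG z : 0 <= z ->
    (\int[G]_y (V (z - y))%:E + ((A - 1) * ptail G z)%:E = (A * sum_tail G G z)%:E)%E.
  move=> z0.
  have mI : measurable (`]z, +oo[%classic : set R) := measurable_itv _.
  have mVz : measurable_fun setT (fun y : R => (V (z - y))%:E).
    by apply/measurable_EFinP; apply: measurableT_comp => //; exact: measurable_funB.
  have -> : (((A - 1) * ptail G z)%:E = \int[G]_y ((A - 1)%:E * (\1_(`]z, +oo[%classic : set R) y)%:E))%E.
    rewrite ge0_integralZl//; last by rewrite lee_fin subr_ge0.
      by rewrite integral_indic// setIT EFinM -ptailE.
    by apply/measurable_EFinP.
  rewrite -ge0_integralD//; last 3 first.
  - by move=> y _; rewrite lee_fin.
  - by move=> y _; rewrite mule_ge0// lee_fin ?subr_ge0// indicE.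
  - by apply: measurable_funeM; apply/measurable_EFinP.
  rewrite EFinM sum_tail_int1 -ge0_integralZl//; last 3 first.
  - exact: measurable_ptail_sub.
  - by move=> y _; rewrite lee_fin ptail_ge0.
  - by rewrite lee_fin ltW.
  apply: eq_integral => y _; rewrite -!EFinM -EFinD; congr EFin.
  have [yz|yz] := ltP (z - y) 0.
    rewrite V_neg// G_neg// indicE mem_set/= ?in_itv/= ?andbT; last by rewrite -subr_lt0.
    by ring.
  rewrite V_pos// indicE memNset/= ?mulr0 ?addr0//.
  by rewrite in_itv/= andbT -subr_lt0 ltNge yz.
have MV z : ((ptail M z)%:E <= (V z)%:E)%E.
  apply: (supersolution_bound t0 (V := fun z => (V z)%:E)).
  - exact/measurable_EFinP.
  - by move=> y; rewrite lee_fin.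
  - move=> y yt; have [y0|y0] := ltP y 0; first by rewrite V_neg// lee_fin ptail_le1.
    rewrite V_pos// lee_fin; apply: (le_trans (ptail_le1 _ _)).
    apply: (@le_trans _ _ ((ptail G t)^-1 * ptail G y)).
      by rewrite ler_pdivlMl// mulr1 ptail_le// ltW.
    by rewrite ler_wpM2r ?ptail_ge0// le_max lexx.
  - move=> y ty; have y0 : 0 <= y := le_trans t0 ty.
    have hr2 : sum_tail G G y <= r * ptail G y.
      by apply: hx0; apply: le_trans ty; rewrite le_max lexx.
    have := VG y y0; set I := (\int[G]_y0 _)%E => E.
    have fI : I \is a fin_num.
      by move: (erefl (A * sum_tail G G y)%:E); rewrite -{1}E; case: (I).
    move: E; rewrite -(fineK fI) -EFinD => -[] E.
    rewrite -EFinM lee_fin V_pos//.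
    have -> : fine I = A * sum_tail G G y - (A - 1) * ptail G y by lra.
    have h1 : p * (A * sum_tail G G y) <= p * (A * (r * ptail G y)).
      by rewrite ler_wpM2l ?(ltW p0)// ler_wpM2l ?(ltW A0).
    have h2 : (p + p * A * (r - 1)) * ptail G y <= A * ptail G y.
      by rewrite ler_wpM2r ?ptail_ge0.
    by lra.
have := MV x; rewrite lee_fin => /le_trans; apply.
have [x0'|x0'] := ltP x 0; last by rewrite V_pos.
by rewrite V_neg// G_neg// mulr1.
Qed.

Lemma both_tail_le mu nu K L x : K <= L ->
  both_tail mu nu L x <= both_tail mu nu K x :> R.
Proof.
move=> KL; rewrite -lee_fin -!both_tailE; apply: (@le_measure _ _ _ (joint_law mu nu)); rewrite ?inE.
- exact: measurable_both_set.
- exact: measurable_both_set.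
- by move=> u [h1 h2 h3]; split => //; exact: le_lt_trans KL _.
Qed.

Section truncated_kernel.
Variables (A K theta CK x0 : R).
Hypotheses (A1 : 1 <= A)
  (GK : ptail G K <= theta) (hCK : forall x, ptail G (x - K) <= CK * ptail G x)
  (hb : forall x, x0 <= x -> both_tail G G K x <= theta / 2 * ptail G x)
  (Ax0 : 1 <= A * ptail G x0) (ACK : 2 * CK <= theta * A).

Let B (x : R) : R := Num.min 1 (A * ptail G x).

Let A0 : 0 < A. Proof. exact: lt_le_trans A1. Qed.

Lemma trunc_ge0 x : 0 <= B x.
Proof. by rewrite le_min ler01 mulr_ge0 ?ptail_ge0 ?ltW. Qed.

Lemma trunc_le1 x : B x <= 1.
Proof. by rewrite ge_min lexx. Qed.

Lemma trunc_nonincreasing x y : x <= y -> B y <= B x.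
Proof.
move=> xy; rewrite /B le_min; apply/andP; split; first by rewrite ge_min lexx.
by rewrite ge_min ler_pM2l// ptail_le// orbT.
Qed.

Lemma measurable_trunc : measurable_fun setT B.
Proof. by apply: nonincreasing_measurable => // x y xy; exact: trunc_nonincreasing. Qed.

Let mBx (x : R) : measurable_fun setT (fun y : R => (B (x - y))%:E).
Proof.
apply/measurable_EFinP; apply: (measurableT_comp measurable_trunc).
exact: measurable_funB.
Qed.

Lemma trunc_big_jump x : (\int[G]_(y in `]K, +oo[) (B (x - y))%:E <= (theta * B x)%:E)%E.
Proof.
have mI z : measurable (`]z, +oo[%classic : set R) := measurable_itv _.
have [hA|hA] := leP 1 (A * ptail G x).
  have -> : B x = 1 by rewrite /B (min_idPl hA).
  rewrite mulr1; apply: (@le_trans _ _ (\int[G]_(y in `]K, +oo[) 1)%E).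
    apply: ge0_le_integral => //.
    - by move=> y _; rewrite lee_fin trunc_ge0.
    - exact: measurable_funTS.
    - by move=> y _; rewrite lee_fin trunc_le1.
  by rewrite integral_cst// mul1e; move: GK; rewrite -lee_fin -ptailE.
have -> : B x = A * ptail G x by rewrite /B min_r// ltW.
have x0x : x0 <= x.
  rewrite leNgt; apply/negP => xx0; move: hA; rewrite ltNge => /negP; apply.
  by apply: (le_trans Ax0); rewrite ler_pM2l// ptail_le// ltW.
pose f y := G (xsection (both_set K x) y).
have mf : measurable_fun setT f by apply: measurable_fun_xsection; exact: measurable_both_set.
have f0 y : (0 <= f y)%E by [].
apply: (@le_trans _ _ (\int[G]_y (A%:E * f y + (\1_(`]x - K, +oo[%classic : set R) y)%:E))%E).
  rewrite integral_mkcond; apply: ge0_le_integral => //.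
  - by move=> y _; rewrite patchE; case: ifP => // _; rewrite lee_fin trunc_ge0.
  - by apply/(measurable_restrictT _ _).1 => //; exact: measurable_funTS.
  - apply: emeasurable_funD; first exact: measurable_funeM.
    by apply/measurable_EFinP.
  move=> y _; rewrite patchE; case: ifPn; last first.
    by move=> _; rewrite adde_ge0// ?mule_ge0// lee_fin ?(ltW A0)// indicE.
  rewrite inE/= in_itv/= andbT => Ky.
  have [yx|yx] := ltP (x - K) y.
    rewrite [X in (_ <= _ + X)%E](_ : _ = 1%E); last first.
      by rewrite indicE mem_set//= in_itv/= yx.
    apply: (@le_trans _ _ 1%E); first by rewrite lee_fin trunc_le1.
    by rewrite leeDr// mule_ge0// lee_fin ltW.
  apply: (@le_trans _ _ (A%:E * f y)%E); last by rewrite leeDl// lee_fin indicE.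
  rewrite /f xsection_both_set Ky ptailE -EFinM lee_fin (max_idPr _); last by lra.
  by rewrite ge_min lexx orbT.
rewrite ge0_integralD//; last 3 first.
- by move=> y _; rewrite mule_ge0// lee_fin ltW.
- exact: measurable_funeM.
- by apply/measurable_EFinP.
rewrite ge0_integralZl//; last by rewrite lee_fin ltW.
have -> : (\int[G]_y (\1_(`]x - K, +oo[%classic : set R) y)%:E = (ptail G (x - K))%:E)%E.
  by rewrite integral_indic// setIT -ptailE.
have -> : (\int[G]_y f y)%E = (both_tail G G K x)%:E by rewrite -both_tailE.
rewrite -EFinM -EFinD lee_fin.
have h1 : A * both_tail G G K x <= A * (theta / 2 * ptail G x).
  by rewrite ler_pM2l//; exact: hb.
have h2 : ptail G (x - K) <= theta * A / 2 * ptail G x.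
  by apply: (le_trans (hCK x)); rewrite ler_wpM2r ?ptail_ge0// ler_pdivlMr// mulrC.
have -> : theta * (A * ptail G x) = A * (theta / 2 * ptail G x) + theta * A / 2 * ptail G x.
  by field.
exact: lerD.
Qed.

(** Convolving [B] with [G]: a jump below [K] shifts [B] by at most [K]. If
    [B x = 1], it is enough that a jump above [K] has probability at most [theta].
    Otherwise a jump [y] above [K] with [x - y] above [K] belongs to the event of
    two large summands, of weight [theta / 2]; and a jump above [x - K] has
    probability of order [ptail G x], which is negligible against
    [A * ptail G x] since [A] is large. *)
Lemma trunc_kernel x :
  (\int[G]_y (B (x - y))%:E <= (B (x - K) + theta * B x)%:E)%E.
Proof.
have mI : measurable (`]K, +oo[%classic : set R) := measurable_itv _.
have mC : measurable (~` (`]K, +oo[%classic : set R)) by exact: measurableC.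
rewrite -(setvU `]K, +oo[%classic) ge0_integral_setU//=; last 3 first.
- by rewrite setvU.
- by move=> y _; rewrite lee_fin trunc_ge0.
- by rewrite disj_set2E setICl.
rewrite EFinD leeD//; last exact: trunc_big_jump.
apply: (@le_trans _ _ (\int[G]_(y in ~` `]K, +oo[) (B (x - K))%:E)%E).
  apply: ge0_le_integral => //.
  - by move=> y _; rewrite lee_fin trunc_ge0.
  - exact: measurable_funTS.
  - move=> y /= /negP; rewrite in_itv/= andbT -leNgt => yK.
    by rewrite lee_fin trunc_nonincreasing// lerD2l lerN2.
rewrite integral_cst// -[leRHS]mule1 lee_wpmul2l ?lee_fin ?trunc_ge0//.
by apply: probability_le1.
Qed.

End truncated_kernel.
End compound_geometric.

Section series_bounds.
Context {R : realType}.

Lemma nneseries_shift_le (f : nat -> \bar R) : (forall n, (0 <= f n)%E) ->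
  (\sum_(0 <= j <oo) f j.+1 <= \sum_(0 <= j <oo) f j)%E.
Proof.
move=> f0; apply: lime_le; first exact: is_cvg_nneseries.
apply: nearW => n; apply: (@le_trans _ _ (\sum_(0 <= j < n.+1) f j)%E).
  by rewrite big_nat_recl// leeDr.
exact: nneseries_lim_ge.
Qed.

Lemma geometric_bound (q c : R) (f : nat -> \bar R) : 0 < q -> q < 1 -> 0 <= c ->
  (forall n, (0 <= f n)%E) -> (forall n, (f n <= (q ^+ n * c)%:E)%E) ->
  (\sum_(0 <= j <oo) f j <= (c / (1 - q))%:E)%E.
Proof.
move=> q0 q1 c0 f0 hf; apply: lime_le; first exact: is_cvg_nneseries.
apply: nearW => n; apply: (@le_trans _ _ (c * (1 - q ^+ n) / (1 - q))%:E).
  elim: n => [|n IH]; first by rewrite big_geq// expr0 subrr mulr0 mul0r.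
  rewrite big_nat_recr//=; apply: (le_trans (leeD IH (hf n))).
  rewrite -EFinD lee_fin le_eqVlt; apply/orP; left; apply/eqP.
  by rewrite exprS; field; lra.
rewrite lee_fin ler_pM2r ?invr_gt0 ?subr_gt0//.
by rewrite ler_piMr// gerBl exprn_ge0// ltW.
Qed.

End series_bounds.

Section heavy_ladder.
Context {R : realType}.
Variables (G M : probability R R) (p : R).
Hypotheses (p0 : 0 < p) (p1 : p < 1).
Hypotheses (G_neg : forall x, x < 0 -> ptail G x = 1)
  (G_gt0 : forall x, 0 < ptail G x).
Hypothesis renewal_eq : forall x, 0 <= x -> ptail M x = p * sum_tail G M x.

(** The function [V x], the sum over [j] of [r ^+ j * B (x - j * K)] with [B] as in
    [trunc_kernel], is a supersolution: the shift by [K] is absorbed by a factor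
    [r^-1], and the remainder by [theta]. Since [ptail G (x - j * K)] is at most a
    constant times [ptail G x / ptail G (j * K)] and [ptail G] decays more slowly
    than any exponential, the series is at most a constant times [ptail G]. *)
Lemma heavy_bound : one_big_jump G ->
  (forall s K, 1 < s -> 0 < K -> exists2 C, 0 < C &
    forall j : nat, 1 <= C * s ^+ j * ptail G (j%:R * K)) ->
  dominated M G.
Proof.
move=> GJ heavy; have [D D0 hD] := one_big_jump_sum G_gt0 GJ.
have [bn sb] := GJ.
(* chosen so that r^-1 + theta = 1 + 2 * theta = p^-1 *)
pose theta := (p^-1 - 1) / 2.
have theta0 : 0 < theta by rewrite divr_gt0// subr_gt0 invf_gt1.
pose r := (1 + theta)^-1.
have r0 : 0 < r by rewrite invr_gt0; lra.
have [K1 [x0 hK1]] := bn (theta / 2) ltac:(by rewrite divr_gt0).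
have [K2 hK2] := ptail_cvg0 G theta0.
pose K := Num.max (Num.max K1 K2) 1.
have K0 : 0 < K by rewrite lt_max ltr01 orbT.
have GK : ptail G K <= theta.
  by apply: le_trans hK2; rewrite ptail_le// /K !le_max lexx orbT.
have hb x : x0 <= x -> both_tail G G K x <= theta / 2 * ptail G x.
  by move=> /hK1; apply: le_trans; apply: both_tail_le; rewrite /K !le_max lexx.
have [CK CK0 hCK] := sb K.
pose A := Num.max (Num.max 1 (ptail G x0)^-1) (2 * CK / theta).
have A1 : 1 <= A by rewrite /A !le_max lexx.
have A0 : 0 < A by lra.
have Ax0 : 1 <= A * ptail G x0.
  by rewrite -ler_pdivrMr// div1r /A !le_max lexx orbT.
have ACK : 2 * CK <= theta * A.
  by rewrite [leRHS]mulrC -ler_pdivrMr// /A !le_max lexx orbT.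
have B0 : forall x, 0 <= Num.min 1 (A * ptail G x) := trunc_ge0 G A1.
have B1 x : Num.min 1 (A * ptail G x) <= 1 by rewrite ge_min lexx.
have BA x : Num.min 1 (A * ptail G x) <= A * ptail G x by rewrite ge_min lexx orbT.
have mB := measurable_trunc G A1.
have BK := trunc_kernel A1 GK hCK hb Ax0 ACK.
move: B0 B1 BA mB BK; rewrite /=.
set B := fun x : R => Num.min 1 (A * ptail G x) => B0 B1 BA mB BK.
pose v j x := (r ^+ j * B (x - j%:R * K))%:E.
have v0 j x : (0 <= v j x)%E by rewrite lee_fin mulr_ge0 ?B0// exprn_ge0// ltW.
have mv j : measurable_fun setT (v j).
  apply/measurable_EFinP; apply: measurable_funM => //.
  by apply: (measurableT_comp mB); exact: measurable_funB.
pose V x := (\sum_(0 <= j <oo) v j x)%E.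
have V0 x : (0 <= V x)%E by apply: nneseries_ge0.
have mV : measurable_fun setT V by apply: (@ge0_emeasurable_sum _ _ _ _ _ xpredT).
have MV x : ((ptail M x)%:E <= V x)%E.
  apply: (supersolution_bound p0 p1 renewal_eq (lexx 0) mV V0).
    move=> z z0; apply: (@le_trans _ _ (v 0 z)); last first.
      rewrite -[leLHS]adde0 /V nneseries_recl// leeD2l//.
      by apply: nneseries_ge0.
    rewrite /v expr0 mul1r mul0r subr0 lee_fin /B G_neg// mulr1 min_l//.
    exact: ptail_le1.
  move=> z _; rewrite /V.
  rewrite integral_nneseries//; last first.
    by move=> n; apply: (measurableT_comp (mv n)); exact: measurable_funB.
  have step j : (\int[G]_y v j (z - y)%R <= (r^-1)%:E * v j.+1 z + theta%:E * v j z)%E.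
    have -> : (\int[G]_y v j (z - y)%R = (r ^+ j)%:E * \int[G]_y (B (z - j%:R * K - y)%R)%:E)%E.
      rewrite -ge0_integralZl//.
      - by apply: eq_integral => y _; rewrite /v EFinM; congr (_ * (B _)%:E)%E; ring.
      - apply/measurable_EFinP; apply: (measurableT_comp mB); exact: measurable_funB.
      - by move=> y _; rewrite lee_fin B0.
      - by rewrite lee_fin exprn_ge0// ltW.
    apply: (@le_trans _ _ ((r ^+ j)%:E * (B (z - j%:R * K - K) + theta * B (z - j%:R * K))%:E)%E).
      by rewrite lee_wpmul2l ?BK// lee_fin exprn_ge0// ltW.
    rewrite /v -!EFinM -EFinD lee_fin le_eqVlt; apply/orP; left; apply/eqP.
    have -> : z - j.+1%:R * K = z - j%:R * K - K by rewrite -natr1; ring.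
    by rewrite exprS; field; lra.
  have le1 : (\sum_(0 <= j <oo) \int[G]_y v j (z - y)%R <= ((r^-1)%:E + theta%:E) * V z)%E.
    apply: (@le_trans _ _ (\sum_(0 <= j <oo) ((r^-1)%:E * v j.+1 z + theta%:E * v j z))%E).
      by apply: lee_nneseries => [j _ _|j _]; [apply: integral_ge0|exact: step].
    rewrite nneseriesD; last 2 first.
    - by move=> j _ _; rewrite mule_ge0// lee_fin invr_ge0 ltW.
    - by move=> j _ _; rewrite mule_ge0// lee_fin ltW.
    have r10 : (0 <= (r^-1)%:E)%E by rewrite lee_fin invr_ge0 ltW.
    have t0 : (0 <= theta%:E)%E by rewrite lee_fin ltW.
    rewrite !nneseriesZl// ge0_muleDl//.
    apply: leeD => //; apply: lee_wpmul2l => //.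
    exact: (@nneseries_shift_le _ (fun j => v j z)).
    apply: (@le_trans _ _ (p%:E * (((r^-1)%:E + theta%:E) * V z))%E).
    by rewrite lee_wpmul2l// lee_fin ltW.
  rewrite muleA -EFinD -EFinM (_ : p * _ = 1) ?mul1e//.
  by rewrite /r invrK /theta; field; rewrite gt_eqF.
(* any s with 1 < s < r^-1 makes the geometric ratio r * s less than 1 *)
pose s := 1 + theta / 2.
have s1 : 1 < s by rewrite ltrDl divr_gt0.
have s0 : 0 < s by lra.
have [C C0 hC] := heavy s K s1 K0.
have q1 : r * s < 1 by rewrite /r mulrC ltr_pdivrMr /s; lra.
exists (A * (C * D) / (1 - r * s)); first by rewrite divr_gt0 ?mulr_gt0// subr_gt0.
move=> x; rewrite -lee_fin; apply: (le_trans (MV x)).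
rewrite mulrAC; apply: geometric_bound => //; first by rewrite mulr_gt0.
  by rewrite !mulr_ge0 ?ptail_ge0 ?(ltW A0) ?(ltW C0) ?(ltW D0).
move=> j; rewrite lee_fin exprMn.
have h1 : ptail G (x - j%:R * K) * ptail G (j%:R * K) <= D * ptail G x.
  exact: le_trans (ptail_mul_le _ _ _ _) (hD x).
have h2 : ptail G (x - j%:R * K) <= C * s ^+ j * (D * ptail G x).
  apply: (@le_trans _ _ (ptail G (x - j%:R * K) * (C * s ^+ j * ptail G (j%:R * K)))).
    by rewrite ler_peMr ?ptail_ge0// hC.
  rewrite mulrCA ler_wpM2l// mulr_ge0 ?exprn_ge0 ?(ltW C0) ?(ltW s0)//.
apply: (@le_trans _ _ (r ^+ j * (A * (C * s ^+ j * (D * ptail G x))))).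
  rewrite ler_wpM2l ?exprn_ge0 ?(ltW r0)//; apply: (le_trans (BA _)).
  by rewrite ler_wpM2l ?(ltW A0).
by rewrite le_eqVlt; apply/orP; left; apply/eqP; ring.
Qed.

End heavy_ladder.

Section convolution_powers.
Context {R : realType}.
Variables (G M : probability R R) (p : R).
Hypotheses (p0 : 0 < p) (p1 : p < 1).
Hypotheses (G_neg : forall x, x < 0 -> ptail G x = 1)
  (M_neg : forall x, x < 0 -> ptail M x = 1)
  (G_gt0 : forall x, 0 < ptail G x).
Hypothesis renewal_eq : forall x, 0 <= x -> ptail M x = p * sum_tail G M x.

Definition conv_iter (n : nat) (nu : probability R R) : probability R R :=
  iter n (conv G) nu.

Let delta : probability R R := @dirac _ R (0 : R) R.
Let gamma n := conv_iter n delta.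
Let theta n := conv_iter n M.
Let psi n := conv_iter n (conv M M).

Let deltaE (A : set R) : delta A = ((0 : R) \in A)%:R%:E.
Proof. exact: (@diracE _ R R (0 : R) A). Qed.

Let delta_neg x : x < 0 -> ptail delta x = 1.
Proof. by move=> x0; rewrite /ptail deltaE mem_set//= in_itv/= andbT. Qed.

Let delta_pos x : 0 <= x -> ptail delta x = 0.
Proof. by move=> x0; rewrite /ptail deltaE memNset//= in_itv/= andbT ltNge x0. Qed.

Lemma sum_tail_delta nu x : sum_tail nu delta x = ptail nu x.
Proof.
apply: EFin_inj; rewrite sum_tailC sum_tail_int1.
apply: (etrans (@integral_dirac _ R (0 : R) R setT measurableT
  (fun y : R => (ptail nu (x - y))%:E) (measurable_ptail_sub nu x))).
by rewrite diracT mul1e subr0.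
Qed.

Lemma iter_neg n nu x : (forall z, z < 0 -> ptail nu z = 1) -> x < 0 ->
  ptail (conv_iter n nu) x = 1.
Proof.
move=> nu1; elim: n x => [|n IH] x x0; first exact: nu1.
by rewrite /conv_iter iterS ptail_conv; exact: sum_tail_neg.
Qed.

(** The law of [M] is the mixture of the point mass at 0 and of [conv G M] with
    weights [1 - p] and [p]. Convolving with powers of [G] or with [M] keeps this
    mixture, which yields the two recursions below. *)
Lemma renewal_mix x : ptail M x = (1 - p) * ptail delta x + p * ptail (theta 1) x.
Proof.
rewrite ptail_conv; have [x0|x0] := ltP x 0; last first.
  by rewrite delta_pos// mulr0 add0r renewal_eq.
by rewrite M_neg// delta_neg// sum_tail_neg//; ring.
Qed.

Lemma iter_mix nu nu1 nu2 :
  (forall x, ptail nu x = (1 - p) * ptail nu1 x + p * ptail nu2 x) ->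
  forall n x, ptail (conv_iter n nu) x =
    (1 - p) * ptail (conv_iter n nu1) x + p * ptail (conv_iter n nu2) x.
Proof.
move=> h; elim=> [|n IH] x; first exact: h.
rewrite /conv_iter !iterS !ptail_conv; apply: sum_tail_mix => //.
  by rewrite subr_ge0 ltW.
exact: ltW.
Qed.

Lemma theta_mix n x : ptail (theta n) x = (1 - p) * ptail (gamma n) x + p * ptail (theta n.+1) x.
Proof. by rewrite (iter_mix renewal_mix n) /theta /conv_iter -iterD addn1. Qed.

Lemma psi_mix n x : ptail (psi n) x = (1 - p) * ptail (theta n) x + p * ptail (psi n.+1) x.
Proof.
have h z : ptail (conv M M) z = (1 - p) * ptail M z + p * ptail (psi 1) z.
  rewrite /psi /conv_iter /= !ptail_conv -(sum_tail_delta M) -sum_tail_conv_swap.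
  by apply: sum_tail_mix => //; [rewrite subr_ge0 ltW|exact: ltW|exact: renewal_mix].
by rewrite (iter_mix h n) /psi /conv_iter -iterD addn1.
Qed.

Lemma gamma_neg n x : x < 0 -> ptail (gamma n) x = 1.
Proof. exact: iter_neg. Qed.

Lemma gamma_homo n x : ptail (gamma n) x <= ptail (gamma n.+1) x.
Proof.
rewrite [in leRHS]/gamma /conv_iter iterS ptail_conv sum_tailC.
by apply: sum_tail_ge_right.
Qed.

Lemma gamma1 x : ptail (gamma 1) x = ptail G x.
Proof. by rewrite ptail_conv sum_tail_delta. Qed.

Lemma gamma_ge n x : ptail G x <= ptail (gamma n.+1) x.
Proof.
elim: n => [|n IH]; first by rewrite gamma1.
exact: le_trans IH (gamma_homo _ _).
Qed.

Lemma sup_le_powers n x :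
  ptail M x <= (1 - p ^+ n) * ptail (gamma n) x + p ^+ n * ptail (theta n) x.
Proof.
elim: n => [|n IH]; first by rewrite expr0 subrr mul0r add0r mul1r.
apply: (le_trans IH); rewrite theta_mix exprSr.
have h : (1 - p ^+ n * p) * ptail (gamma n) x <= (1 - p ^+ n * p) * ptail (gamma n.+1) x.
  rewrite ler_wpM2l ?gamma_homo// subr_ge0 -exprSr.
  by rewrite exprn_ile1 ?(ltW p0) ?(ltW p1).
by lra.
Qed.

(** Unrolling [psi_mix], the sum of two independent copies of [M] has a tail at
    least [1 - p] times the sum over [k < n] of [p ^+ k * ptail (theta k)], and
    by [sup_le_powers] each term is at least
    [ptail M - ptail (gamma n)]. *)
Lemma double_sup_ge n x : (1 - p) * n%:R * (ptail M x - ptail (gamma n) x)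
  + p ^+ n * ptail (psi n) x <= sum_tail M M x.
Proof.
elim: n => [|n IH].
  by rewrite mulr0 mul0r add0r expr0 mul1r ptail_conv.
apply: le_trans IH; rewrite (psi_mix n) exprSr -natr1.
have h1 := sup_le_powers n x.
have h2 : ptail M x - ptail (gamma n) x <= p ^+ n * ptail (theta n) x.
  have : 0 <= p ^+ n * ptail (gamma n) x.
    by rewrite mulr_ge0 ?ptail_ge0// exprn_ge0// ltW.
  by lra.
have q0 : 0 < 1 - p by rewrite subr_gt0.
have h3 : (1 - p) * (ptail M x - ptail (gamma n) x) <= (1 - p) * (p ^+ n * ptail (theta n) x).
  by rewrite ler_pM2l.
have h4 : (1 - p) * (n%:R + 1) * ptail (gamma n) x <= (1 - p) * (n%:R + 1) * ptail (gamma n.+1) x.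
  rewrite ler_wpM2l ?gamma_homo// mulr_ge0 ?(ltW q0)// addr_ge0//.
by lra.
Qed.

(** If the tail of the sum of two copies of [M] is at most [C * ptail M], then
    [double_sup_ge] with [(1 - p) * n >= 2 * C] forces
    [ptail M <= 2 * ptail (gamma n)]. *)
Lemma sum_bounded_powers : sum_bounded M -> exists n, dominated M (gamma n.+1).
Proof.
move=> [C C0 hC]; have q0 : 0 < 1 - p by rewrite subr_gt0.
pose n := Num.truncn (2 * C / (1 - p)); exists n, 2 => // x.
have hn : 2 * C <= (1 - p) * n.+1%:R.
  by rewrite [leRHS]mulrC -ler_pdivrMr//; apply: ltW; exact: truncnS_gt.
have h1 := double_sup_ge n.+1 x.
have h2 : 0 <= p ^+ n.+1 * ptail (psi n.+1) x.
  by rewrite mulr_ge0 ?ptail_ge0// exprn_ge0// ltW.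
have h3 := hC x.
have [hM|hM] := leP (ptail M x) (ptail (gamma n.+1) x).
  by have := ptail_ge0 M x; lra.
have h4 : 2 * C * (ptail M x - ptail (gamma n.+1) x) <=
    (1 - p) * n.+1%:R * (ptail M x - ptail (gamma n.+1) x).
  by rewrite ler_wpM2r// subr_ge0 ltW.
have h5 : C * (2 * (ptail M x - ptail (gamma n.+1) x)) <= C * ptail M x by lra.
by rewrite ler_pM2l// in h5; lra.
Qed.

Lemma powers_dominated n : sum_bounded G -> dominated (gamma n) G.
Proof.
move=> [D D0 hD]; elim: n => [|n [C C0 hC]].
  exists 1 => // x; have [x0|x0] := ltP x 0; first by rewrite delta_neg// G_neg// mul1r.
  by rewrite delta_pos// mul1r ptail_ge0.
exists (C * D); first by rewrite mulr_gt0.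
move=> x; rewrite /gamma /conv_iter iterS ptail_conv.
have hG z : ptail G z <= 1 * ptail G z by rewrite mul1r.
apply: (le_trans (sum_tail_cmp x ler01 (ltW C0) hG hC)).
by rewrite mul1r -mulrA ler_pM2l.
Qed.

Lemma powers_dominated_sup n : dominated (gamma n) M.
Proof.
elim: n => [|n [C C0 hC]].
  exists 1 => // x; have [x0|x0] := ltP x 0; first by rewrite delta_neg// M_neg// mul1r.
  by rewrite delta_pos// mul1r ptail_ge0.
exists (C / p + 1); first by rewrite addr_gt0// divr_gt0.
move=> x; rewrite mulrDl mul1r.
have h0 : 0 <= C / p * ptail M x by rewrite mulr_ge0 ?ptail_ge0// divr_ge0 ?ltW.
have [x0|x0] := ltP x 0; first by rewrite gamma_neg// M_neg//; rewrite M_neg// in h0; lra.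
rewrite /gamma /conv_iter iterS ptail_conv.
have hG z : ptail G z <= 1 * ptail G z by rewrite mul1r.
apply: (le_trans (sum_tail_cmp x ler01 (ltW C0) hG hC)).
rewrite mul1r; have := ptail_ge0 M x; rewrite {2}renewal_eq//.
by rewrite mulrA divfK ?gt_eqF//; lra.
Qed.

(** The law [gamma k.+2] is that of a sum of two variables with laws [G] and
    [gamma k.+1], both dominated by [M]. If both are large, the one-big-jump
    property of [M] makes the contribution at most half of [ptail M], which moves
    to the left-hand side; otherwise one of them exceeds [x - K], and the tail of
    [gamma k.+1] dominates that of [G]. *)
Lemma powers_descent k : one_big_jump M ->
  dominated M (gamma k.+2) -> dominated M (gamma k.+1).
Proof.
move=> [bn sb] [C C0 hC]; have [D D0 hD] := powers_dominated_sup k.+1.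
have GM : forall x, ptail G x <= p^-1 * ptail M x.
  move=> x; rewrite ler_pdivlMl//; exact: (ladder_le_sup p0 p1 G_neg M_neg renewal_eq).
pose e := p / (2 * C * D).
have e0 : 0 < e by rewrite divr_gt0// !mulr_gt0.
have [K [x0 hK]] := bn _ e0; have [L L0 hL] := sb K.
have g0 x : 0 < ptail (gamma k.+1) x by exact: lt_le_trans (G_gt0 x) (gamma_ge k x).
apply: (@everywhere_bound _ _ (fun x => ptail M x) (x0 - K) (L * (4 * C))) => //.
  by move=> x; exact: ptail_le1.
move=> x xx0; rewrite -mulrA; have -> : x = (x + K) - K by rewrite addrK.
apply: (le_trans (hL _)); rewrite ler_pM2l//.
set z := x + K; have /hK hz : x0 <= z by rewrite /z -lerBlDr.
have h1 := hC z; rewrite {1}/gamma /conv_iter iterS ptail_conv in h1.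
have h2 := sum_tail_le_both G (gamma k.+1) K z.
have h3 := both_tail_cmp K z (ltac:(by rewrite invr_ge0 ltW) : 0 <= p^-1) (ltW D0) GM hD.
have h4 := gamma_ge k (z - K).
have h5 : C * sum_tail G (gamma k.+1) z <= C * (p^-1 * D * (e * ptail M z) + 2 * ptail (gamma k.+1) (z - K)).
  rewrite ler_pM2l//; apply: (le_trans h2).
  have h6 : p^-1 * D * both_tail M M K z <= p^-1 * D * (e * ptail M z).
    by rewrite ler_wpM2l// mulr_ge0 ?invr_ge0 ?(ltW p0) ?(ltW D0).
  by lra.
have h7 : C * (p^-1 * D * (e * ptail M z)) = ptail M z / 2.
  by rewrite /e; field; rewrite !gt_eqF.
by move: h1 h5 h7; rewrite /gamma /conv_iter iterS; lra.
Qed.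

Lemma sup_dominated_of_sum : sum_bounded M -> sum_bounded G -> dominated M G.
Proof.
move=> /sum_bounded_powers[n [C C0 hC]] /(powers_dominated n.+1)[D D0 hD].
exists (C * D); first by rewrite mulr_gt0.
by move=> x; apply: (le_trans (hC x)); rewrite -mulrA ler_pM2l.
Qed.

Lemma sup_dominated_of_jump : one_big_jump M -> dominated M G.
Proof.
move=> MJ; have M0 := M_gt0 p0 p1 G_neg M_neg G_gt0 renewal_eq.
have [n] := sum_bounded_powers (one_big_jump_sum M0 MJ).
elim: n => [|n IH]; last by move/(powers_descent MJ).
by move=> [C C0 hC]; exists C => // x; rewrite -gamma1.
Qed.

End convolution_powers.

(** * The distribution functions of the supremum, the ladder height and the integrated tail *)

Section law_to_distribution_function.
Context {R : realType}.

Lemma classF_of_law (H : R -> R) (mu : probability R R) :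
  (forall x, ptail mu x = tail H x) -> (forall x, x < 0 -> ptail mu x = 1) ->
  (forall x, 0 < ptail mu x) -> classF H.
Proof.
move=> hH mu_neg mu_pos.
pose X : R -> R := idfun.
pose Xm := HB.pack_for {mfun R >-> R} X (@isMeasurableFun.Build _ _ _ _ X (@measurable_id _ _ setT)).
have HE x : H x = 1 - ptail mu x by rewrite hH /tail opprB addrCA subrr addr0.
have cdfE : H = fine \o cdf (Xm : {RV mu >-> R}).
  apply/funext => x /=; apply: EFin_inj; rewrite HE EFinB -ptailE.
  rewrite [RHS]fineK ?fin_num_measure//.
  transitivity (1 - ccdf (Xm : {RV mu >-> R}) x)%E; first by [].
  by rewrite -(cdf_ccdf_1 (Xm : {RV mu >-> R}) x) addeK ?fin_num_measure.
have cfin x : cdf (Xm : {RV mu >-> R}) x \is a fin_num by exact: fin_num_measure.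
split; last 2 first.
- by move=> x x0; rewrite HE mu_neg// subrr.
- by move=> x; rewrite HE ltrBlDr ltrDl.
split.
- by move=> x y xy; rewrite !HE lerD2l lerN2 ptail_le.
- move=> x; rewrite cdfE; apply: fine_cvg; rewrite /= fineK//.
  exact: cdf_right_continuous.
- rewrite cdfE; apply: fine_cvg; exact: cvg_cdfNy0.
- rewrite cdfE; apply: fine_cvg; exact: cvg_cdfy1.
Qed.

End law_to_distribution_function.

Section ladder_variables.
Context {R : realType} {d : measure_display} {T : measurableType d}.
Variable P : probability T R.
Variables (X W : nat -> {RV P >-> R}) (c : R).
Let xi := Xbar X W c.
Local Notation S := (incr xi 0).

Lemma SbarE n w : Sbar X W c n w = S n w.
Proof. by rewrite /Sbar /incr add0n big_mkord. Qed.

Lemma tail_F_M x : tail (F_M X W c) x = fine (P (exceeds xi x)).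
Proof.
have mE := measurable_exceeds xi x.
rewrite /tail /F_M (_ : [set w | _] = ~` exceeds xi x).
  rewrite probability_setC// fineB ?fin_num_measure//=.
  by rewrite opprB addrCA subrr addr0.
apply/seteqP; split=> w /=.
  move=> h [n _ /=]; apply/negP; rewrite -leNgt -lee_fin; apply: le_trans h.
  by apply: ereal_sup_ubound; exists n => //; rewrite SbarE.
move=> h; apply: ge_ereal_sup => _ [n _ <-]; rewrite lee_fin SbarE leNgt.
by apply/negP => hn; apply: h; exists n.
Qed.

Lemma tau_plus_ladder n w : ladder_at xi n w -> tau_plus X W c w = n.+1%:R%:E.
Proof.
move=> [An /= Sn]; apply/eqP; rewrite eq_le; apply/andP; split.
  by apply: ereal_inf_lbound; exists n.+1 => //; split => //; rewrite SbarE.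
apply: le_ereal_inf_tmp => _ [m [m1 Sm] <-]; rewrite lee_fin ler_nat ltnNge.
apply/negP => mn; move: Sm; rewrite SbarE ltNge => /negP; apply.
by move/fmax_leP: An; apply.
Qed.

Lemma tau_plus_fin w : tau_plus X W c w != +oo%E -> exists n, ladder_at xi n w.
Proof.
move=> h; apply: (@exceeds_ladder_at _ _ _ _ xi 0 w (lexx _)).
have [[n [_ Sn]]|hn] := pselect (exists n, (1 <= n)%N /\ 0 < Sbar X W c n w).
  by exists n => //=; rewrite -SbarE.
case/negP: h; apply/eqP; rewrite /tau_plus.
rewrite (_ : [set n | _] = set0) ?image_set0 ?ereal_inf0//.
by apply/seteqP; split=> // n hh; apply: hn; exists n.
Qed.

Lemma p_ladderE : p_ladder X W c = fine (P (\bigcup_n ladder_at xi n)).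
Proof.
congr (fine (P _)); apply/seteqP; split=> w /=.
  move=> h; have [|n An] := @tau_plus_fin w; first by rewrite lt_eqF.
  by exists n.
by move=> [n _ /tau_plus_ladder->]; rewrite ltry.
Qed.

Lemma tail_G_ladder (muG : probability R R) : 0 < p_ladder X W c ->
  (forall x, ((p_ladder X W c)%:E * (ptail muG x)%:E =
     \sum_(n <oo) P (ladder_at xi n `&` [set w | (x < S n.+1 w)%R]))%E) ->
  forall x, ptail muG x = tail (G_ladder X W c) x.
Proof.
move=> p0 h x; rewrite /tail /G_ladder opprB addrCA subrr addr0.
rewrite (_ : [set w | _] =
  \bigcup_n (ladder_at xi n `&` [set w | (x < S n.+1 w)%R])); last first.
  apply/seteqP; split=> w /=.
    move=> [n [hn xS]]; have [|m Am] := @tau_plus_fin w; first by rewrite hn.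
    exists m => //; split => //=; move: hn xS; rewrite (tau_plus_ladder Am) SbarE.
    by move=> [/eqP]; rewrite eqr_nat => /eqP->.
  move=> [n _ [An /= xS]]; exists n.+1; split; first exact: tau_plus_ladder.
  by rewrite SbarE.
rewrite measure_bigcup//; last 2 first.
- move=> n _; apply: measurableI; first exact: measurable_ladder_at.
  exact: measurable_S_gt.
- by apply: (@trivIset_ladder_at _ _ _ _ xi) => n w [].
rewrite (eq_eseriesl (Q := xpredT)); last by move=> n; rewrite in_setT.
by rewrite -h /= mulrAC divff ?mul1r// gt_eqF.
Qed.

Lemma tail_F_Xbar y : tail (F_Xbar X W c) y = ptail (distribution P (xi 0%N)) y.
Proof.
apply: EFin_inj; rewrite -ptailE EFinB /F_Xbar fineK; last exact: fin_num_measure.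
by rewrite -ccdf_1_cdf.
Qed.

(** Since [F_I] tends to 1, the truncation of the integral at 1 is eventually inactive. *)
Lemma tail_F_I_eventually : classF (F_I X W c) ->
  \forall x \near +oo, ((tail (F_I X W c) x)%:E =
    \int[lebesgue_measure]_(y in `[x, +oo[) (ptail (distribution P (xi 0%N)) y)%:E)%E.
Proof.
move=> [[_ _ _ cvg1] _ _].
have : \forall x \near +oo, 0 < F_I X W c x by exact: (cvgr_gt _ cvg1 _ ltr01).
move=> h; near=> x.
have x0 : 0 <= x by near: x; apply: nbhs_pinfty_ge; exact: num_real.
have : 0 < F_I X W c x by near: x.
rewrite /tail /F_I [x < 0]ltNge x0/= opprB addrCA subrr addr0.
have -> : (\int[lebesgue_measure]_(y in `[x, +oo[) (tail (F_Xbar X W c) y)%:E =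
    \int[lebesgue_measure]_(y in `[x, +oo[) (ptail (distribution P (xi 0%N)) y)%:E)%E.
  by apply: eq_integral => y _; rewrite tail_F_Xbar.
set I := (\int[_]_(_ in _) _)%E; rewrite subr_gt0.
have I0 : (0 <= I)%E by apply: integral_ge0 => y _; rewrite lee_fin ptail_ge0.
have [hI|hI] := leP 1%E I; first by rewrite ltxx.
by rewrite fineK// ge0_fin_numE// (lt_trans hI)// ltry.
Unshelve. all: by end_near. Qed.

Hypotheses (intX : P.-integrable setT (EFin \o X 0%N))
  (intW : P.-integrable setT (EFin \o W 0%N)) (neg : ('E_P[Xbar X W c 0%N] < 0)%E).

Let int_xi : P.-integrable setT (EFin \o xi 0%N).
Proof.
apply: (eq_integrable _ ((EFin \o X 0%N) \- (fun w => c%:E * (EFin \o W 0%N) w))%E) => //.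
  by move=> w _; rewrite /xi /Xbar /= [in RHS]mulrC EFinB.
by apply: integrableB => //; exact: integrableZl.
Qed.

Let posE : (\int[P]_w (EFin \o xi 0%N)^\+ w)%E = (\int[P]_w (Num.max 0 (xi 0%N w))%:E)%E.
Proof. by apply: eq_integral => w _; rewrite funeposE EFin_max maxC. Qed.

Let negE : (\int[P]_w (EFin \o xi 0%N)^\- w)%E = (\int[P]_w (Num.max 0 (- xi 0%N w))%:E)%E.
Proof. by apply: eq_integral => w _; rewrite funenegE EFin_max maxC. Qed.

Lemma step_down_fin : (\int[P]_w (Num.max 0 (- xi 0%N w))%:E < +oo)%E.
Proof. by rewrite -negE ltey_eq (integrable_neg_fin_num _ int_xi). Qed.

Lemma step_drift : (\int[P]_w (Num.max 0 (xi 0%N w))%:E <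
  \int[P]_w (Num.max 0 (- xi 0%N w))%:E)%E.
Proof.
rewrite -negE -posE -sube_lt0; last first.
  by rewrite (integrable_neg_fin_num _ int_xi)// orbT.
by rewrite -integralE; move: neg; rewrite unlock.
Qed.

End ladder_variables.

(** * Asymptotic classes in terms of laws *)

Section tail_ratios.
Context {R : realType}.
Implicit Types (f g : R -> R) (mu nu : probability R R).

Lemma near_pinfty_ge (Q : R -> Prop) : (\forall x \near +oo, Q x) ->
  exists x0, forall x, x0 <= x -> Q x.
Proof.
move=> [x0 [_ h]]; exists (x0 + 1) => x hx; apply: h.
by apply: lt_le_trans hx; rewrite ltrDl.
Qed.

Lemma limsup_ratio_fin f g : (forall x, 0 < g x) -> (limsup_ratio f g < +oo)%E ->
  exists2 C, 0 < C & exists x0, forall x, x0 <= x -> f x <= C * g x.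
Proof.
move=> g0 h; have [a ha] : exists a : R, (limsup_ratio f g < a%:E)%E.
  move: h; case: (limsup_ratio f g) => [l _|//|_]; last by exists 0; rewrite ltNye.
  by exists (l + 1); rewrite lte_fin ltrDl.
exists (Num.max a 1); first by rewrite lt_max ltr01 orbT.
have [x0 hx0] := near_pinfty_ge (limf_esup_lt_near ha).
exists x0 => x /hx0; rewrite lte_fin ltr_pdivrMr// => /ltW /le_trans; apply.
by rewrite ler_pM2r// le_max lexx.
Qed.

Lemma asymp_equiv_dominated f g (A B : R) : (forall x, 0 < g x) -> 0 < A ->
  (forall x, A * g x <= f x) -> (forall x, f x <= B * g x) -> asymp_equiv f g.
Proof.
move=> g0 A0 hA hB; split; last 2 first.
- exact: limf_einf_le_esup.
- apply: (@le_lt_trans _ _ B%:E); last by rewrite ltry.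
  by apply: near_limf_esup_le; apply: nearW => x; rewrite lee_fin ler_pdivrMr.
apply: (@lt_le_trans _ _ A%:E); first by rewrite lte_fin.
by apply: near_limf_einf_ge; apply: nearW => x; rewrite lee_fin ler_pdivlMr.
Qed.

Lemma dominated_asymp mu nu (H K : R -> R) : (forall x, 0 < ptail nu x) ->
  (forall x, ptail mu x = tail H x) -> (forall x, ptail nu x = tail K x) ->
  dominated mu nu -> dominated nu mu -> asymp_equiv (tail H) (tail K).
Proof.
move=> nu0 hH hK [B B0 hB] [A A0 hA].
apply: (@asymp_equiv_dominated _ _ A^-1 B); rewrite ?invr_gt0// => x.
- by rewrite -hK.
- by rewrite -hH -hK ler_pdivrMl.
- by rewrite -hH -hK.
Qed.

Lemma eq_sum_tail mu nu x : (forall x, ptail mu x = ptail nu x) ->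
  sum_tail mu mu x = sum_tail nu nu x.
Proof.
move=> h; apply/eqP; rewrite eq_le; apply/andP; split.
- have := @sum_tail_cmp _ mu nu mu nu 1 1 x ler01 ler01; rewrite !mul1r; apply.
  + by move=> y; rewrite mul1r h.
  + by move=> y; rewrite mul1r h.
- have := @sum_tail_cmp _ nu mu nu mu 1 1 x ler01 ler01; rewrite !mul1r; apply.
  + by move=> y; rewrite mul1r h.
  + by move=> y; rewrite mul1r h.
Qed.

Lemma tail_convolution mu (H : R -> R) x : is_df H ->
  (forall x, ptail mu x = tail H x) -> tail (convolution H H) x = sum_tail mu mu x.
Proof.
move=> dfH h; have [nu [hnu intnu]] := law_of_df_spec dfH.
rewrite (@eq_sum_tail mu nu); last by move=> y; rewrite h hnu.
have HE y : H y = 1 - ptail nu y by rewrite hnu /tail opprB addrCA subrr addr0.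
have mH : measurable_fun setT (fun y : R => (H (x - y))%:E).
  rewrite (_ : (fun y => _) = (fun y => (1 - ptail nu (x - y))%:E)); last first.
    by apply/funext => y; rewrite HE.
  apply/measurable_EFinP; apply: measurable_funB => //.
  by apply/measurable_EFinP; exact: measurable_ptail_sub.
have H0 y : (0 <= (H (x - y))%:E)%E by rewrite lee_fin HE subr_ge0 ptail_le1.
rewrite /tail /convolution intnu//.
have E : (\int[nu]_y (H (x - y))%:E + (sum_tail nu nu x)%:E = 1)%E.
  rewrite sum_tail_int1 -ge0_integralD//.
  - transitivity (\int[nu]_y (cst 1%E) y)%E.
      by apply: eq_integral => y _; rewrite -EFinD HE subrK.
    by rewrite integral_cst// mul1e; exact: probability_setT.
  - by move=> y _; rewrite lee_fin ptail_ge0.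
  - exact: measurable_ptail_sub.
move: E; case: (integral _ _ _) => //= I [E].
by rewrite -E addrC addrK.
Qed.

(** The condition with [lambda = ln s / K], read at the points [j * K]. *)
Lemma kstar_geometric mu nu (H : R -> R) : (forall x, 0 < ptail nu x) ->
  (forall x, ptail mu x = tail H x) -> dominated mu nu -> classKstar H ->
  forall s K, 1 < s -> 0 < K -> exists2 C, 0 < C &
    forall j : nat, 1 <= C * s ^+ j * ptail nu (j%:R * K).
Proof.
move=> nu0 hH [D D0 hD] [_ hk] s K s1 K0.
have s0 : 0 < s by lra.
have l0 : 0 < ln s / K by rewrite divr_gt0// ln_gt0.
have /near_pinfty_ge[x0 hx0] : \forall x \near +oo, 1 <= expR (ln s / K * x) * tail H x.
  by have /cvgryPge := hk _ l0; apply.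
exists (Num.max D (ptail nu x0)^-1); first by rewrite lt_max D0.
move=> j; have sj : 1 <= s ^+ j by rewrite exprn_ege1// ltW.
have [jx|jx] := leP x0 (j%:R * K).
  have := hx0 _ jx; have -> : ln s / K * (j%:R * K) = j%:R * ln s.
    by field; rewrite gt_eqF.
  rewrite expRM_natl lnK ?posrE// -hH => h; apply: (le_trans h).
  apply: (@le_trans _ _ (s ^+ j * (D * ptail nu (j%:R * K)))).
    by rewrite ler_pM2l// exprn_gt0.
  rewrite mulrCA mulrA ler_wpM2r ?ptail_ge0// ler_wpM2r//; first by lra.
  by rewrite le_max lexx.
apply: (@le_trans _ _ ((ptail nu x0)^-1 * ptail nu (j%:R * K))).
  by rewrite ler_pdivlMl// mulr1 ptail_le// ltW.
rewrite ler_wpM2r ?ptail_ge0//.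
apply: (@le_trans _ _ ((ptail nu x0)^-1 * s ^+ j)).
  by rewrite ler_peMr// invr_ge0 ltW.
by rewrite ler_wpM2r ?le_max ?lexx ?orbT//; lra.
Qed.

Lemma classOS_sum_bounded mu (H : R -> R) : (forall x, ptail mu x = tail H x) ->
  classOS H -> sum_bounded mu.
Proof.
move=> hH [FH hOS]; have [mu0 _] := classF_tail FH hH.
have [tH0 dfH] : (forall x, 0 < tail H x) /\ is_df H.
  by split; [move=> x; rewrite -hH|case: FH].
have [C C0 [x0 hC]] := limsup_ratio_fin tH0 hOS.
apply: (@everywhere_bound _ _ (fun x => sum_tail mu mu x) x0 C) => //.
  by move=> x; exact: sum_tail_le1.
by move=> x /hC; rewrite (tail_convolution _ dfH hH) hH.
Qed.

Lemma kesten_condition mu (H : R -> R) (p : R) : classF H ->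
  (forall x, ptail mu x = tail H x) -> 0 < p ->
  (exists eps : R, 0 < eps /\
    (p%:E * (limsup_ratio (tail (convolution H H)) (tail H) + eps%:E - 1) < 1)%E) ->
  exists r x0, p * (r - 1) < 1 /\
    forall x, x0 <= x -> sum_tail mu mu x <= r * ptail mu x.
Proof.
move=> FH hH p0 [e [e0]]; have [mu0 _] := classF_tail FH hH.
have [dfH _ _] := FH.
set c := limsup_ratio _ _ => hc.
(* an infinite upper limit violates the condition; the case -oo allows r = 1 *)
have [r [hr hl]] : exists r : R, p * (r - 1) < 1 /\ (c < r%:E)%E.
  case: c hc => [l| |] hc.
  - by exists (l + e); split; [rewrite -lte_fin; exact: hc|rewrite lte_fin ltrDl].
  - have : (p%:E * +oo < 1)%E := hc.
    by rewrite gt0_muley ?lte_fin// ltNge leey.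
  - by exists 1; rewrite subrr mulr0 ltr01 ltNye.
have [x0 hx0] := near_pinfty_ge (limf_esup_lt_near hl).
exists r, x0; split => // x /hx0.
by rewrite (tail_convolution _ dfH hH) -hH lte_fin ltr_pdivrMr// => /ltW.
Qed.

End tail_ratios.

(** * The equivalence *)

Section main_equivalence.
Context {R : realType}.

(** The shift by 1 between the two bounds is absorbed by the class OL at [- 1]. *)
Lemma comparable_laws (muG muI : probability R R) (Phi : R -> \bar R) (b B : R) (H : R -> R) :
  0 < b -> 0 < B -> (forall x, ptail muI x = tail H x) -> classOL H ->
  (\forall x \near +oo, ((tail H x)%:E = Phi x)%E) ->
  (forall x : R, 0 <= x -> (b%:E * Phi x <= (ptail muG x)%:E)%E) ->
  (forall x : R, 0 <= x -> ((ptail muG x)%:E <= B%:E * Phi (x - 1)%R)%E) ->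
  [/\ forall x, 0 < ptail muG x, dominated muG muI & dominated muI muG].
Proof.
move=> b0 B0 hI [FH OL] /near_pinfty_ge[x0 hx0] hb hB.
have [muI0 _] := classF_tail FH hI.
have tH0 x : 0 < tail H x by rewrite -hI.
have low (x : R) : Num.max x0 0 <= x -> b * ptail muI x <= ptail muG x.
  by rewrite ge_max => /andP[/hx0 h] /hb; rewrite -h -EFinM lee_fin hI.
have muG0 x : 0 < ptail muG x.
  pose y := Num.max (Num.max x0 0) x.
  apply: (@lt_le_trans _ _ (ptail muG y)); last by rewrite ptail_le// le_max lexx orbT.
  by apply: lt_le_trans (low y _); rewrite ?mulr_gt0// le_max lexx.
have [C C0 [x1 hC]] := limsup_ratio_fin tH0 (OL (- 1)).
split => //.
- apply: (@everywhere_bound _ _ (fun x => ptail muG x) (Num.max (Num.max (x0 + 1) 0) x1) (B * C)) => //.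
    by move=> x; exact: ptail_le1.
  move=> x; rewrite !ge_max -andbA => /and3P[h1 h2 /hC h3].
  have := hB _ h2; rewrite -hx0; last by rewrite lerBrDr.
  rewrite -EFinM lee_fin => /le_trans; apply.
  by rewrite -mulrA ler_pM2l// hI.
- apply: (@everywhere_bound _ _ (fun x => ptail muI x) (Num.max x0 0) b^-1) => //.
    by move=> x; exact: ptail_le1.
  by move=> x /low; rewrite ler_pdivlMl.
Qed.

End main_equivalence.

Theorem theorem19 (R : realType) (d : measure_display) (T : measurableType d)
  (P : probability T R) (X W : nat -> {RV P >-> R}) (c : R)
  (iidX : iid X) (iidW : iid W)
  (indepXW : independent_families X W)
  (X_gt0 : forall k, {ae P, forall w, 0 < X k w})
  (W_gt0 : forall k, {ae P, forall w, 0 < W k w})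
  (intX : forall k, P.-integrable setT (EFin \o X k))
  (intW : forall k, P.-integrable setT (EFin \o W k))
  (c_gt0 : 0 < c)
  (a_lt0 : forall k, ('E_P[Xbar X W c k] < 0)%E)
  (p_gt0 : 0 < p_ladder X W c)
  (F_I_OL : classOL (F_I X W c)) :
  let p := p_ladder X W c in
  let FI := F_I X W c in
  let G := G_ladder X W c in
  let FM := F_M X W c in
  let c_G := limsup_ratio (tail (convolution G G)) (tail G) in
  let cond_i :=
    exists eps : R, 0 < eps /\ (p%:E * (c_G + eps%:E - 1) < 1)%E in
  let cond_ii := classOS FM in
  let cond_iii := classJ FI /\ classKstar FI in
  cond_i \/ cond_ii \/ cond_iii ->
  (classJ FI <-> classJ G) /\
  (classJ G <-> classJ FM) /\
  (classJ FI \/ classJ G \/ classJ FM ->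
    asymp_equiv (tail FM) (tail G) /\ asymp_equiv (tail G) (tail FI)).
Proof.
move=> p FI G FM c_G cond_i cond_ii cond_iii cond.
pose xi := Xbar X W c.
have xi_indep : mutually_independent xi := Xbar_indep c iidX iidW indepXW.
have xi_ident : identically_distributed xi := Xbar_ident c iidX iidW indepXW.
have drift := step_drift (intX 0%N) (intW 0%N) (a_lt0 0%N).
have down_fin := step_down_fin c (intX 0%N) (intW 0%N).
have pE : p = fine (P (\bigcup_n ladder_at xi n)) := p_ladderE X W c.
have p1 : p < 1 by rewrite pE; exact: ladder_prob_lt1 drift down_fin.
have p0 : 0 < p := p_gt0.
have [muG [muM [hG G_neg hM renewal [b [B [b0 B0 hb hB]]]]]] :=
  walk_summary xi_indep xi_ident drift down_fin (eq_ind _ (fun q => 0 < q) p0 _ pE).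
rewrite -pE in hG renewal.
have muG_tail : forall x : R, ptail muG x = tail G x := tail_G_ladder p_gt0 hG.
have muM_tail x : ptail muM x = tail FM x by rewrite hM -tail_F_M.
have FFI : classF FI := F_I_OL.1.
have dfI : is_df FI by case: FFI.
have [muI [muI_tail _]] := law_of_df_spec dfI.
have [muI_gt0 _] := classF_tail FFI muI_tail.
have [muG_gt0 GI IG] := comparable_laws b0 B0 muI_tail F_I_OL (tail_F_I_eventually FFI) hb hB.
have M_neg x : x < 0 -> ptail muM x = 1.
  move=> x0; rewrite hM (_ : exceeds xi x = setT) ?probability_setT//.
  by apply/seteqP; split => // w _; exists 0%N => //=; rewrite incr0.
have muM_gt0 := M_gt0 p0 p1 G_neg M_neg muG_gt0 renewal.
have GM : dominated muG muM := G_dominated p0 p1 G_neg M_neg renewal.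
have FG : classF G := classF_of_law muG_tail G_neg muG_gt0.
have FFM : classF FM := classF_of_law muM_tail M_neg muM_gt0.
have JI : classJ FI <-> one_big_jump muI := classJP muI_tail FFI.
have JG : classJ G <-> one_big_jump muG := classJP muG_tail FG.
have JM : classJ FM <-> one_big_jump muM := classJP muM_tail FFM.
have JIG : classJ FI <-> classJ G.
  by rewrite JI JG; split; exact: one_big_jump_dominated.
have MG_of_G : classJ G -> dominated muM muG.
  move=> /JG GJ; case: cond => [hi|[hii|[_ hiii]]].
  - have [r [x0 [hr hx0]]] := kesten_condition FG muG_tail p0 hi.
    exact: (kesten_bound p0 p1 G_neg muG_gt0 renewal hr hx0).
  - apply: (sup_dominated_of_sum p0 p1 G_neg M_neg renewal).
      exact: (classOS_sum_bounded muM_tail hii).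
    exact: one_big_jump_sum.
  - apply: (heavy_bound p0 p1 G_neg muG_gt0 renewal GJ).
    exact: (kstar_geometric muG_gt0 muI_tail IG hiii).
have MG_of_M : classJ FM -> dominated muM muG.
  by move=> /JM; exact: (sup_dominated_of_jump p0 p1 G_neg M_neg muG_gt0 renewal).
have JGM : classJ G <-> classJ FM.
  split=> h; first by apply/JM; apply: (one_big_jump_dominated GM (MG_of_G h)); exact/JG.
  by apply/JG; apply: (one_big_jump_dominated (MG_of_M h) GM); exact/JM.
split => //; split => // hJ.
have MG : dominated muM muG.
  by case: hJ => [/JIG|[|]]; [exact: MG_of_G|exact: MG_of_G|exact: MG_of_M].
split.
  exact: (dominated_asymp muG_gt0 muM_tail muG_tail MG GM).
exact: (dominated_asymp muI_gt0 muG_tail muI_tail GI IG).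
Qed.
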